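(* Let $(\Sigma,g)$ be a Riemannian manifold and $(E,G)$ a Riemannian Lie algebroid over $M$. The Lie algebra of the internal symmetries of the Lie algebroid sigma model with source $(\Sigma,g)$ and target $(E,G)$ is the Lie algebra $\mathrm{iso}(E,G)$ of Killing sections of $(E,G)$.
   Context: A Lie algebroid is a vector bundle $E\to M$ with a Lie bracket $[\cdot,\cdot]$ on its space of smooth sections $\mathrm{Sec}(E)$ and an anchor $\rho:\mathrm{Sec}(E)\to\mathrm{Vect}(M)$ (induced by a vector bundle map $E\to TM$) such that $[u,fv]=\rho(u)[f]\,v+f[u,v]$. With local coordinates $x^A$ on $M$ and a local basis of sections $(s_a)$, the structure functions are given by $[s_a,s_b]=Q_{ab}^c(x)s_c$ and $\rho(s_a)=Q_a^A(x)\frac{\partial}{\partial x^A}$; $(x^A,y^a)$ are the induced coordinates on $E$. Repeated indices are summed. A Riemannian metric on $E$ is a smooth assignment of an inner product to each fibre, $\langle u|v\rangle=G_{ab}(x)u^av^b$ (no compatibility with the Lie algebroid structure is required); $(E,G)$ is then called a Riemannian Lie algebroid. The metric is also regarded as the quadratic function $G=y^ay^bG_{ba}$ on $E$. The tangent lift of $u=u^as_a\in\mathrm{Sec}(E)$ is the vector field on $E$ $$d_T(u)=u^aQ_a^A\frac{\partial}{\partial x^A}+\left(y^aQ_a^A\frac{\partial u^c}{\partial x^A}-y^au^bQ_{ba}^c\right)\frac{\partial}{\partial y^c}.$$ The section $u$ is a Killing section if $\mathcal{L}_uG:=d_T(u)[G]=0$. The Killing sections, with the bracket of $\mathrm{Sec}(E)$,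 form a real Lie algebra denoted $\mathrm{iso}(E,G)$. Sigma model. The fields are the Lie algebroid morphisms $\Phi:T\Sigma\to E$ over maps $\phi:\Sigma\to M$. In local coordinates $(z^i,\delta z^j)$ on $T\Sigma$ one writes $\Phi^*(x^A,y^a)=(\phi^A(z),\delta z^i\chi_i^a(z))$, and the morphism condition is $$\frac{\partial\phi^A}{\partial z^i}=\chi_i^aQ_a^A(\phi),\qquad \chi_j^b\chi_k^cQ_{cb}^a(\phi)=\frac{\partial\chi_k^a}{\partial z^j}-\frac{\partial\chi_j^a}{\partial z^k}.$$ The action of the Lie algebroid sigma model is $$S[\Phi]=\frac12\int_\Sigma dz\,\sqrt{|g|}\;g^{ij}(z)\chi_j^b(z)\chi_i^a(z)G_{ab}(\phi(z)).$$ It is assumed that $\Sigma$ has no boundary (or boundary terms are neglected). Internal symmetries. Each section $u=u^as_a\in\mathrm{Sec}(E)$ determines the infinitesimal field redefinition $$\phi^A\mapsto\phi^A+\epsilon\,u^a(\phi)Q_a^A(\phi),\qquad \chi_i^a\mapsto\chi_i^a+\epsilon\,\chi_i^b\left(Q_b^A(\phi)\frac{\partial u^a}{\partial\phi^A}(\phi)-u^c(\phi)Q_{cb}^a(\phi)\right).$$ It is an internal symmetry if the Lagrangian of $S$ (the integrand above) is invariant to first order in $\epsilon$ for every field configuration. The Lie algebra of internal symmetries consists of the sections $u$ whose field redefinitions are internal symmetries, with the bracket of $\mathrm{Sec}(E)$. *)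

(* Defs.v *)
From HB Require Import structures.
From mathcomp Require Import all_boot all_order all_algebra.
From mathcomp Require Import all_classical all_reals all_analysis.

Set Implicit Arguments.
Unset Strict Implicit.
Unset Printing Implicit Defensive.

Import Order.TTheory GRing.Theory Num.Theory.
Import numFieldNormedType.Exports.

Local Open Scope classical_set_scope.
Local Open Scope ring_scope.

Definition unit_row (R : realType) (n : nat) (i : 'I_n) : 'rV[R]_n :=
  delta_mx ord0 i.

(* C^k for an open set U, through iterated partial derivatives. *)
Fixpoint Ck (R : realType) (n k : nat) (U : set 'rV[R]_n) (f : 'rV[R]_n -> R)
    : Prop :=
  (forall p, U p -> {for p, continuous f}) /\
  match k with
  | 0 => True
  | k'.+1 => forall i : 'I_n,
      (forall p, U p -> derivable f p (unit_row R i)) /\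
      Ck k' U ('D_(unit_row R i) f)
  end.

Definition Cinfty (R : realType) (n : nat) (U : set 'rV[R]_n)
    (f : 'rV[R]_n -> R) : Prop := forall k, Ck k U f.

(* [cmap] and [cinv] are total functions; only their restrictions to [cdom]
   and to the open set [cmap @` cdom] are meaningful. *)
Record chart (R : realType) (n : nat) (T : topologicalType) := Chart {
  cdom : set T;
  cmap : T -> 'rV[R]_n;
  cinv : 'rV[R]_n -> T;
  cdom_open : open cdom;
  cimg_open : open (cmap @` cdom);
  cmapK : forall x, cdom x -> cinv (cmap x) = x;
  cmap_continuous : forall x, cdom x -> {for x, continuous cmap};
  cinv_continuous : forall x, cdom x -> {for cmap x, continuous cinv} }.

Definition transition_smooth (R : realType) (n : nat) (T : topologicalType)
    (c c' : chart R n T) : Prop :=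
  forall i : 'I_n, Cinfty (cmap c @` (cdom c `&` cdom c'))
    (fun p => cmap c' (cinv c p) ord0 i).

(* Manifolds have no boundary; the atlas is the maximal one, so that [atlas]
   contains every smooth local coordinate system. *)
Record manifold (R : realType) (n : nat) := Manifold {
  points :> topologicalType;
  points_hausdorff : hausdorff_space points;
  points_second_countable : @second_countable points;
  atlas : set (chart R n points);
  atlas_cover : forall x, exists2 c, atlas c & cdom c x;
  atlas_compatible : forall c c', atlas c -> atlas c' -> transition_smooth c c';
  atlas_maximal : forall c,
    (forall c', atlas c' -> transition_smooth c c' /\ transition_smooth c' c) ->
    atlas c }.

Section Functions.
Variables (R : realType) (n : nat) (M : manifold R n).

Definition smooth_on (U : set M) (f : M -> R) : Prop :=
  forall c, atlas c -> Cinfty (cmap c @` (U `&` cdom c)) (f \o cinv c).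

Definition smooth_near (x : M) (f : M -> R) : Prop :=
  exists U : set M, [/\ open U, U x & smooth_on U f].

Definition partial (c : chart R n M) (i : 'I_n) (f : M -> R) (x : M) : R :=
  'D_(unit_row R i) (f \o cinv c) (cmap c x).

Definition coordinate (c : chart R n M) (i : 'I_n) : M -> R :=
  fun x => cmap c x ord0 i.

(* Tangent vectors at x are the derivations of germs of smooth functions at x.
   A germ is represented by any total function that is smooth near x; the
   derivation is normalized to vanish on the functions that are not smooth near
   x, so that equal tangent vectors are equal as functionals.  (The Leibniz rule
   makes the value depend on the germ only.) *)
Definition tangent_space (x : M) : set ((M -> R) -> R) :=
  [set D | [/\ forall f, ~ smooth_near x f -> D f = 0,
      forall (a : R) f h, smooth_near x f -> smooth_near x h ->
        D (fun y => a * f y + h y) = a * D f + D h &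
      forall f h, smooth_near x f -> smooth_near x h ->
        D (fun y => f y * h y) = D f * h x + f x * D h]].

Definition coordinate_vector (c : chart R n M) (i : 'I_n) (x : M)
    : (M -> R) -> R :=
  fun f => if `[< smooth_near x f >] then partial c i f x else 0.

End Functions.

Definition inner_product_on (R : realType) (V : lmodType R) (W : set V)
    (B : V -> V -> R) : Prop :=
  [/\ forall (a : R) u v w, W u -> W v -> W w ->
        B (a *: u + v) w = a * B u w + B v w,
      forall u v, W u -> W v -> B u v = B v u &
      forall u, W u -> u != 0 -> 0 < B u u].

Record riemannian_metric (R : realType) (d : nat) (S : manifold R d) :=
  RiemannianMetric {
    gmetric :> forall z : S, ((S -> R) -> R) -> ((S -> R) -> R) -> R;
    gmetric_inner : forall z, inner_product_on (@tangent_space R d S z) (gmetric z);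
    gmetric_smooth : forall c, atlas c -> forall i j,
      smooth_on (cdom c)
        (fun z => gmetric z (coordinate_vector c i z) (coordinate_vector c j z)) }.

Record local_frame (R : realType) (T : topologicalType) (F : T -> vectType R)
    (r : nat) := LocalFrame {
  fdom : set T;
  fsec : 'I_r -> forall x, F x;
  fdom_open : open fdom;
  fsec_basis : forall x, fdom x -> basis_of fullv [tuple fsec a x | a < r] }.

Definition component (R : realType) (T : topologicalType) (F : T -> vectType R)
    (r : nat) (s : local_frame F r) (a : 'I_r) (x : T) (v : F x) : R :=
  coord [tuple fsec s b x | b < r] a v.

Definition frame_smooth (R : realType) (n : nat) (M : manifold R n)
    (F : M -> vectType R) (r : nat) (s s' : local_frame F r) : Prop :=
  forall a b, smooth_on (fdom s `&` fdom s')
    (fun x => component s a (fsec s' b x)).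

(* A vector bundle is given by its fibres and by the maximal family of its
   smooth local frames; the total space is {x : M & fibre x}. *)
Record vector_bundle (R : realType) (n : nat) (M : manifold R n) (r : nat) :=
  VectorBundle {
    fibre :> M -> vectType R;
    frames : set (local_frame fibre r);
    frames_cover : forall x, exists2 s, frames s & fdom s x;
    frames_compatible : forall s s', frames s -> frames s' -> frame_smooth s s';
    frames_maximal : forall s,
      (forall s', frames s' -> frame_smooth s s' /\ frame_smooth s' s) ->
      frames s }.

Section Sections.
Variables (R : realType) (n : nat) (M : manifold R n) (r : nat).
Variable E : vector_bundle M r.

Definition section := forall x : M, E x.

Definition section_smooth_on (U : set M) (u : section) : Prop :=
  forall s, frames s -> forall a,
    smooth_on (U `&` fdom s) (fun x => component s a (u x)).

Definition Sec : set section := [set u | section_smooth_on setT u].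

Definition section_zero : section := fun x => 0.
Definition section_comb (a : R) (u v : section) : section :=
  fun x => a *: u x + v x.
Definition section_scale (f : M -> R) (u : section) : section :=
  fun x => f x *: u x.

End Sections.

(* [bracket] is meaningful on smooth sections only.  The anchor is a linear map
   E_x -> T_xM on every fibre, depending smoothly on x. *)
Record lie_algebroid (R : realType) (n : nat) (M : manifold R n) (r : nat) :=
  LieAlgebroid {
    bundle :> vector_bundle M r;
    anchor : forall x : M, bundle x -> ((M -> R) -> R);
    bracket : section bundle -> section bundle -> section bundle;
    anchor_tangent : forall x (e : bundle x), tangent_space x (anchor e);
    anchor_linear : forall x (a : R) (e e' : bundle x),
      anchor (a *: e + e') = a *: anchor e + anchor e';
    anchor_smooth : forall (U : set M) (u : section bundle) (f : M -> R),
      open U -> section_smooth_on U u -> smooth_on U f ->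
      smooth_on U (fun x => anchor (u x) f);
    bracket_smooth : forall u v, Sec u -> Sec v -> Sec (bracket u v);
    bracket_linear : forall (a : R) u v w, Sec u -> Sec v -> Sec w ->
      bracket (section_comb a u v) w
        = section_comb a (bracket u w) (bracket v w);
    bracket_antisym : forall u v, Sec u -> Sec v -> forall x,
      bracket u v x = - bracket v u x;
    bracket_jacobi : forall u v w, Sec u -> Sec v -> Sec w -> forall x,
      bracket u (bracket v w) x + bracket v (bracket w u) x
        + bracket w (bracket u v) x = 0;
    bracket_leibniz : forall u v f, Sec u -> Sec v -> smooth_on setT f ->
      bracket u (section_scale f v)
        = fun x => anchor (u x) f *: v x + f x *: bracket u v x }.

Section LieAlgebroid.
Variables (R : realType) (n : nat) (M : manifold R n) (r : nat).
Variable E : lie_algebroid M r.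

Definition lie_subalgebra (L : set (section E)) : Prop :=
  [/\ L `<=` @Sec R n M r E, L (@section_zero R n M r E),
      forall (a : R) u v, L u -> L v -> L (section_comb a u v) &
      forall u v, L u -> L v -> L (bracket u v)].

(* Q_{ab}^c at x, where [s_a, s_b] = Q_{ab}^c s_c.  The bracket is defined on
   global sections, so the bracket of the local sections s_a and s_b at x is
   that of any global smooth sections that coincide with them near x. *)
Definition structure_fun (s : local_frame E r) (a b c : 'I_r) (x : M) : R :=
  xget 0 [set q : R | exists u v : section E,
    [/\ Sec u, Sec v,
        \forall y \near x, u y = fsec s a y /\ v y = fsec s b y &
        q = component s c (bracket u v x)]].

(* Q_a^A at x, where rho(s_a) = Q_a^A d/dx^A. *)
Definition anchor_fun (k : chart R n M) (s : local_frame E r)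
    (a : 'I_r) (A : 'I_n) (x : M) : R :=
  anchor (fsec s a x) (coordinate k A).

(* The coordinates of rho(u) on M at x. *)
Definition base_variation (k : chart R n M) (s : local_frame E r)
    (u : section E) (x : M) : 'rV[R]_n :=
  \row_A \sum_a component s a (u x) * anchor_fun k s a A x.

(* Q_b^A d u^a / d x^A - u^c Q_{cb}^a at x *)
Definition fibre_variation (k : chart R n M) (s : local_frame E r)
    (u : section E) (x : M) : 'M[R]_r :=
  \matrix_(b, a)
    (\sum_A anchor_fun k s b A x
              * partial k A (fun x' => component s a (u x')) x
     - \sum_c component s c (u x) * structure_fun s c b a x).

(* The expression of a function F on (the total space of) E in the coordinates
   (x^A, y^a) induced by k and s. *)
Definition local_expression (k : chart R n M) (s : local_frame E r)
    (F : forall x, E x -> R) (p : 'rV[R]_n) (y : 'rV[R]_r) : R :=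
  F (cinv k p) (\sum_a y ord0 a *: fsec s a (cinv k p)).

(* d_T(u)[F] in the coordinates (x^A, y^a), at the point (k(x), y). *)
Definition tangent_lift (k : chart R n M) (s : local_frame E r)
    (u : section E) (F : forall x, E x -> R) (x : M) (y : 'rV[R]_r) : R :=
  \sum_A base_variation k s u x ord0 A
    * 'D_(unit_row R A) (fun p => local_expression k s F p y) (cmap k x)
  + \sum_c (y *m fibre_variation k s u x) ord0 c
    * 'D_(unit_row R c) (fun y' => local_expression k s F (cmap k x) y') y.

Record bundle_metric := BundleMetric {
  bmetric :> forall x : M, E x -> E x -> R;
  bmetric_inner : forall x, inner_product_on setT (@bmetric x);
  bmetric_smooth : forall s, frames s -> forall a b,
    smooth_on (fdom s) (fun x => bmetric (fsec s a x) (fsec s b x)) }.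

Definition killing_sections (G : bundle_metric) : set (section E) :=
  [set u | Sec u /\
    forall k s x (y : 'rV[R]_r),
      atlas k -> frames s -> cdom k x -> fdom s x ->
      tangent_lift k s u (fun x' e => G x' e e) x y = 0].

End LieAlgebroid.

Section SigmaModel.
Variables (R : realType) (d n : nat) (S : manifold R d) (M : manifold R n).
Variables (r : nat) (E : lie_algebroid M r).

(* chi_i^a for a bundle map Phi : TS -> E over phi *)
Definition pullback_component (phi : S -> M)
    (Phi : forall z, ((S -> R) -> R) -> E (phi z))
    (c : chart R d S) (s : local_frame E r) (i : 'I_d) (a : 'I_r) (z : S) : R :=
  component s a (Phi z (coordinate_vector c i z)).

(* Lie algebroid morphisms TS -> E; the bundle map [fmap] is meaningful on
   tangent vectors only. *)
Record field_configuration := FieldConfiguration {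
  fbase : S -> M;
  fmap : forall z, ((S -> R) -> R) -> E (fbase z);
  fmap_linear : forall z (a : R) D D',
    tangent_space z D -> tangent_space z D' ->
    fmap z (a *: D + D') = a *: fmap z D + fmap z D';
  fbase_continuous : continuous fbase;
  fbase_smooth : forall k, atlas k -> forall A,
    smooth_on (fbase @^-1` cdom k) (fun z => cmap k (fbase z) ord0 A);
  fmap_smooth : forall c s, atlas c -> frames s -> forall i a,
    smooth_on (cdom c `&` fbase @^-1` fdom s) (pullback_component fmap c s i a);
  fmap_anchor : forall c k s z, atlas c -> atlas k -> frames s ->
    cdom c z -> cdom k (fbase z) -> fdom s (fbase z) ->
    forall i A,
      partial c i (fun z' => cmap k (fbase z') ord0 A) z
        = \sum_a pullback_component fmap c s i a z
                   * anchor_fun k s a A (fbase z);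
  fmap_bracket : forall c s z, atlas c -> frames s ->
    cdom c z -> fdom s (fbase z) ->
    forall i j a,
      \sum_b \sum_b' pullback_component fmap c s i b z
          * pullback_component fmap c s j b' z
          * structure_fun s b' b a (fbase z)
        = partial c i (pullback_component fmap c s j a) z
          - partial c j (pullback_component fmap c s i a) z }.

Definition gram_matrix (g : riemannian_metric S) (c : chart R d S) (z : S)
    : 'M[R]_d :=
  \matrix_(i, j) g z (coordinate_vector c i z) (coordinate_vector c j z).

(* Invariance to first order in eps means that the derivative at eps = 0 of
   [lagrangian] along the field redefinition vanishes.  [lagrangian] is the
   Lagrangian density of the action, as a function of the values p = (phi^A(z)) and
   X = (chi_i^a(z)) of the fields at z. *)
Definition lagrangian (g : riemannian_metric S) (G : bundle_metric E)
    (c : chart R d S) (k : chart R n M) (s : local_frame E r)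
    (z : S) (p : 'rV[R]_n) (X : 'M[R]_(d, r)) : R :=
  2^-1 * (Num.sqrt `|\det (gram_matrix g c z)| *
    \sum_i \sum_j \sum_a \sum_b
      invmx (gram_matrix g c z) i j * X j b * X i a
        * G (cinv k p) (fsec s a (cinv k p)) (fsec s b (cinv k p))).

Definition internal_symmetries (g : riemannian_metric S) (G : bundle_metric E)
    : set (section E) :=
  [set u | Sec u /\
    forall (Phi : field_configuration) c k s z,
      atlas c -> atlas k -> frames s ->
      cdom c z -> cdom k (fbase Phi z) -> fdom s (fbase Phi z) ->
      let x := fbase Phi z in
      let X := \matrix_(i, a) pullback_component (@fmap Phi) c s i a z in
      is_derive (0 : R) (1 : R)
        (fun eps : R => lagrangian g G c k s z
          (cmap k x + eps *: base_variation k s u x)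
          (X + eps *: (X *m fibre_variation k s u x)))
        0].

End SigmaModel.

(* Main.v *)
(* The variation of the Lagrangian under u at a point of the source is
   1/2 sqrt|g| g^ij B(chi_i, chi_j), where B is the symmetric bilinear form on the
   fibre of E polarizing y |-> d_T(u)[G](y).  A Killing section has B = 0 and is
   therefore an internal symmetry.  Conversely, given x in M and y in E_x, let
   gamma be an integral curve through x of the anchor of the local section with
   constant components y^a; it is the base of an algebroid morphism from an
   interval to E.  Composing it with a function f : Sigma -> R with small values,
   f(z) = 0 and df(z) = dz^1, gives a field configuration on the whole of Sigma
   with chi_i^a(z) = delta_i^1 y^a (df is closed, so the morphism condition holds),
   and the variation of the Lagrangian at z is 1/2 sqrt|g| g^11 d_T(u)[G](y).

   That the Killing sections are closed under the bracket follows from their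
   coordinate-free description rho(u)[G(v, w)] = G([u, v], w) + G(v, [u, w]) for
   all v, w in Sec(E), the Jacobi identity, and the fact that the anchor is a Lie
   algebra morphism.  A tangent vector being a derivation of germs, its expression
   in coordinates rests on Hadamard's lemma. *)
From HB Require Import structures.
Require Import Defs.
From mathcomp Require Import all_boot all_order all_algebra.
From mathcomp Require Import all_classical all_reals all_analysis.
From mathcomp Require Import ring lra.

Set Implicit Arguments.
Unset Strict Implicit.
Unset Printing Implicit Defensive.

Import Order.TTheory GRing.Theory Num.Theory.
Import numFieldNormedType.Exports.

Local Open Scope classical_set_scope.
Local Open Scope ring_scope.

(** * Calculus in R^n *)

Section RowVectors.
Context {R : realType} {n : nat}.
Implicit Types (p v : 'rV[R]_n).

(** Four features of the definitions shape the proof. [Ck] knows derivatives along unit vectors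
    only, so differentiability and the chain rule have to be recovered from continuous partial
    derivatives. The bracket accepts global sections only, and [structure_fun] refers to it through
    extensions of the frame; bump functions supply the extensions and show that the bracket depends
    on germs alone. A field configuration lives on all of Sigma and must satisfy the morphism
    conditions in every chart and every frame; hence the field is built as df tensor Y, with Y the
    section of constant components, and checked through the identity d(F o phi) = rho(Y)(F) df,
    valid for every smooth F on M. The symmetry of second derivatives that the bracket condition
    needs is itself drawn from the expansion of tangent vectors in coordinates. Finally, that the
    anchor respects brackets is not an axiom: it follows from the Jacobi identity applied with a
    section that does not vanish at the point, which is why the Killing condition is tested below on
    such sections. *)

Lemma row_entry_le v i : `|v ord0 i| <= `|v|.
Proof.
rewrite [leRHS]/Num.Def.normr/= mx_normrE.
exact: (le_bigmax _ (fun ij => `|v ij.1 ij.2|) (ord0, i)).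
Qed.

Lemma row_norm_le v (e : R) :
  0 <= e -> (forall i, `|v ord0 i| <= e) -> `|v| <= e.
Proof.
move=> e0 h; rewrite /Num.Def.normr/= mx_normrE bigmax_le // => -[i j] _ /=.
by rewrite (ord1 i).
Qed.

Lemma cvg_row (T : Type) (F : set_system T) (FF : Filter F)
    (f : T -> 'rV[R]_n) v :
  (forall i, (fun t => f t ord0 i) @ F --> v ord0 i) -> f @ F --> v.
Proof.
move=> h; apply/cvgrPdist_le => e e0.
have : \forall t \near F, forall i, `|v ord0 i - f t ord0 i| <= e.
  by apply: filter_forall => i; move/cvgrPdist_le: (h i) => /(_ _ e0).
apply: filterS => t ht; apply: row_norm_le; first exact: ltW.
by move=> i; rewrite !mxE.
Qed.

End RowVectors.

Section Lines.
Context {R : realType} {V W : normedModType R}.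

(** The difference quotients of [f] along [v] are those of a function of one real variable; through
    this identity every directional derivative becomes an ordinary one. *)
Lemma growth_line (f : V -> W) (x v : V) (t : R) :
  (fun h : R => h^-1 *: (((fun s : R => f (s *: v + x)) \o shift t) (h *: 1)
      - f (t *: v + x)))
  = (fun h : R => h^-1 *: ((f \o shift (t *: v + x)) (h *: v)
      - f (t *: v + x))).
Proof. by apply/funext => h /=; rewrite [h%:A]mulr1 scalerDl addrA. Qed.

Lemma is_derive_lineP (f : V -> W) (x v : V) (t : R) (d : W) :
  is_derive (t *: v + x) v f d <-> is_derive t (1 : R) (fun s : R => f (s *: v + x)) d.
Proof.
split=> -[h1 h2]; split.
- by rewrite /derivable growth_line.
- by rewrite /derive growth_line.
- by move: h1; rewrite /derivable growth_line.
- by move: h2; rewrite /derive growth_line.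
Qed.

Lemma is_derive_line0P (f : V -> W) (x v : V) (d : W) :
  is_derive x v f d <-> is_derive (0 : R) (1 : R) (fun s : R => f (s *: v + x)) d.
Proof. by rewrite -is_derive_lineP scale0r add0r. Qed.

End Lines.

(** Locating the intermediate point only by its distance to [a] allows increments of either sign, at
    the price of a derivative on an interval symmetric about [a]. *)
Lemma MVT_sym (R : realType) (f df : R -> R) (a b : R) :
  (forall x, `|x - a| <= `|b - a| -> is_derive x 1 f (df x)) ->
  exists2 c, `|c - a| <= `|b - a| & f b - f a = df c * (b - a).
Proof.
move=> H; have [ab|ba|ab] := ltgtP a b.
- have Hd x : a <= x <= b -> is_derive x 1 f (df x).
    by move=> /andP[ax xb]; apply: H; rewrite !ger0_norm ?subr_ge0 ?lerB// ltW.
  have [||c] := @MVT_segment R f df a b (ltW ab).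
  + by move=> x; rewrite in_itv /= => /andP[ax xb]; apply: Hd; rewrite !ltW.
  + apply: derivable_within_continuous => x; rewrite in_itv /= => axb.
    by have [] := Hd _ axb.
  + rewrite in_itv /= => /andP[ac cb] E; exists c => //.
    by rewrite !ger0_norm ?subr_ge0 ?lerB// ltW.
- have Hd x : b <= x <= a -> is_derive x 1 f (df x).
    move=> /andP[ax xb]; apply: H.
    by rewrite !ler0_norm ?subr_le0 ?lerN2 ?lerB// ltW.
  have [||c] := @MVT_segment R f df b a (ltW ba).
  + by move=> x; rewrite in_itv /= => /andP[ax xb]; apply: Hd; rewrite !ltW.
  + apply: derivable_within_continuous => x; rewrite in_itv /= => axb.
    by have [] := Hd _ axb.
  + rewrite in_itv /= => /andP[ac cb] E; exists c.
      by rewrite !ler0_norm ?subr_le0 ?lerN2 ?lerB// ltW.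
    by rewrite -opprB E -mulrN opprB.
- by exists a; rewrite ?subrr ?ab ?subrr ?mulr0 ?normr0.
Qed.

Lemma near_forall (T : topologicalType) (I : finType) (P : I -> T -> Prop)
    (x : T) :
  (forall i, \forall y \near x, P i y) -> \forall y \near x, forall i, P i y.
Proof. exact: filter_forall. Qed.

Lemma cvg_sumr (R : realType) (T I : Type) (F : set_system T) (FF : Filter F)
    (r : seq I) (P : pred I) (f : I -> T -> R) (l : I -> R) :
  (forall i, f i @ F --> l i) ->
  (fun t => \sum_(i <- r | P i) f i t) @ F --> \sum_(i <- r | P i) l i.
Proof.
move=> h; elim: r => [|i r IH].
  by under eq_fun do rewrite big_nil; rewrite big_nil; exact: cvg_cst.
under eq_fun do rewrite big_cons; rewrite big_cons.
by case: (P i) => //; apply: cvgD.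
Qed.

(** * Differentiability of functions with continuous partial derivatives *)

Section Frechet.
Context {R : realType} {n : nat}.
Variables (f : 'rV[R]_n -> R) (p : 'rV[R]_n).
Hypothesis df : forall i, \forall q \near p, derivable f q (unit_row R i).
Hypothesis cdf : forall i, {for p, continuous ('D_(unit_row R i) f)}.

(** The coordinates of [h] are switched on one at a time. Each step moves along a unit vector, where
    the mean value theorem and the continuity of the partial derivative at [p] apply. *)
Lemma C1_increment (e : R) : 0 < e -> \forall h \near (0 : 'rV[R]_n),
  `|f (h + p) - f p - \sum_i h ord0 i * 'D_(unit_row R i) f p| <= e * `|h|.
Proof.
move=> e0; pose e' := e / n.+1%:R; have e'0 : 0 < e' by rewrite divr_gt0.
have H : \forall q \near p, forall i, derivable f q (unit_row R i) /\
   `|'D_(unit_row R i) f p - 'D_(unit_row R i) f q| <= e'.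
  have H0 i : \forall q \near p, derivable f q (unit_row R i) /\
      `|'D_(unit_row R i) f p - 'D_(unit_row R i) f q| <= e'.
    have := @cdf i; move/cvgrPdist_le/(_ _ e'0).
    by apply: filterS2 (@df i).
  exact: near_forall H0.
move/nbhs_normP : H => [d /= d0 Hd].
apply/nbhs_normP; exists d => //= h /=; rewrite sub0r normrN => hd.
(* The vector [h] truncated to its first [k] coordinates. *)
pose tr k : 'rV[R]_n := \row_i (if (i < k)%N then h ord0 i else 0).
have claim k : (k <= n)%N ->
    `|f (tr k + p) - f p
      - \sum_(i < n | (i < k)%N) h ord0 i * 'D_(unit_row R i) f p|
    <= e' * `|h| * k%:R.
  elim: k => [|k IH] kn.
    have -> : tr 0%N = 0 by apply/rowP => i; rewrite !mxE.
    by rewrite add0r subrr big_pred0 // subr0 normr0 mulr0.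
  pose i0 := Ordinal kn.
  have trS : tr k.+1 = h ord0 i0 *: unit_row R i0 + tr k.
    apply/rowP => i; rewrite !mxE eqxx /= ltnS leq_eqVlt -val_eqE /=.
    have [ik|ik] := eqVneq (i : nat) k; last by rewrite mulr0 add0r.
    have -> : i = i0 by apply/val_inj.
    by rewrite mulr1 /= ltnn addr0.
  pose phi (t : R) := f (t *: unit_row R i0 + (tr k + p)).
  have Hx x : `|x| <= `|h ord0 i0| ->
      `|p - (x *: unit_row R i0 + (tr k + p))| < d.
    move=> xh; apply: le_lt_trans hd.
    rewrite addrA opprD addrCA subrr addr0 normrN.
    apply: row_norm_le => // i; rewrite !mxE eqxx /=.
    have [->|ii0] := eqVneq i i0.
      by rewrite ltnn addr0 mulr1 (le_trans xh) ?row_entry_le.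
    by rewrite mulr0 add0r; case: ifP; rewrite ?normr0// row_entry_le.
  have [|c ch E] := @MVT_sym R phi
      (fun t => 'D_(unit_row R i0) f (t *: unit_row R i0 + (tr k + p)))
      0 (h ord0 i0).
    move=> x; rewrite [x - 0]subr0 [h _ _ - 0]subr0 => xh.
    apply: (is_derive_lineP f (tr k + p) (unit_row R i0) x _).1.
    by apply: derivableP; have [] := Hd _ (Hx _ xh) i0.
  rewrite [c - 0]subr0 [h _ _ - 0]subr0 in ch.
  rewrite [h _ _ - 0]subr0 in E.
  rewrite /phi scale0r add0r addrA -trS in E.
  have [_ Hc] := Hd _ (Hx _ ch) i0.
  rewrite (bigD1 i0) //= (eq_bigl (fun i : 'I_n => (i < k)%N)); last first.
    move=> i; rewrite ltnS leq_eqVlt -val_eqE /=.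
    by have [->|] := eqVneq (i : nat) k; rewrite /= ?andbT// ltnn.
  set Sk := \sum_(i < n | _) _ in IH *.
  set Dp := 'D_(unit_row R i0) f p in Hc *.
  set Dc := 'D_(unit_row R i0) f _ in Hc E.
  have -> : f (tr k.+1 + p) - f p - (h ord0 i0 * Dp + Sk)
     = (f (tr k + p) - f p - Sk) - (Dp - Dc) * h ord0 i0.
    by move: E => /eqP; rewrite subr_eq => /eqP ->; ring.
  rewrite -natr1 mulrDr mulr1 (le_trans (ler_normB _ _)) // lerD ?IH ?(ltnW kn)//.
  by rewrite normrM ler_pM // row_entry_le.
have trn : tr n = h by apply/rowP => i; rewrite !mxE ltn_ord.
have H1 := claim n (leqnn n); rewrite trn (eq_bigl (fun=> true)) in H1; last first.
  by move=> i; rewrite ltn_ord.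
apply: le_trans H1 _; rewrite -mulrA [`|h| * _]mulrC mulrA ler_wpM2r //.
by rewrite /e' mulrAC ler_pdivrMr // ler_wpM2l ?ler_nat // ltW.
Qed.

Let L := fun h : 'rV[R]_n => \sum_i h ord0 i * 'D_(unit_row R i) f p.

Let L_linear : linear L.
Proof.
move=> a u v; rewrite /L scaler_sumr -big_split /=; apply: eq_bigr => i _.
by rewrite !mxE mulrDl scalerAl.
Qed.

Lemma C1_is_diff : is_diff p f L.
Proof.
pose df0 : {linear 'rV[R]_n -> R} := HB.pack L (GRing.isLinear.Build R _ _ _ L L_linear).
have cL : continuous df0.
  move=> x; apply: (@cvg_sumr R _ _ (nbhs x) (nbhs_filter x)) => i.
  by apply: (@cvgMr_tmp _ _ (nbhs x) (nbhs_filter x)); exact: coord_continuous.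
have E : f \o shift p = cst (f p) + df0 +o_ (0 : 'rV[R]_n) id.
  apply/eqaddoP => e e0; near=> h.
  rewrite -![(_ + _ : _ -> _) _]/(_ + _) -![(- _ : _ -> _) _]/(- _) /cst /=.
  rewrite opprD addrA; near: h; exact: C1_increment.
have D := diff_unique cL E.
split; last exact: D.
by apply/diff_locallyP; rewrite D.
Unshelve. all: by end_near. Qed.

Lemma C1_is_derive v : is_derive p v f (L v).
Proof.
have [h1 h2] := C1_is_diff; split; first exact: diff_derivable.
by rewrite deriveE // h2.
Qed.

Lemma C1_is_derive_curve (c : R -> 'rV[R]_n) (c' : 'I_n -> R) (t : R) :
  c t = p -> (forall i, is_derive t 1 (fun s => c s ord0 i) (c' i)) ->
  is_derive t 1 (f \o c) (\sum_i c' i * 'D_(unit_row R i) f p).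
Proof.
move=> ct dc; have [h1 h2] := C1_is_diff.
have dct : derivable c t 1.
  by apply/derivable_mxP => i j; rewrite (ord1 i); have [] := dc j.
have dct' : differentiable c t by apply/derivable1_diffP.
have dfc : differentiable f (c t) by rewrite ct.
split; first by apply/derivable1_diffP; exact: differentiable_comp.
rewrite deriveE; last exact: differentiable_comp.
rewrite diff_comp //= ct h2 -deriveE // derive_mx // /L.
by apply: eq_bigr => i _; rewrite mxE; have [_ ->] := dc i.
Qed.

End Frechet.

Lemma near_eq_continuous (T U : topologicalType) (f g : T -> U) (x : T) :
  (\forall y \near x, f y = g y) -> {for x, continuous f} ->
  {for x, continuous g}.
Proof.
move=> fg fc; have E : f x = g x := nbhs_singleton fg.
rewrite /prop_for /continuous_at -E; apply: cvg_trans fc.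
by apply: near_eq_cvg; apply: filterS fg.
Qed.

Lemma derivable_continuous1 (R : realType) (f : R -> R) (t : R) :
  derivable f t 1 -> {for t, continuous f}.
Proof. by move=> /derivable1_diffP; exact: differentiable_continuous. Qed.

Lemma continuous_for_row (R : realType) (T : topologicalType) (m : nat)
    (f : T -> 'rV[R]_m) (x : T) :
  (forall i, {for x, continuous (fun t => f t ord0 i)}) ->
  {for x, continuous f}.
Proof. by move=> h; apply: cvg_row => i; exact: h. Qed.

Section ContinuousFor.
Context {R : realType} {T : topologicalType}.
Variables (f g : T -> R) (x : T).
Hypotheses (fc : {for x, continuous f}) (gc : {for x, continuous g}).

Lemma continuous_for_add : {for x, continuous (fun y => f y + g y)}.
Proof. exact: cvgD. Qed.
Lemma continuous_for_mul : {for x, continuous (fun y => f y * g y)}.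
Proof. exact: cvgM. Qed.
Lemma continuous_for_inv : f x != 0 -> {for x, continuous (fun y => (f y)^-1)}.
Proof. by move=> f0; apply: cvgV. Qed.

End ContinuousFor.

(** * Locality of smoothness and its stability under algebraic operations *)

Section CkToolkit.
Context {R : realType} {n : nat}.
Implicit Types (U V : set 'rV[R]_n) (f g : 'rV[R]_n -> R).

Lemma Ck_continuous k U f p : Ck k U f -> U p -> {for p, continuous f}.
Proof. by case: k => [|k] [h _]; exact: h. Qed.

Lemma Ck_is_derive k U f p i : Ck k.+1 U f -> U p ->
  is_derive p (unit_row R i) f ('D_(unit_row R i) f p).
Proof. by move=> [_ /(_ i)[h _]] Up; apply/derivableP/h. Qed.

Lemma Ck_derive k U f i : Ck k.+1 U f -> Ck k U ('D_(unit_row R i) f).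
Proof. by move=> [_ /(_ i)[_]]. Qed.

Lemma CkW k U f : Ck k.+1 U f -> Ck k U f.
Proof.
elim: k f => [|k IH] f [fc fd]; split => // i.
by have [h1 h2] := fd i; split => //; exact: IH.
Qed.

Lemma Cinfty_derive U f i : Cinfty U f -> Cinfty U ('D_(unit_row R i) f).
Proof. by move=> h k; exact: Ck_derive (h k.+1). Qed.

(** All the conditions in [Ck] are imposed at single points on the derivatives of a total function,
    so they can be collected from sets [V] that are not even open. *)
Lemma Ck_local k U f :
  (forall p, U p -> exists2 V : set 'rV[R]_n, V p & Ck k V f) -> Ck k U f.
Proof.
elim: k f => [|k IH] f h.
  by split=> // p /h[V Vp fV]; exact: Ck_continuous fV Vp.
split=> [p /h[V Vp fV]|i]; first exact: Ck_continuous fV Vp.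
split=> [p /h[V Vp fV]|]; first by have [] := Ck_is_derive i fV Vp.
by apply: IH => p /h[V Vp fV]; exists V => //; exact: Ck_derive.
Qed.

Lemma Ck_sub k U V f : U `<=` V -> Ck k V f -> Ck k U f.
Proof. by move=> UV fV; apply: Ck_local => p /UV; exists V. Qed.

Lemma Cinfty_local U f :
  (forall p, U p -> exists2 V : set 'rV[R]_n, V p & Cinfty V f) -> Cinfty U f.
Proof. by move=> h k; apply: Ck_local => p /h[V Vp fV]; exists V. Qed.

Lemma Cinfty_sub U V f : U `<=` V -> Cinfty V f -> Cinfty U f.
Proof. by move=> UV fV k; exact: Ck_sub (fV k). Qed.

(** Derivatives at a point of [U] also see values off [U], so the functions must agree near each
    point; for open [U] agreement on [U] suffices, see [eq_open_Cinfty]. *)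
Lemma Ck_eq k U f g : (forall p, U p -> \forall q \near p, f q = g q) ->
  Ck k U f -> Ck k U g.
Proof.
elim: k f g => [|k IH] f g fg [fc fd].
  split=> // p Up; exact: near_eq_continuous (fg _ Up) (fc _ Up).
split=> [p Up|i]; first exact: near_eq_continuous (fg _ Up) (fc _ Up).
have [h1 h2] := fd i; split=> [p Up|].
  exact: near_eq_derivable (fg _ Up) (h1 _ Up).
apply: IH h2 => p Up; have := nbhs_interior (fg _ Up).
by apply: filterS => q; exact: near_eq_derive.
Qed.

Lemma Cinfty_eq U f g : (forall p, U p -> \forall q \near p, f q = g q) ->
  Cinfty U f -> Cinfty U g.
Proof. by move=> fg h k; exact: Ck_eq fg (h k). Qed.

Lemma eq_open_Cinfty U f g : open U -> (forall p, U p -> f p = g p) ->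
  Cinfty U f -> Cinfty U g.
Proof.
move=> oU fg; apply: Cinfty_eq => p Up.
by apply: filterS (open_nbhs_nbhs (conj oU Up)) => q /fg.
Qed.

(** Allows induction on [k] from explicit formulas [df] for the partial derivatives, as the product,
    quotient and chain rules provide them. *)
Lemma CkS_intro k U f (df : 'I_n -> 'rV[R]_n -> R) : open U ->
  (forall p, U p -> {for p, continuous f}) ->
  (forall p i, U p -> is_derive p (unit_row R i) f (df i p)) ->
  (forall i, Ck k U (df i)) -> Ck k.+1 U f.
Proof.
move=> oU fc fd dfk; split=> // i; split=> [p Up|].
  by have [] := fd p i Up.
apply: Ck_eq (dfk i) => p Up.
apply: filterS (open_nbhs_nbhs (conj oU Up)) => q Uq.
by have [_ ->] := fd q i Uq.
Qed.

Lemma Ck_is_derive_row k U f p v : open U -> Ck k.+1 U f -> U p ->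
  is_derive p v f (\sum_i v ord0 i * 'D_(unit_row R i) f p).
Proof.
move=> oU fk Up; apply: C1_is_derive => i.
  apply: filterS (open_nbhs_nbhs (conj oU Up)) => q Uq.
  by have [] := Ck_is_derive i fk Uq.
exact: Ck_continuous (Ck_derive i fk) Up.
Qed.

Lemma Ck_cst k U (a : R) : open U -> Ck k U (fun=> a).
Proof.
move=> oU; elim: k a => [|k IH] a.
  by split=> // p _; exact: cst_continuous.
apply: (CkS_intro (df := fun _ _ => 0)) => // p.
  by move=> _; exact: cst_continuous.
Qed.

Lemma coord_is_derive (p v : 'rV[R]_n) j :
  is_derive p v (fun q : 'rV[R]_n => q ord0 j) (v ord0 j).
Proof.
apply/is_derive_line0P.
have -> : (fun s : R => (s *: v + p) ord0 j)
   = (fun s : R => v ord0 j *: s + p ord0 j).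
  by apply/funext => s; rewrite !mxE mulrC.
apply: is_derive_eq.
by rewrite addr0 [_%:A]mulr1.
Qed.

Lemma Ck_coord k U j : open U -> Ck k U (fun p => p ord0 j).
Proof.
move=> oU; case: k => [|k].
  by split=> // p _; exact: coord_continuous.
apply: (CkS_intro (df := fun i _ => unit_row R i ord0 j)) => //.
- by move=> p _; exact: coord_continuous.
- by move=> p i _; exact: coord_is_derive.
- by move=> i; exact: Ck_cst.
Qed.

Lemma Ck_add k U f g : open U -> Ck k U f -> Ck k U g ->
  Ck k U (fun p => f p + g p).
Proof.
move=> oU; elim: k f g => [|k IH] f g fk gk.
  split=> // p Up.
  by apply: continuous_for_add; [exact: Ck_continuous fk Up|exact: Ck_continuous gk Up].
apply: (CkS_intro
  (df := fun i q => 'D_(unit_row R i) f q + 'D_(unit_row R i) g q)) => //.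
- move=> p Up.
  by apply: continuous_for_add; [exact: Ck_continuous fk Up|exact: Ck_continuous gk Up].
- move=> p i Up; have := Ck_is_derive i fk Up; have := Ck_is_derive i gk Up.
  by move=> ? ?; exact: is_deriveD.
- by move=> i; apply: IH; exact: Ck_derive.
Qed.

Lemma Ck_mul k U f g : open U -> Ck k U f -> Ck k U g ->
  Ck k U (fun p => f p * g p).
Proof.
move=> oU; elim: k f g => [|k IH] f g fk gk.
  split=> // p Up.
  by apply: continuous_for_mul; [exact: Ck_continuous fk Up|exact: Ck_continuous gk Up].
apply: (CkS_intro
  (df := fun i q => f q * 'D_(unit_row R i) g q + g q * 'D_(unit_row R i) f q)) => //.
- move=> p Up.
  by apply: continuous_for_mul; [exact: Ck_continuous fk Up|exact: Ck_continuous gk Up].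
- move=> p i Up; have := Ck_is_derive i fk Up; have := Ck_is_derive i gk Up.
  by move=> ? ?; exact: is_deriveM.
- by move=> i; apply: Ck_add => //; apply: IH; rewrite ?CkW//;
    [exact: CkW|exact: Ck_derive|exact: CkW|exact: Ck_derive].
Qed.

Lemma Ck_sum k U (I : Type) (r : seq I) (P : pred I) (F : I -> 'rV[R]_n -> R) :
  open U -> (forall i, Ck k U (F i)) ->
  Ck k U (fun p => \sum_(i <- r | P i) F i p).
Proof.
move=> oU h; elim: r => [|i r IH].
  by under eq_fun do rewrite big_nil; exact: Ck_cst.
under eq_fun do rewrite big_cons.
by case: (P i) => //; exact: Ck_add.
Qed.

Lemma Ck_inv k U f : open U -> (forall p, U p -> f p != 0) -> Ck k U f ->
  Ck k U (fun p => (f p)^-1).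
Proof.
move=> oU f0; elim: k => [|k IH] fk.
  by split=> // p Up; apply: continuous_for_inv; [exact: Ck_continuous fk Up|exact: f0].
have Ik := IH (CkW fk).
apply: (CkS_intro
  (df := fun i q => (-1) * ((f q)^-1 * ((f q)^-1 * 'D_(unit_row R i) f q)))) => //.
- by move=> p Up; apply: continuous_for_inv; [exact: Ck_continuous fk Up|exact: f0].
- move=> p i Up; have [d1 d2] := Ck_is_derive i fk Up; split.
    by apply: derivableV => //; exact: f0.
  rewrite deriveV //; last exact: f0.
  by rewrite mulN1r mulrA -invfM -expr2 scaleNr.
- move=> i; apply: Ck_mul => //; first exact: Ck_cst.
  by do 2 apply: Ck_mul => //; exact: Ck_derive.
Qed.

Lemma Cinfty_cst U (a : R) : open U -> Cinfty U (fun=> a).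
Proof. by move=> oU k; exact: Ck_cst. Qed.
Lemma Cinfty_coord U j : open U -> Cinfty U (fun p => p ord0 j).
Proof. by move=> oU k; exact: Ck_coord. Qed.
Lemma Cinfty_add U f g : open U -> Cinfty U f -> Cinfty U g ->
  Cinfty U (fun p => f p + g p).
Proof. by move=> oU fU gU k; exact: Ck_add. Qed.
Lemma Cinfty_mul U f g : open U -> Cinfty U f -> Cinfty U g ->
  Cinfty U (fun p => f p * g p).
Proof. by move=> oU fU gU k; exact: Ck_mul. Qed.
Lemma Cinfty_inv U f : open U -> (forall p, U p -> f p != 0) -> Cinfty U f ->
  Cinfty U (fun p => (f p)^-1).
Proof. by move=> oU f0 fU k; exact: Ck_inv. Qed.
Lemma Cinfty_sum U (I : Type) (r : seq I) (P : pred I) (F : I -> 'rV[R]_n -> R) :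
  open U -> (forall i, Cinfty U (F i)) ->
  Cinfty U (fun p => \sum_(i <- r | P i) F i p).
Proof. by move=> oU h k; apply: Ck_sum => // i; exact: h. Qed.

Lemma Cinfty_continuous U f p : Cinfty U f -> U p -> {for p, continuous f}.
Proof. by move=> h; exact: Ck_continuous (h 0%N). Qed.
Lemma Cinfty_is_derive U f p i : Cinfty U f -> U p ->
  is_derive p (unit_row R i) f ('D_(unit_row R i) f p).
Proof. by move=> h; exact: Ck_is_derive (h 1%N). Qed.
Lemma Cinfty_is_derive_row U f p v : open U -> Cinfty U f -> U p ->
  is_derive p v f (\sum_i v ord0 i * 'D_(unit_row R i) f p).
Proof. by move=> oU h; exact: Ck_is_derive_row oU (h 1%N). Qed.

Lemma Cinfty_is_derive_curve U f (c : R -> 'rV[R]_n) (c' : 'I_n -> R) (t : R) :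
  open U -> Cinfty U f -> U (c t) ->
  (forall i, is_derive t 1 (fun s => c s ord0 i) (c' i)) ->
  is_derive t 1 (f \o c) (\sum_i c' i * 'D_(unit_row R i) f (c t)).
Proof.
move=> oU fU Uc; apply: C1_is_derive_curve => // i.
  apply: filterS (open_nbhs_nbhs (conj oU Uc)) => q Uq.
  by have [] := Cinfty_is_derive i fU Uq.
exact: Cinfty_continuous (Cinfty_derive i fU) Uc.
Qed.

End CkToolkit.

(** * Composition of smooth maps *)

Section Composition.
Context {R : realType}.

(** Restricted to the line through [x] directed by [v], the map [g] is a curve, so the chain rule
    along curves applies; of [g] only the derivatives along [v] enter. *)
Lemma Cinfty_is_derive_comp (V : normedModType R) (m : nat)
    (U : set 'rV[R]_m) (f : 'rV[R]_m -> R) (g : V -> 'rV[R]_m)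
    (dg : 'I_m -> R) (x v : V) :
  open U -> Ck 1 U f -> U (g x) ->
  (forall j, is_derive x v (fun y => g y ord0 j) (dg j)) ->
  is_derive x v (f \o g) (\sum_j dg j * 'D_(unit_row R j) f (g x)).
Proof.
move=> oU fU Ug h; apply/is_derive_line0P.
have := @C1_is_derive_curve R m f (g x) _ _ (fun s : R => g (s *: v + x)) dg 0.
apply.
- move=> i; apply: filterS (open_nbhs_nbhs (conj oU Ug)) => q Uq.
  by have [] := Ck_is_derive i fU Uq.
- by move=> i; exact: Ck_continuous (Ck_derive i fU) Ug.
- by rewrite scale0r add0r.
- by move=> i; apply/(is_derive_line0P (fun y => g y ord0 i)).
Qed.

Variable n : nat.

Lemma Ck_comp m k (U : set 'rV[R]_n) (V : set 'rV[R]_m) (f : 'rV[R]_m -> R)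
    (g : 'rV[R]_n -> 'rV[R]_m) :
  open U -> open V -> (forall p, U p -> V (g p)) ->
  (forall j, Ck k U (fun p => g p ord0 j)) -> Ck k V f -> Ck k U (f \o g).
Proof.
move=> oU oV UV; have Hc k' f' : (forall j, Ck k' U (fun p => g p ord0 j)) ->
    Ck k' V f' -> forall p, U p -> {for p, continuous (f' \o g)}.
  move=> gk fk p Up; apply: continuous_comp; last exact: Ck_continuous fk (UV _ Up).
  by apply: continuous_for_row => j; exact: (Ck_continuous (gk j) Up).
elim: k f => [|k IH] f gk fk; first by split=> //; exact: Hc.
apply: (CkS_intro (df := fun i q =>
   \sum_j 'D_(unit_row R i) (fun p => g p ord0 j) q
         * ('D_(unit_row R j) f \o g) q)) => //.
- exact: Hc.
- move=> p i Up; apply: (Cinfty_is_derive_comp oV _ (UV _ Up)) => //.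
    by elim: k fk {IH gk} => // k IH /CkW/IH.
  by move=> j; exact: Ck_is_derive (gk j) Up.
- move=> i; apply: Ck_sum => // j; apply: Ck_mul => //.
    exact: Ck_derive (gk j).
  apply: IH; last exact: Ck_derive.
  by move=> j'; apply: CkW.
Qed.

Lemma Cinfty_comp m (U : set 'rV[R]_n) (V : set 'rV[R]_m) (f : 'rV[R]_m -> R)
    (g : 'rV[R]_n -> 'rV[R]_m) :
  open U -> open V -> (forall p, U p -> V (g p)) ->
  (forall j, Cinfty U (fun p => g p ord0 j)) -> Cinfty V f ->
  Cinfty U (f \o g).
Proof. by move=> oU oV UV gU fV k; apply: (Ck_comp oU oV) => // j; exact: gU. Qed.

(** [F] lists a real function and its successive derivatives. The induction treats all [F m] at
    once, because differentiating [F m \o g] brings in [F m.+1 \o g]. *)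
Lemma Cinfty_comp_real (U : set 'rV[R]_n) (F : nat -> R -> R)
    (g : 'rV[R]_n -> R) :
  open U -> (forall (k : nat) (t : R), is_derive t 1 (F k) (F k.+1 t)) ->
  Cinfty U g -> Cinfty U (F 0%N \o g).
Proof.
move=> oU dF gU k.
have Hc m' p : U p -> {for p, continuous (F m' \o g)}.
  move=> Up; apply: continuous_comp; first exact: Cinfty_continuous gU Up.
  by apply: derivable_continuous1; have [] := dF m' (g p).
suff h m : Ck k U (F m \o g) by exact: h.
elim: k m => [|k IH] m; first by split=> //; exact: Hc.
apply: (CkS_intro (df := fun i q =>
   (F m.+1 \o g) q * 'D_(unit_row R i) g q)) => //.
- exact: Hc.
- move=> p i Up; apply/is_derive_line0P.
  apply: (is_derive1_comp (f := F m) (g := fun s : R => g (s *: unit_row R i + p))).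
    by rewrite scale0r add0r.
  by apply/(is_derive_line0P g); exact: Cinfty_is_derive gU Up.
- by move=> i; apply: Ck_mul => //; exact: Ck_derive (gU k.+1).
Qed.

End Composition.

(** * Primitives and the Hadamard lemma *)

Section Primitive.
Context {R : realType}.
Implicit Types f g F : R -> R.

(* With the base point -2 the derivative is two-sided at all points of [-1, 1]. *)
Definition primitive f (t : R) : R :=
  parameterized_integral lebesgue_measure (-2) t f
  - parameterized_integral lebesgue_measure (-2) 0 f.

Lemma primitive0 f : primitive f 0 = 0.
Proof. exact: subrr. Qed.

Lemma primitive_is_derive f (t : R) : continuous f -> `|t| <= 1 ->
  is_derive t 1 (primitive f) (f t).
Proof.
move=> fc t1.
have t2 : -2 < t by move: t1; rewrite ler_norml => /andP[h _]; lra.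
have tt : t < t + 1 by rewrite ltrDl.
have fi : lebesgue_measure.-integrable [set` Interval (BLeft (-2)) (BRight (t + 1))]
    (EFin \o f).
  apply: continuous_compact_integrable; first exact: segment_compact.
  exact: continuous_subspaceT.
have [d1 d2] := continuous_FTC1_closed tt fi t2 (fc t).
have D : is_derive t 1 (parameterized_integral lebesgue_measure (-2) ^~ f) (f t).
  by apply: DeriveDef; [exact: d1|rewrite -derive1E; exact: d2].
by apply: is_derive_eq; rewrite subr0.
Qed.

(** The mean value theorem for the combination of the three primitives. This is the source of all
    integral estimates: [K = 0] gives linearity, [c = 0] dependence on a parameter, and [c] equal to
    an increment gives differentiation under the integral. *)
Lemma primitive_comb_le (f g h : R -> R) (c K t : R) :
  continuous f -> continuous g -> continuous h -> `|t| <= 1 ->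
  (forall s, `|s| <= `|t| -> `|f s - g s - c * h s| <= K) ->
  `|primitive f t - primitive g t - c * primitive h t| <= K * `|t|.
Proof.
move=> fc gc hc t1 H.
have [|s] := @MVT_sym R (fun s => primitive f s - primitive g s - c * primitive h s)
    (fun s => f s - g s - c * h s) 0 t.
  move=> s; rewrite [s - 0]subr0 [t - 0]subr0 => /le_trans/(_ t1) s1.
  have := primitive_is_derive fc s1; have := primitive_is_derive gc s1.
  have := primitive_is_derive hc s1 => ? ? ?.
  by apply: is_derive_eq.
rewrite [s - 0]subr0 [t - 0]subr0 !primitive0 mulr0 !subr0 => st ->.
by rewrite normrM ler_wpM2r // H.
Qed.

Definition clamp (a b t : R) := Num.max a (Num.min b t).

Lemma clamp_in a b t : a <= b -> a <= clamp a b t <= b.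
Proof. by move=> ab; rewrite /clamp le_max lexx ge_max ab ge_min lexx. Qed.

Lemma clamp_id a b t : a <= t <= b -> clamp a b t = t.
Proof. by move=> /andP[at_ tb]; rewrite /clamp min_r // max_r. Qed.

Lemma clamp_lip a b s t : `|clamp a b s - clamp a b t| <= `|s - t|.
Proof.
wlog st : s t / s <= t => [H|].
  by have [|/ltW] := leP s t => /H //; rewrite distrC [leRHS]distrC.
have [s1 t1] : Num.min b s <= Num.min b t /\ Num.min b t - Num.min b s <= t - s.
  by case: (leP b s); case: (leP b t) => *; split; lra.
by rewrite /clamp; case: (leP a (Num.min b s)); case: (leP a (Num.min b t)) => *;
  rewrite !ler0_norm ?subr_le0 //; lra.
Qed.

Lemma clamp_continuous a b : continuous (clamp a b).
Proof.
move=> t; apply/cvgrPdist_le => e e0.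
have := @cvg_id _ (nbhs t); move/cvgrPdist_le/(_ e e0).
by apply: filterS => s; apply: le_trans; exact: clamp_lip.
Qed.

(** Precomposition with [clamp] turns a function continuous at the points of [0, 1] into one
    continuous on the whole line, as the differentiability of [primitive] demands. *)
Definition integral01 f := primitive (f \o clamp 0 1) 1.

Let cont01 f := forall t : R, 0 <= t <= 1 -> {for t, continuous f}.

Let cont01_clamp f : cont01 f -> continuous (f \o clamp 0 1).
Proof.
move=> fc t; apply: continuous_comp; first exact: clamp_continuous.
by apply: fc; exact: clamp_in.
Qed.

Lemma integral01_comb_le f g h (c K : R) : cont01 f -> cont01 g -> cont01 h ->
  (forall t : R, 0 <= t <= 1 -> `|f t - g t - c * h t| <= K) ->
  `|integral01 f - integral01 g - c * integral01 h| <= K.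
Proof.
move=> /cont01_clamp fc /cont01_clamp gc /cont01_clamp hc H.
have := primitive_comb_le (t := 1) (K := K) (c := c) fc gc hc.
rewrite normr1 mulr1; apply => // s _; apply: H; exact: clamp_in.
Qed.

Lemma integral01_derive F f : cont01 f ->
  (forall t : R, 0 <= t <= 1 -> is_derive t 1 F (f t)) ->
  integral01 f = F 1 - F 0.
Proof.
move=> fc dF; apply/eqP; rewrite -subr_eq0; apply/eqP.
pose H t := primitive (f \o clamp 0 1) t - F t.
have dH (t : R) : 0 <= t <= 1 -> is_derive t 1 H 0.
  move=> t01; have Ft := dF _ t01.
  have t1 : `|t| <= 1 by rewrite ger0_norm; case/andP: t01.
  have := primitive_is_derive (cont01_clamp fc) t1; rewrite /= clamp_id // => ?.
  by apply: is_derive_eq; rewrite subrr.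
have [|||c _] := @MVT_segment R H (fun=> 0) 0 1.
- exact: ler01.
- by move=> x; rewrite in_itv /= => /andP[x0 x1]; apply: dH; rewrite !ltW.
- apply: derivable_within_continuous => x; rewrite in_itv /= => x01.
  by have [] := dH x x01.
rewrite mul0r /H primitive0 /integral01 => E; rewrite -[RHS]E; ring.
Qed.

End Primitive.

Lemma continuous_forP (R : realType) (T : topologicalType) (f : T -> R) (x : T) :
  {for x, continuous f} <->
  forall e, 0 < e -> \forall y \near x, `|f x - f y| <= e.
Proof. exact: cvgrPdist_le. Qed.

Lemma continuous_for_pair (T A B : topologicalType) (f : T -> A) (g : T -> B)
    (x : T) : {for x, continuous f} -> {for x, continuous g} ->
  {for x, continuous (fun y => (f y, g y))}.
Proof. by move=> fc gc; apply: cvg_pair. Qed.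

(** * Integrals depending on a parameter *)

Section ParameterIntegral.
Context {R : realType} {n : nat}.
Variable U : set 'rV[R]_n.
Hypothesis oU : open U.
Implicit Types (phi psi : R -> 'rV[R]_n -> R).

Definition jointly_continuous phi := forall (t : R) x, 0 <= t <= 1 -> U x ->
  {for (t, x), continuous (fun z : R * 'rV[R]_n => phi z.1 z.2)}.

(** Compactness of [0, 1] makes the continuity in the parameter uniform in [t]. *)
Lemma jointly_continuous_tube phi x (e : R) : jointly_continuous phi -> U x ->
  0 < e ->
  \forall y \near x, forall t : R, 0 <= t <= 1 -> `|phi t y - phi t x| <= e.
Proof.
move=> pc Ux e0.
have cov := (compact_near_coveringP _).1 (@segment_compact R 0 1).
have : \forall y \near x, `[0, 1]%classic `<=` (fun t => `|phi t y - phi t x| <= e).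
  apply: (cov _ (nbhs x) (fun y t => `|phi t y - phi t x| <= e) _) => t.
  rewrite /= in_itv /= => t01.
  have := pc t x t01 Ux; move/continuous_forP => /(_ (e / 2)).
  rewrite divr_gt0 // => /(_ isT) [[A B] /= [nA nB] AB].
  exists (A, B) => //= -[t' y] /= [At' By].
  have H1 := AB (t', y) (conj At' By).
  have H2 := AB (t', x) (conj At' (nbhs_singleton nB)).
  rewrite /= in H1 H2; rewrite [e]splitr -(subrKA (phi t x)).
  by rewrite (le_trans (ler_normD _ _)) // lerD // distrC.
by apply: filterS => y H t t01; apply: H; rewrite /= in_itv.
Qed.

Lemma jointly_continuous_section phi x : jointly_continuous phi -> U x ->
  forall t : R, 0 <= t <= 1 -> {for t, continuous (phi^~ x)}.
Proof.
move=> pc Ux t t01.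
apply: (continuous_comp (f := fun s : R => (s, x))
  (g := fun z : R * 'rV[R]_n => phi z.1 z.2)); last exact: pc.
have h : {for t, continuous (fun s : R => (s, x))}.
  by apply: continuous_for_pair; [exact: cvg_id|exact: cst_continuous].
exact: h.
Qed.

Lemma integral01_continuous phi x : jointly_continuous phi -> U x ->
  {for x, continuous (fun y => integral01 (phi^~ y))}.
Proof.
move=> pc Ux; apply/continuous_forP => e e0.
have := jointly_continuous_tube pc Ux e0; apply: filterS2 (open_nbhs_nbhs (conj oU Ux)) => y Uy H.
have := integral01_comb_le (c := 0) (K := e) (jointly_continuous_section pc Ux)
  (jointly_continuous_section pc Uy) (jointly_continuous_section pc Ux).
rewrite mul0r subr0; apply => t t01.
by rewrite mul0r subr0 distrC; exact: H.
Qed.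

(** For each [t], the mean value theorem in the direction [v] compares the increment of [phi t] with
    [h * psi t x]; the tube lemma makes the error at most [e] times the size of [h], uniformly in
    [t], so it survives integration. *)
Lemma integral01_is_derive phi psi x v :
  jointly_continuous phi -> jointly_continuous psi -> U x ->
  (forall (t : R) y, 0 <= t <= 1 -> U y -> is_derive y v (phi t) (psi t y)) ->
  is_derive x v (fun y => integral01 (phi^~ y)) (integral01 (psi^~ x)).
Proof.
move=> pc qc Ux dphi.
suff H : (fun h : R => h^-1 *: (((fun y => integral01 (phi^~ y)) \o shift x) (h *: v)
    - integral01 (phi^~ x))) @ 0^' --> integral01 (psi^~ x).
  split; first by apply/cvg_ex; eexists; exact: H.
  exact: cvg_lim H.
apply/cvgrPdist_le => e e0.
have N : \forall y \near x, U y /\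
    forall t : R, 0 <= t <= 1 -> `|psi t y - psi t x| <= e.
  have := jointly_continuous_tube qc Ux e0.
  by apply: filterS2 (open_nbhs_nbhs (conj oU Ux)).
move/nbhs_normP : N => [d /= d0 Hd].
(* The quotient of [d] by this quantity is the admissible size of [h], so that [h *: v] has norm
   below [d]; adding 1 covers [v = 0]. *)
have v1 : 0 < `|v| + 1 by rewrite ltr_wpDl.
have dv : 0 < d / (`|v| + 1) by rewrite divr_gt0.
near=> h.
have hd : `|h| < d / (`|v| + 1) by near: h; exact: dnbhs0_lt.
have h0 : h != 0 by near: h; exact: nbhs_dnbhs_neq.
have Hs (s : R) : `|s| <= `|h| -> U (s *: v + x) /\
    forall t : R, 0 <= t <= 1 -> `|psi t (s *: v + x) - psi t x| <= e.
  move=> sh; apply: Hd; rewrite /= opprD addrCA subrr addr0 normrN normrZ.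
  rewrite (le_lt_trans (ler_wpM2r _ sh)) // (@le_lt_trans _ _ (`|h| * (`|v| + 1))) //.
    by rewrite ler_wpM2l // lerDl.
  by rewrite -ltr_pdivlMr.
have [Uh _] := Hs h (lexx _).
have := integral01_comb_le (c := h) (K := e * `|h|) (jointly_continuous_section pc Uh)
  (jointly_continuous_section pc Ux) (jointly_continuous_section qc Ux).
move=> H /=; have -> (a b c : R) : a - h^-1 *: (b - c) = - (h^-1 * (b - c - h * a)).
  by rewrite /GRing.scale /=; field.
rewrite normrN normrM normfV mulrC ler_pdivrMr ?normr_gt0 //; apply: H => t t01.
have [|c] := @MVT_sym R (fun s => phi t (s *: v + x)) (fun s => psi t (s *: v + x)) 0 h.
  move=> s; rewrite [s - 0]subr0 [h - 0]subr0 => sh.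
  by apply/(is_derive_lineP (phi t)); apply: dphi => //; have [] := Hs s sh.
rewrite [c - 0]subr0 [h - 0]subr0 scale0r add0r => ch ->.
rewrite [psi _ _ * h]mulrC -mulrBr normrM mulrC ler_wpM2r //.
by have [_] := Hs c ch; apply.
Unshelve. all: by end_near. Qed.

End ParameterIntegral.

Section IntegralSum.
Context {R : realType}.
Implicit Types f g h : R -> R.

Lemma integral01_comb f g h (c : R) :
  (forall t : R, 0 <= t <= 1 -> {for t, continuous f}) ->
  (forall t : R, 0 <= t <= 1 -> {for t, continuous g}) ->
  (forall t : R, 0 <= t <= 1 -> {for t, continuous h}) ->
  (forall t : R, 0 <= t <= 1 -> f t = g t + c * h t) ->
  integral01 f = integral01 g + c * integral01 h.
Proof.
move=> fc gc hc H; have := integral01_comb_le (c := c) (K := 0) fc gc hc.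
rewrite normr_le0 -addrA -opprD subr_eq0 => /(_ _)/eqP; apply.
by move=> t /H ->; rewrite -addrA -opprD subrr normr0.
Qed.

Lemma integral01_sum (I : Type) (r : seq I) (c : I -> R) (g : I -> R -> R) :
  (forall i (t : R), 0 <= t <= 1 -> {for t, continuous (g i)}) ->
  integral01 (fun t => \sum_(i <- r) c i * g i t)
  = \sum_(i <- r) c i * integral01 (g i).
Proof.
move=> gc.
have sc r' (t : R) : 0 <= t <= 1 ->
    {for t, continuous (fun t => \sum_(i <- r') c i * g i t)}.
  by move=> t01; apply: cvg_sumr => i; apply: cvgMl_tmp; exact: gc.
elim: r => [|i r IH].
  rewrite big_nil.
  (* The integral of the zero function equals twice itself. *)
  have := @integral01_comb (fun t => \sum_(i <- [::]) c i * g i t)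
    (fun t => \sum_(i <- [::]) c i * g i t) (fun t => \sum_(i <- [::]) c i * g i t) 1.
  move=> /(_ (sc _) (sc _) (sc _)) H.
  have /H/eqP : forall t : R, 0 <= t <= 1 -> \sum_(i <- [::]) c i * g i t
      = \sum_(i <- [::]) c i * g i t + 1 * \sum_(i <- [::]) c i * g i t.
    by move=> t _; rewrite big_nil mulr0 addr0.
  by rewrite mul1r -subr_eq subrr eq_sym => /eqP.
rewrite big_cons -IH addrC; apply: integral01_comb; [exact: sc|exact: sc|exact: gc|].
by move=> t _; rewrite big_cons addrC.
Qed.

End IntegralSum.

Section Hadamard.
Context {R : realType} {n : nat}.
Variables (x0 : 'rV[R]_n) (rho : R).
Let U : set 'rV[R]_n := ball x0 rho.
Hypothesis rho0 : 0 < rho.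

Let oU : open U.
Proof. exact: ball_open. Qed.

Let segment_in (t : R) x : 0 <= t <= 1 -> U x -> U (t *: (x - x0) + x0).
Proof.
move=> /andP[t0 t1]; rewrite /U -!ball_normE /= => h.
rewrite opprD addrCA subrr addr0 normrN normrZ ger0_norm //.
by rewrite (le_lt_trans _ h) // distrC ler_piMl.
Qed.

(** The weight [t ^+ m] makes the family stable under partial derivatives: differentiating under the
    integral brings out one more factor [t]. *)
Definition radial_integral (m : nat) (F : 'rV[R]_n -> R) (x : 'rV[R]_n) :=
  integral01 (fun t => t ^+ m * F (t *: (x - x0) + x0)).

Let radial_jointly m F : (forall p, U p -> {for p, continuous F}) ->
  jointly_continuous U (fun t x => t ^+ m * F (t *: (x - x0) + x0)).
Proof.
move=> Fc t x t01 Ux; apply: continuous_for_mul.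
  apply: (continuous_comp (f := fst) (g := fun t : R => t ^+ m)).
    exact: cvg_fst.
  exact: exprn_continuous.
apply: (continuous_comp (f := fun z : R * 'rV[R]_n => z.1 *: (z.2 - x0) + x0) (g := F)).
  apply: cvgD; last exact: cst_continuous.
  apply: cvgZ; first exact: cvg_fst.
  apply: cvgB; [exact: cvg_snd|exact: cst_continuous].
exact/Fc/segment_in.
Qed.

Lemma Ck_radial_integral k m F : Ck k U F -> Ck k U (radial_integral m F).
Proof.
elim: k m F => [|k IH] m F FU.
  split=> // p Up; apply: (integral01_continuous oU) => //.
  by apply: radial_jointly => q; exact: Ck_continuous FU.
apply: (CkS_intro (df := fun i => radial_integral m.+1 ('D_(unit_row R i) F))) => //.
- move=> p Up; apply: (integral01_continuous oU) => //.
  by apply: radial_jointly => q; exact: Ck_continuous FU.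
- move=> p i Up; apply: (integral01_is_derive
    (psi := fun t x => t ^+ m.+1 * 'D_(unit_row R i) F (t *: (x - x0) + x0)) oU) => //.
  + by apply: (@radial_jointly m F) => q; exact: Ck_continuous FU.
  + apply: (@radial_jointly m.+1 ('D_(unit_row R i) F)) => q.
    exact: Ck_continuous (Ck_derive i FU).
  move=> t y t01 Uy.
  have Uty := segment_in t01 Uy.
  have FU1 : Ck 1 U F by elim: k FU {IH} => // k IH /CkW/IH.
  have D : is_derive y (unit_row R i) (F \o (fun y => t *: (y - x0) + x0))
      (\sum_j (t * unit_row R i ord0 j) * 'D_(unit_row R j) F (t *: (y - x0) + x0)).
    apply: (Cinfty_is_derive_comp (g := fun y => t *: (y - x0) + x0) oU FU1 Uty) => j.
    have -> : (fun y : 'rV[R]_n => (t *: (y - x0) + x0) ord0 j)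
       = (fun y : 'rV[R]_n => t * (y ord0 j - x0 ord0 j) + x0 ord0 j).
      by apply/funext => z; rewrite !mxE.
    have := coord_is_derive y (unit_row R i) j => ?.
    by apply: is_derive_eq; rewrite subr0 addr0.
  have E : \sum_j (t * unit_row R i ord0 j) * 'D_(unit_row R j) F (t *: (y - x0) + x0)
      = t * 'D_(unit_row R i) F (t *: (y - x0) + x0).
    rewrite (bigD1 i) //= big1 ?addr0 ?mxE ?eqxx ?mulr1 // => j ji.
    by rewrite mxE eqxx /= (negbTE ji) mulr0 mul0r.
  rewrite E in D.
  have := @is_deriveZ R _ _ (F \o (fun y => t *: (y - x0) + x0)) (t ^+ m) _ _ _ D.
  by rewrite exprSr -mulrA; exact.
- by move=> i; apply: IH; exact: Ck_derive.
Qed.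

(** The functions [G i] average the partial derivatives of [F] along the segment from [x0] to [x],
    and the formula is the fundamental theorem of calculus on that segment, which stays in the
    ball. *)
Lemma Hadamard F : Cinfty U F ->
  exists G : 'I_n -> 'rV[R]_n -> R, [/\ forall i, Cinfty U (G i),
    forall i, G i x0 = 'D_(unit_row R i) F x0 &
    forall x, U x -> F x = F x0 + \sum_i (x ord0 i - x0 ord0 i) * G i x].
Proof.
move=> FU; exists (fun i => radial_integral 0 ('D_(unit_row R i) F)).
have pc i : jointly_continuous U
    (fun t x => t ^+ 0 * 'D_(unit_row R i) F (t *: (x - x0) + x0)).
  apply: (@radial_jointly 0%N ('D_(unit_row R i) F)) => q.
  exact: Cinfty_continuous (Cinfty_derive i FU).
split=> [i k|i|x Ux].
- exact: Ck_radial_integral (Cinfty_derive i FU k).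
- have := @integral01_derive R (fun t => t * 'D_(unit_row R i) F x0)
    (fun t => t ^+ 0 * 'D_(unit_row R i) F (t *: (x0 - x0) + x0)).
  rewrite /radial_integral mul0r mul1r subr0; apply.
    exact: (jointly_continuous_section (pc i) (ballxx x0 rho0)).
  move=> t _; rewrite subrr scaler0 add0r expr0 mul1r.
  by apply: is_derive_eq; rewrite scaler0 add0r [_%:A]mulr1.
- pose f (t : R) := F (t *: (x - x0) + x0).
  pose f' (t : R) := \sum_i (x ord0 i - x0 ord0 i)
    * (t ^+ 0 * 'D_(unit_row R i) F (t *: (x - x0) + x0)).
  have gc i (t : R) : 0 <= t <= 1 -> {for t, continuous
      (fun t : R => t ^+ 0 * 'D_(unit_row R i) F (t *: (x - x0) + x0))}.
    exact: (jointly_continuous_section (pc i)).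
  have : integral01 f' = f 1 - f 0.
    apply: integral01_derive => t t01.
      by apply: cvg_sumr => i; apply: cvgMl_tmp; exact: gc.
    apply: is_derive_eq.
      apply: (Cinfty_is_derive_curve (c := fun t => t *: (x - x0) + x0)
        (c' := fun i => x ord0 i - x0 ord0 i) oU FU); first exact: segment_in.
      move=> i; have -> : (fun s : R => (s *: (x - x0) + x0) ord0 i)
          = (fun s : R => s * (x ord0 i - x0 ord0 i) + x0 ord0 i).
        by apply/funext => s; rewrite !mxE.
      by apply: is_derive_eq; rewrite scaler0 !addr0 add0r [_%:A]mulr1.
    by apply: eq_bigr => i _; rewrite expr0 mul1r.
  rewrite /f' (@integral01_sum R) // /f scale1r scale0r add0r subrK => ->.
  by rewrite addrC subrK.
Qed.

End Hadamard.

(** * Solutions of differential equations *)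

Section GeometricLimit.
Context {R : realType}.

Lemma half_pow_le0 (a c : R) : (forall k, a <= c / 2 ^+ k) -> a <= 0.
Proof.
move=> H; rewrite leNgt; apply/negP => a0.
have c0 : 0 <= c by have := H 0%N; rewrite expr0 divr1; exact/le_trans/ltW.
have ca0 : 0 <= c / a by rewrite divr_ge0 // ltW.
have := archi_boundP ca0; set k := Num.Def.archi_bound _; rewrite ltr_pdivrMr // => ck.
have k2 : k%:R <= 2 ^+ k :> R by rewrite -natrX ler_nat ltnW // ltn_expl.
have := H k; rewrite ler_pdivlMr ?exprn_gt0 // leNgt => /negP; apply.
by rewrite (lt_le_trans ck) // mulrC ler_wpM2l // ltW.
Qed.

(** The intervals of radius [2 * C / 2 ^+ k] around [u k] are nested, so the supremum of their left
    ends lies in all of them; this gives the limit and the rate together. *)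
Lemma geometric_limit (u : nat -> R) (C : R) :
  (forall k, `|u k.+1 - u k| <= C / 2 ^+ k) ->
  exists l, forall k, `|u k - l| <= 2 * C / 2 ^+ k.
Proof.
move=> H.
have C0 : 0 <= C by have := H 0%N; rewrite expr0 divr1; exact: le_trans.
have e0 k : 0 <= 2 * C / 2 ^+ k by rewrite divr_ge0 // ?exprn_ge0 ?mulr_ge0.
have eS k : 2 * C / 2 ^+ k = C / 2 ^+ k + 2 * C / 2 ^+ k.+1.
  by rewrite exprS; field; rewrite expf_neq0.
pose a k := u k - 2 * C / 2 ^+ k; pose b k := u k + 2 * C / 2 ^+ k.
have aS : {homo a : i j / (i <= j)%N >-> i <= j}.
  apply: homo_leq => [x|y x z|k]; [exact: lexx|exact: le_trans|].
  have := H k; rewrite ler_norml => /andP[h1 h2]; rewrite /a (eS k); lra.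
have bS : {homo b : i j / (i <= j)%N >-> j <= i}.
  apply: homo_leq => [x|y x z|k]; [exact: lexx|by move=> h1 h2; exact: le_trans h2 h1|].
  have := H k; rewrite ler_norml => /andP[h1 h2]; rewrite /b (eS k); lra.
have ab j k : a j <= b k.
  have [jk|/ltnW kj] := leqP j k.
    apply: le_trans (aS _ _ jk) _; rewrite /a /b; have := e0 k; lra.
  apply: le_trans (bS _ _ kj); rewrite /a /b; have := e0 j; lra.
pose A : set R := range a.
have A0 : A !=set0 by exists (a 0%N), 0%N.
have Aub k : ubound A (b k) by move=> _ [j _ <-]; exact: ab.
have hA : has_ubound A by exists (b 0%N); exact: Aub.
exists (sup A) => k.
have h1 : a k <= sup A by apply: ub_le_sup => //; exists k.
have h2 : sup A <= b k by apply: ge_sup.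
rewrite ler_norml; rewrite /a /b in h1 h2; apply/andP; split; lra.
Qed.

Lemma primitive_le (f : R -> R) (K t : R) : continuous f -> `|t| <= 1 ->
  (forall s, `|s| <= `|t| -> `|f s| <= K) -> `|primitive f t| <= K * `|t|.
Proof.
move=> fc t1 H.
have := @primitive_comb_le R f f f (-1) K t fc fc fc t1.
rewrite subrr sub0r mulN1r opprK; apply => s /H.
by rewrite subrr sub0r mulN1r opprK.
Qed.

Lemma primitive_dist_le (f g : R -> R) (K t : R) : continuous f ->
  continuous g -> `|t| <= 1 ->
  (forall s, `|s| <= `|t| -> `|f s - g s| <= K) ->
  `|primitive f t - primitive g t| <= K * `|t|.
Proof.
move=> fc gc t1 H.
have := @primitive_comb_le R f g f 0 K t fc gc fc t1.
by rewrite mul0r subr0; apply => s /H; rewrite mul0r subr0.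
Qed.

End GeometricLimit.

(** * Existence and smoothness of integral curves *)

Section Picard.
Context {R : realType} {n : nat}.
Variables (W : set 'rV[R]_n) (p0 : 'rV[R]_n) (V : 'I_n -> 'rV[R]_n -> R).
Hypotheses (oW : open W) (Wp0 : W p0) (VW : forall A, Cinfty W (V A)).

Lemma local_lipschitz : exists rho L M : R, [/\ 0 < rho, 0 < L, 0 < M,
  forall q, `|q - p0| <= rho -> W q /\ forall A, `|V A q| <= M &
  forall A x y, `|x - p0| <= rho -> `|y - p0| <= rho ->
    `|V A x - V A y| <= L * `|x - y|].
Proof.
pose M := \sum_A (`|V A p0| + 1) + 1.
pose L := \sum_A \sum_i (`|'D_(unit_row R i) (V A) p0| + 1) + 1.
have near_le (f : 'rV[R]_n -> R) : {for p0, continuous f} ->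
    \forall q \near p0, `|f q| <= `|f p0| + 1.
  move=> /continuous_forP /(_ _ ltr01); apply: filterS => q.
  by rewrite distrC => h; rewrite -lerBlDl (le_trans (lerB_dist _ _)).
have N : \forall q \near p0, [/\ W q, forall A, `|V A q| <= `|V A p0| + 1 &
    forall A i, `|'D_(unit_row R i) (V A) q| <= `|'D_(unit_row R i) (V A) p0| + 1].
  have N1 : \forall q \near p0, forall A, `|V A q| <= `|V A p0| + 1.
    apply: (near_forall (P := fun A q => `|V A q| <= `|V A p0| + 1)) => A.
    exact/near_le/(Cinfty_continuous (VW A)).
  have N2 : \forall q \near p0, forall A i,
      `|'D_(unit_row R i) (V A) q| <= `|'D_(unit_row R i) (V A) p0| + 1.
    apply: (near_forall (P := fun A q => forall i,
      `|'D_(unit_row R i) (V A) q| <= `|'D_(unit_row R i) (V A) p0| + 1)) => A.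
    apply: (near_forall (P := fun i q =>
      `|'D_(unit_row R i) (V A) q| <= `|'D_(unit_row R i) (V A) p0| + 1)) => i.
    exact/near_le/(Cinfty_continuous (Cinfty_derive i (VW A))).
  by apply: filterS3 N1 N2 (open_nbhs_nbhs (conj oW Wp0)).
move/nbhs_normP : N => [d /= d0 Hd].
(* With [x] and [y] this close to [p0], the points [s *: (x - y) + y] stay within 3d/4 of [p0] for
   all [s] in [-1, 1]; negative [s] matter because [MVT_sym] may return one. *)
have r0 : 0 < d / 4%:R by rewrite divr_gt0.
exists (d / 4%:R), L, M; split=> //.
- by rewrite ltr_wpDl // sumr_ge0 // => A _; rewrite sumr_ge0 // => i _; rewrite addr_ge0.
- by rewrite ltr_wpDl // sumr_ge0 // => A _; rewrite addr_ge0.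
- move=> q qr; have [|Wq Hq _] := Hd q.
    by rewrite /= distrC (le_lt_trans qr) // ltr_pdivrMr // ltr_pMr // ltr1n.
  split=> // A; apply: le_trans (Hq A) _; rewrite /M (bigD1 A) //= -addrA lerDl.
  by rewrite addr_ge0 // sumr_ge0 // => B _; rewrite addr_ge0.
move=> A x y xr yr.
have Hs (s : R) : `|s| <= 1 -> `|p0 - (s *: (x - y) + y)| < d.
  move=> s1; rewrite distrC -addrA (le_lt_trans (ler_normD _ _)) // normrZ.
  have xy : `|x - y| <= d / 4%:R + d / 4%:R.
    by rewrite -(subrKA p0) (le_trans (ler_normD _ _)) // lerD // distrC.
  have := ler_pM (normr_ge0 s) (normr_ge0 (x - y)) s1 xy.
  lra.
have [|c] := @MVT_sym R (fun s => V A (s *: (x - y) + y))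
   (fun s => \sum_i (x - y) ord0 i * 'D_(unit_row R i) (V A) (s *: (x - y) + y)) 0 1.
  move=> s; rewrite [s - 0]subr0 [1 - 0]subr0 normr1 => s1.
  apply/(is_derive_lineP (V A)).
  by apply: Cinfty_is_derive_row (VW A) _ => //; have [] := Hd _ (Hs _ s1).
rewrite [c - 0]subr0 [1 - 0]subr0 normr1 mulr1 scale1r scale0r add0r subrK => c1 ->.
have [_ _ HD] := Hd _ (Hs _ c1).
rewrite (le_trans (ler_norm_sum _ _ _)) //.
apply: (@le_trans _ _ (\sum_i (`|'D_(unit_row R i) (V A) p0| + 1) * `|x - y|)).
  by apply: ler_sum => i _; rewrite normrM mulrC ler_pM // row_entry_le.
rewrite -mulr_suml ler_wpM2r // /L [X in _ <= X + 1](bigD1 A) //= -addrA lerDl addr_ge0 // sumr_ge0 // => B _.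
by rewrite sumr_ge0 // => i _; rewrite addr_ge0.
Qed.


(* Truncated to a cube, V is globally bounded and Lipschitz, so that the Picard
   iterates exist for all times. *)
Let box (rho : R) (x : 'rV[R]_n) : 'rV[R]_n :=
  \row_i clamp (p0 ord0 i - rho) (p0 ord0 i + rho) (x ord0 i).

Let box_lip rho x y : `|box rho x - box rho y| <= `|x - y|.
Proof.
apply: row_norm_le => // i; rewrite !mxE.
by rewrite (le_trans (clamp_lip _ _ _ _)) // (le_trans _ (row_entry_le _ i)) // !mxE.
Qed.

Let box_in rho x : 0 <= rho -> `|box rho x - p0| <= rho.
Proof.
move=> r0; apply: row_norm_le => // i; rewrite !mxE.
have : p0 ord0 i - rho <= p0 ord0 i + rho by lra.
by move=> /(@clamp_in _ _ _ (x ord0 i)); rewrite ler_norml; lra.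
Qed.

Let box_id rho x : `|x - p0| <= rho -> box rho x = x.
Proof.
move=> xr; apply/rowP => i; rewrite !mxE clamp_id //.
have := le_trans (row_entry_le (x - p0) i) xr; rewrite !mxE ler_norml; lra.
Qed.

(** The Picard iterates of the truncated field converge geometrically near 0, their limit is a fixed
    point of the integral equation, and the bound on the field keeps it in the cube where truncation
    changes nothing. *)
Theorem ODE_solution : exists2 e : R, 0 < e & exists gamma : R -> 'rV[R]_n,
  gamma 0 = p0 /\ forall t : R, `|t| <= e -> W (gamma t) /\
    forall A, is_derive t 1 (fun s => gamma s ord0 A) (V A (gamma t)).
Proof.
have [rho [L [M [r0 L0 M0 VM VL]]]] := local_lipschitz.
pose U A x := V A (box rho x).
have UL A x y : `|U A x - U A y| <= L * `|x - y|.
  apply: le_trans (VL _ _ _ (box_in _ (ltW r0)) (box_in _ (ltW r0))) _.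
  by rewrite ler_wpM2l ?box_lip // ltW.
have UM A x : `|U A x| <= M by have [_] := VM _ (box_in x (ltW r0)); apply.
have Uc A : continuous (U A).
  move=> x; apply/continuous_forP => d d0.
  have dL : 0 < d / L by rewrite divr_gt0.
  apply/nbhs_normP; exists (d / L) => //= y /=; rewrite ltr_pdivlMr // mulrC => h.
  by rewrite (le_trans (UL _ _ _)) // ltW.
(* Time is clamped to [-1, 1], the range in which [primitive] is known to be differentiable; the
   iterates are then continuous for all times. *)
have [it [it0 itS]] : exists it : nat -> R -> 'rV[R]_n, (forall t, it 0%N t = p0) /\
    forall k t, it k.+1 t = \row_A (p0 ord0 A
      + primitive (fun s => U A (it k s)) (clamp (-1) 1 t)).
  by exists (fix it k := if k is k'.+1 then
    fun t : R => \row_A (p0 ord0 A + primitive (fun s => U A (it k' s)) (clamp (-1) 1 t))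
    else fun=> p0).
have m11 : -1 <= 1 :> R by lra.
have itc k : continuous (it k).
  elim: k => [|k IH] t.
    by have -> : it 0%N = fun=> p0; [exact/funext|exact: cst_continuous].
  apply: continuous_for_row => A /=.
  have -> : (fun s : R => it k.+1 s ord0 A)
     = (fun s : R => p0 ord0 A + primitive (fun s => U A (it k s)) (clamp (-1) 1 s)).
    by apply/funext => s; rewrite itS mxE.
  apply: continuous_for_add; first exact: cst_continuous.
  apply: (continuous_comp (f := clamp (-1) 1)); first exact: clamp_continuous.
  apply: derivable_continuous1.
  have := @primitive_is_derive R (fun s => U A (it k s)) (clamp (-1) 1 t).
  move=> []//; last by rewrite ler_norml clamp_in.
  by move=> s; apply: (continuous_comp (g := U A)); [exact: IH|exact: Uc].
have Uitc k A : continuous (fun s => U A (it k s)).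
  by move=> s; apply: (continuous_comp (g := U A)); [exact: itc|exact: Uc].
(* [L * e] at most 1/2 halves the distance between successive iterates; [M * e] at most [rho] keeps
   the solution in the cube; [e] at most 1 stays in the range of [primitive_is_derive]. *)
have [e [e0 e1 eL eM]] : exists e : R, [/\ 0 < e, e <= 1, L * e <= 2^-1 & M * e <= rho].
  exists (Num.min 1 (Num.min ((2 * L)^-1) (rho / M))); split.
  - by rewrite !lt_min ltr01 invr_gt0 mulr_gt0 //= divr_gt0.
  - by rewrite ge_min lexx.
  - rewrite -ler_pdivlMl // -invfM [L * 2]mulrC.
    by rewrite !ge_min lexx orbT.
  - by rewrite mulrC -ler_pdivlMr // !ge_min lexx !orbT.
have clt (t : R) : `|t| <= e -> clamp (-1) 1 t = t.
  by move=> te; rewrite clamp_id // -ler_norml (le_trans te).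
have itd k : forall t : R, `|t| <= e -> `|it k.+1 t - it k t| <= M / 2 ^+ k.
  elim: k => [|k IH] t te.
    apply: row_norm_le => [|A]; first by rewrite divr_ge0 // ltW.
    rewrite itS it0 !mxE addrAC subrr add0r clt // expr0 divr1.
    apply: le_trans (primitive_le (K := M) (Uitc 0%N A) (le_trans te e1) _) _ => //.
    by rewrite ler_piMr ?(ltW M0) // (le_trans te).
  apply: row_norm_le => [|A]; first by rewrite divr_ge0 // ltW // exprn_gt0.
  rewrite (itS k.+1 t) [X in _ - X](itS k t) !mxE opprD addrACA subrr add0r clt //.
  apply: le_trans (primitive_dist_le (K := L * (M / 2 ^+ k)) (Uitc _ A) (Uitc _ A)
    (le_trans te e1) _) _.
    move=> s st; rewrite (le_trans (UL _ _ _)) // ler_wpM2l ?(ltW L0) //.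
    by apply: IH; rewrite (le_trans st).
  have H : L * `|t| <= 2^-1 by rewrite (le_trans _ eL) // ler_wpM2l // ltW.
  have Q : 0 <= M / 2 ^+ k by rewrite divr_ge0 // ?exprn_ge0 // ltW.
  rewrite exprS invfM [leRHS]mulrA [M / 2]mulrC -[leRHS]mulrA mulrAC.
  by rewrite ler_wpM2r.
have [x xP] : exists x : R -> 'rV[R]_n, forall t k, `|t| <= e ->
    forall A, `|it k t ord0 A - x t ord0 A| <= 2 * M / 2 ^+ k.
  have H (tA : R * 'I_n) : exists l : R, `|tA.1| <= e ->
      forall k, `|it k tA.1 ord0 tA.2 - l| <= 2 * M / 2 ^+ k.
    case: (boolP (`|tA.1| <= e)) => te; last by exists 0.
    have [|l lP] := @geometric_limit R (fun k => it k tA.1 ord0 tA.2) M.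
      by move=> k; rewrite (le_trans _ (itd k _ te)) // (le_trans _ (row_entry_le _ tA.2)) // !mxE.
    by exists l.
  have [l lP] := choice H.
  exists (fun t => \row_A l (t, A)) => t k te A; rewrite mxE.
  exact: (lP (t, A)).
(* The limit [x] is controlled on [-e, e] only; freezing it outside gives a continuous function on
   the whole line, to which [primitive] applies. *)
pose cl := clamp (-e) e.
have cle s : `|cl s| <= e by rewrite ler_norml clamp_in //; lra.
have xc A : continuous (fun s => x (cl s) ord0 A).
  move=> t; apply/continuous_forP => d d0.
  have [k kd] : exists k, 2 * M / 2 ^+ k <= d / 4%:R.
    apply: contrapT => /forallNP H.
    have : d / 4%:R <= 0.
      by apply: (@half_pow_le0 _ _ (2 * M)) => k; have /negP := H k; rewrite -ltNge => /ltW.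
    by rewrite leNgt divr_gt0.
  have d2 : 0 < d / 2 by rewrite divr_gt0.
  have : {for t, continuous (fun s => it k (cl s) ord0 A)}.
    apply: (continuous_comp (f := fun s => it k (cl s)) (g := fun q : 'rV[R]_n => q ord0 A)).
      by apply: (continuous_comp (f := cl)); [exact: clamp_continuous|exact: itc].
    exact: coord_continuous.
  move=> /continuous_forP /(_ _ d2); apply: filterS => s.
  have := xP _ k (cle t) A; have := xP _ k (cle s) A.
  rewrite !ler_norml => /andP[? ?] /andP[? ?] /andP[? ?]; apply/andP; split; lra.
have Uxc A : continuous (fun s => U A (x (cl s))).
  move=> s; apply: (continuous_comp (f := fun s => x (cl s)) (g := U A)); last exact: Uc.
  by apply: continuous_for_row => B; exact: xc.
(* [y] is the image of [x] under the integral operator, hence differentiable; it equals [x] on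
   [-e, e] because both are limits of the iterates. *)
pose y (t : R) := \row_A (p0 ord0 A + primitive (fun s => U A (x (cl s))) t).
have yx t : `|t| <= e -> y t = x t.
  move=> te; apply/rowP => A; apply/eqP; rewrite -subr_eq0 -normr_le0; apply: (@half_pow_le0 _ _ (2 * M)) => k.
  rewrite -(subrKA (it k.+1 t ord0 A)) (le_trans (ler_normD _ _)) //.
  (* The first summand bounds the distance from [y] to the iterate of rank [k.+1] by the Lipschitz
     estimate. As [L * e] is at most 1/2, the second is at least half of the left side, which is the
     error bound for that iterate against [x]. *)
  have -> : 2 * M / 2 ^+ k = L * (2 * M / 2 ^+ k) * e + (2 * M / 2 ^+ k) * (1 - L * e) by ring.
  rewrite lerD //.
    rewrite itS !mxE opprD addrACA subrr add0r clt //.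
    have := @primitive_dist_le R _ _ (L * (2 * M / 2 ^+ k)) t (Uxc A) (Uitc k A) (le_trans te e1).
    move=> /(_ _)/le_trans; apply; last first.
      by rewrite ler_wpM2l // mulr_ge0 ?(ltW L0) // divr_ge0 ?exprn_ge0 // mulr_ge0 // ltW.
    move=> s st; rewrite (le_trans (UL _ _ _)) // ler_wpM2l ?(ltW L0) //.
    have se := le_trans st te; rewrite /cl clamp_id -?ler_norml //.
    apply: row_norm_le => [|B]; first by rewrite divr_ge0 // ?mulr_ge0 // ?exprn_ge0 // ltW.
    by rewrite !mxE distrC; exact: xP.
  apply: le_trans (xP t k.+1 te A) _; rewrite exprS invfM mulrA mulrAC ler_wpM2l //.
    by rewrite divr_ge0 // ?mulr_ge0 // ?exprn_ge0 // ltW.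
  lra.
exists e => //; exists y; split.
  by apply/rowP => A; rewrite mxE primitive0 addr0.
move=> t te.
have yp : `|y t - p0| <= rho.
  apply: row_norm_le => [|A]; first exact: ltW.
  rewrite !mxE addrAC subrr add0r.
  apply: le_trans (primitive_le (K := M) (Uxc A) (le_trans te e1) _) _ => //.
  by rewrite (le_trans _ eM) // ler_wpM2l // ltW.
split=> [|A]; first by have [] := VM _ yp.
have -> : (fun s => y s ord0 A) = (fun s => p0 ord0 A
    + primitive (fun s => U A (x (cl s))) s).
  by apply/funext => s; rewrite mxE.
have := primitive_is_derive (Uxc A) (le_trans te e1) => H.
apply: is_derive_eq; rewrite add0r /cl clamp_id -?ler_norml //.
by rewrite -(yx _ te) /U (box_id yp) mul1r.
Qed.

Section SolutionSmooth.
Variables (e : R) (gamma : R -> 'rV[R]_n).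
Hypothesis gammaP : forall t : R, `|t| < e -> W (gamma t) /\
    forall A, is_derive t 1 (fun s => gamma s ord0 A) (V A (gamma t)).

(** A bootstrap: the partial derivatives of [gamma \o h] are the field evaluated at [gamma \o h],
    times those of [h], so each order of smoothness yields the next. *)
Lemma ODE_solution_Cinfty m (U : set 'rV[R]_m) (h : 'rV[R]_m -> R) A :
  open U -> (forall p, U p -> `|h p| < e) -> Cinfty U h ->
  Cinfty U (fun p => gamma (h p) ord0 A).
Proof.
move=> oU he hU k; elim: k A => [|k IH] A.
all: have hc B p : U p -> {for p, continuous (fun p => gamma (h p) ord0 B)}.
1, 3: move=> Up; apply: (continuous_comp (f := h) (g := fun s => gamma s ord0 B));
    first exact: Cinfty_continuous hU Up.
1, 2: by apply: derivable_continuous1; have [_ /(_ B)[]] := gammaP (he _ Up).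
  by split=> // p; exact: hc.
apply: (CkS_intro (df := fun i q =>
   (V A \o (gamma \o h)) q * 'D_(unit_row R i) h q)) => //.
- by move=> p; exact: hc.
- move=> p i Up; apply/is_derive_line0P.
  apply: (is_derive1_comp (f := fun s => gamma s ord0 A)
    (g := fun s : R => h (s *: unit_row R i + p))).
    by rewrite scale0r add0r; have [_] := gammaP (he _ Up); exact.
  by apply/(is_derive_line0P h); exact: Cinfty_is_derive hU Up.
- move=> i; apply: Ck_mul => //; last exact: Ck_derive (hU k.+1).
  apply: (Ck_comp (V := W)) => //.
  + by move=> p Up; have [] := gammaP (he _ Up).
  + exact: VW.
Qed.

End SolutionSmooth.

End Picard.

(** * Bump functions *)

Section FlatFunction.
Context {R : realType}.
Implicit Types P : {poly R}.

(** The polynomial is carried along so that the family is closed under derivation: on positive [t],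
    differentiating P(1/t) exp(-1/t) replaces P by X^2 (P - P'). *)
Definition flat P (t : R) : R :=
  if 0 < t then P.[t^-1] * expR (- t^-1) else 0.

(** The exponential beats the polynomial by two powers of [t], through the single term of degree
    [m.+2] of the exponential series; a quadratic bound makes the difference quotient at 0 tend to
    0. *)
Let flat_bound P : exists C : R, forall t, 0 < t <= 1 -> `|flat P t| <= C * t ^+ 2.
Proof.
pose m := size P; pose A := \sum_(i < m) `|P`_i|.
exists (A * (m.+2)`!%:R) => t /andP[t0 t1]; rewrite /flat t0.
set s := t^-1; have s1 : 1 <= s by rewrite invf_ge1.
have s0 : 0 < s by rewrite invr_gt0.
have PA : `|P.[s]| <= A * s ^+ m.
  rewrite horner_coef (le_trans (ler_norm_sum _ _ _)) // /A mulr_suml.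
  apply: ler_sum => i _; rewrite normrM ler_wpM2l // ger0_norm ?exprn_ge0 ?(ltW s0) //.
  by apply: ler_weXn2l => //; exact: ltnW.
have E : expR (- s) <= (m.+2)`!%:R * (s ^+ m.+2)^-1.
  rewrite expRN -[leRHS]invrK lef_pV2 ?posrE ?expR_gt0 ?invr_gt0 //; last first.
    by rewrite mulr_gt0 ?invr_gt0 ?exprn_gt0 // ltr0n fact_gt0.
  rewrite invfM invrK mulrC (le_trans _ (expR_ge1Dxn m.+1 (ltW s0))) //.
  by rewrite lerDr.
rewrite normrM [`|expR _|]ger0_norm ?expR_ge0 //.
apply: le_trans (ler_pM (normr_ge0 _) (expR_ge0 _) PA E) _.
rewrite le_eqVlt; apply/orP; left; apply/eqP.
have -> : t = s^-1 by rewrite invrK.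
rewrite !exprS; field.
by rewrite expf_neq0 gt_eqF.
Qed.

Lemma flat_is_derive P (t : R) :
  is_derive t (1 : R) (flat P) (flat ('X^2 * (P - P^`())) t).
Proof.
have [t0|t0|t0] := ltgtP t 0.
- have E : \forall s \near t, 0 = flat P s.
    near=> s; rewrite /flat ltNge ltW //; near: s; exact: lt_nbhsl.
  have -> : flat ('X^2 * (P - P^`())) t = 0 by rewrite /flat ltNge ltW.
  by apply: near_eq_is_derive E _; exact: is_derive_cst.
- have E : \forall s \near t, P.[s^-1] * expR (- s^-1) = flat P s.
    near=> s; rewrite /flat ifT //; near: s; exact: lt_nbhsr.
  apply: near_eq_is_derive E _.
  have tn : t != 0 by rewrite gt_eqF.
  have Dinv : is_derive t (1 : R) (fun s : R => s^-1) (- t ^- 2).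
    split; first exact: derivableV.
    by rewrite (deriveV (f := id)) // derive_id scaleNr [_%:A]mulr1.
  have D1 : is_derive t (1 : R) (fun s : R => P.[s^-1]) (P^`().[t^-1] * - t ^- 2).
    exact: (@is_derive1_comp _ (horner P) (fun s => s^-1) _ _ _
      (is_derive_poly P t^-1) Dinv).
  have DN : is_derive t (1 : R) (fun s : R => - s^-1) (- - t ^- 2).
    exact: is_deriveN.
  have D2 : is_derive t (1 : R) (fun s : R => expR (- s^-1)) (expR (- t^-1) * - - t ^- 2).
    exact: (@is_derive1_comp _ expR (fun s => - s^-1) _ _ _ (is_derive_expR _) DN).
  have D := is_deriveM D1 D2.
  rewrite /flat t0; apply: is_derive_eq; rewrite !hornerE /GRing.scale /= exprVn; ring.
- rewrite t0; have -> : flat ('X^2 * (P - P^`())) 0 = 0 by rewrite /flat ltxx.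
  have [C HC] := flat_bound P.
  suff H : (fun h : R => h^-1 *: ((flat P \o shift 0) (h *: 1) - flat P 0)) @ 0^' --> 0.
    split; first by apply/cvg_ex; eexists; exact: H.
    exact: cvg_lim H.
  apply/cvgrPdist_le => e e0; near=> h.
  have h0 : h != 0 by near: h; exact: nbhs_dnbhs_neq.
  rewrite /= [h%:A]mulr1 addr0 sub0r normrN {2}/flat ltxx subr0.
  have [hp|hn] := ltP 0 h; last by rewrite /flat ltNge hn scaler0 normr0 ltW.
  have h1 : `|h| < 1 by near: h; exact: dnbhs0_lt.
  have he : `|h| < e / (`|C| + 1).
    by near: h; apply: dnbhs0_lt; rewrite divr_gt0 // ltr_wpDl.
  rewrite ger0_norm ?(ltW hp) // in h1 he.
  rewrite /GRing.scale /= normrM normfV [`|h|]ger0_norm ?(ltW hp) // ler_pdivrMl //.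
  rewrite (le_trans (HC h _)) ?hp ?(ltW h1) //.
  rewrite ltr_pdivlMr ?ltr_wpDl // in he.
  rewrite expr2 mulrCA ler_wpM2l ?(ltW hp) // (le_trans _ (ltW he)) // mulrC.
  by rewrite ler_wpM2l ?(ltW hp) // (le_trans (ler_norm C)) // lerDl.
Unshelve. all: by end_near. Qed.

Lemma flat1_gt0 (t : R) : 0 < t -> 0 < flat 1 t.
Proof. by move=> t0; rewrite /flat t0 hornerE mul1r expR_gt0. Qed.

Lemma flat_le0 P (t : R) : t <= 0 -> flat P t = 0.
Proof. by move=> t0; rewrite /flat ltNge t0. Qed.

Lemma flat1_ge0 (t : R) : 0 <= flat 1 t.
Proof. by have [/flat1_gt0/ltW|/flat_le0 ->] := ltP 0 t. Qed.

Lemma Cinfty_flat n (U : set 'rV[R]_n) (f : 'rV[R]_n -> R) P :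
  open U -> Cinfty U f -> Cinfty U (fun p => flat P (f p)).
Proof.
move=> oU fU.
apply: (Cinfty_comp_real
  (F := fun k => flat (iter k (fun Q => 'X^2 * (Q - Q^`())) P))) => // k t.
exact: flat_is_derive.
Qed.

(** The norm of row vectors is the maximum norm, which is not smooth, so the radius is measured by
    the scaled sum of squares [q]. The quotient below is 1 where [q] is at most 1 and 0 where [q] is
    at least 2; the scale 2/rho makes [q] at least 2 as soon as one coordinate differs by more than
    [rho]. *)
Lemma bump_exists n (x0 : 'rV[R]_n) (rho : R) : 0 < rho ->
  exists b : 'rV[R]_n -> R, [/\ Cinfty setT b, forall p, 0 <= b p <= 1,
    \forall p \near x0, b p = 1 & forall p, rho < `|p - x0| -> b p = 0].
Proof.
move=> r0; pose q (p : 'rV[R]_n) := \sum_i ((p ord0 i - x0 ord0 i) * (2 / rho)) ^+ 2.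
have yU i : Cinfty setT (fun p : 'rV[R]_n => (p ord0 i - x0 ord0 i) * (2 / rho)).
  apply: Cinfty_mul; [exact: openT| |apply: Cinfty_cst; exact: openT].
  apply: Cinfty_add; [exact: openT| |apply: Cinfty_cst; exact: openT].
  by apply: Cinfty_coord; exact: openT.
have qU : Cinfty setT q.
  apply: Cinfty_sum; first exact: openT.
  by move=> i; under eq_fun do rewrite expr2; apply: Cinfty_mul; [exact: openT| |].
pose den p := flat 1 (2 - q p) + flat 1 (q p - 1).
have den0 p : 0 < den p.
  have [h|h] := ltP (q p) 2.
    by rewrite ltr_wpDr ?flat1_ge0 // flat1_gt0 // subr_gt0.
  by rewrite ltr_wpDl ?flat1_ge0 // flat1_gt0 // subr_gt0; lra.
exists (fun p => flat 1 (2 - q p) * (den p)^-1); split.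
- have A1 : Cinfty setT (fun p => flat 1 (2 - q p)).
    apply: Cinfty_flat; first exact: openT.
    have -> : (fun p => 2 - q p) = (fun p => 2 + (-1) * q p) by apply/funext => p; ring.
    apply: Cinfty_add; [exact: openT|apply: Cinfty_cst; exact: openT|].
    by apply: Cinfty_mul; [exact: openT|apply: Cinfty_cst; exact: openT|].
  have A2 : Cinfty setT (fun p => flat 1 (q p - 1)).
    apply: Cinfty_flat; first exact: openT.
    by apply: Cinfty_add; [exact: openT| |apply: Cinfty_cst; exact: openT].
  apply: Cinfty_mul; [exact: openT|exact: A1|].
  apply: Cinfty_inv; [exact: openT|by move=> p _; rewrite gt_eqF|].
  by apply: Cinfty_add; first exact: openT.
- move=> p; rewrite divr_ge0 ?flat1_ge0 ?(ltW (den0 _)) //= ler_pdivrMr // mul1r.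
  by rewrite /den lerDl flat1_ge0.
- have : {for x0, continuous q} by exact: Cinfty_continuous qU _.
  move=> /continuous_forP /(_ _ ltr01); apply: filterS => p.
  have -> : q x0 = 0 by rewrite /q big1 // => i _; rewrite subrr mul0r expr0n.
  rewrite sub0r normrN ger0_norm; last by rewrite sumr_ge0 // => i _; rewrite sqr_ge0.
  move=> qp; have E : flat 1 (q p - 1) = 0 by apply: flat_le0; lra.
  by rewrite /den E addr0 divff // gt_eqF // flat1_gt0 //; lra.
- move=> p rp; suff : 2 <= q p by move=> h; rewrite flat_le0 ?mul0r //; lra.
  have [i Hi] : exists i, rho < `|p ord0 i - x0 ord0 i|.
    apply: contrapT => /forallNP H; move: rp; rewrite ltNge => /negP; apply.
    apply: row_norm_le; first exact: ltW.
    by move=> i; rewrite !mxE leNgt; apply/negP.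
  rewrite /q (bigD1 i) //= ler_wpDr //.
    by rewrite sumr_ge0 // => j _; rewrite sqr_ge0.
  have H : 2 <= `|(p ord0 i - x0 ord0 i) * (2 / rho)|.
    rewrite normrM [`|2 / rho|]ger0_norm ?divr_ge0 // ?(ltW r0) //.
    by rewrite mulrA ler_pdivlMr // mulrC ler_wpM2r // ltW.
  rewrite -real_normK ?num_real // expr2; apply: (le_trans H).
  by rewrite ler_peMl //; apply: le_trans H; lra.
Qed.

End FlatFunction.

(** * Smooth functions on manifolds *)

Section Charts.
Context {R : realType} {n : nat} {M : manifold R n}.
Implicit Types (c : chart R n M) (x y : M) (f g : M -> R).

Lemma near_chart c x (P : M -> Prop) : cdom c x ->
  (\forall y \near x, P y) -> \forall p \near cmap c x, P (cinv c p).
Proof. by move=> cx Px; apply: (cinv_continuous cx); rewrite cmapK. Qed.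

Lemma near_cmap c x (Q : 'rV[R]_n -> Prop) : cdom c x ->
  (\forall p \near cmap c x, Q p) -> \forall y \near x, Q (cmap c y).
Proof. by move=> cx Qx; apply: (cmap_continuous cx). Qed.

Lemma near_cdom c x : cdom c x -> \forall y \near x, cdom c y.
Proof. by move=> cx; exact: open_nbhs_nbhs (conj (cdom_open c) cx). Qed.

Lemma near_cimg c x : cdom c x ->
  \forall p \near cmap c x, (cmap c @` cdom c) p.
Proof.
move=> cx; apply: open_nbhs_nbhs; split; first exact: cimg_open.
by exists x.
Qed.

Lemma cinvP c p : (cmap c @` cdom c) p ->
  cdom c (cinv c p) /\ cmap c (cinv c p) = p.
Proof. by move=> [x cx <-]; rewrite cmapK. Qed.

Lemma image_chart_open c (U : set M) : open U -> open (cmap c @` (U `&` cdom c)).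
Proof.
move=> oU; rewrite openE => p [x [Ux cx] <-]; rewrite /interior.
have H := near_chart cx (open_nbhs_nbhs (conj oU Ux)).
apply: filterS2 H (near_cimg cx) => q Uq qc.
by have [? ?] := cinvP qc; exists (cinv c q).
Qed.

Lemma smooth_near_chart c x f : atlas c -> cdom c x -> smooth_near x f ->
  exists W : set 'rV[R]_n, [/\ open W, W (cmap c x),
    W `<=` cmap c @` cdom c & Cinfty W (f \o cinv c)].
Proof.
move=> ac cx [U [oU Ux fU]]; exists (cmap c @` (U `&` cdom c)); split.
- exact: image_chart_open.
- by exists x.
- by move=> _ [y [_ cy] <-]; exists y.
- exact: fU.
Qed.

(** Smoothness in the single chart [c] passes to every other chart by composition with the smooth
    transition map. *)
Lemma smooth_near_intro c x f (W : set 'rV[R]_n) : atlas c -> cdom c x ->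
  open W -> W (cmap c x) -> Cinfty W (f \o cinv c) -> smooth_near x f.
Proof.
move=> ac cx oW Wx fW; pose U := [set y | cdom c y /\ W (cmap c y)].
have oU : open U.
  rewrite openE => y [cy Wy]; rewrite /interior.
  apply: filterS2 (near_cdom cy) (near_cmap cy (open_nbhs_nbhs (conj oW Wy))).
  by move=> z.
exists U; split => // c' ac'.
have oO := image_chart_open (c := c') oU.
apply: (@eq_open_Cinfty _ _ _ ((f \o cinv c) \o (cmap c \o cinv c'))) => //.
  by move=> _ [y [[cy Wy] c'y] <-] /=; rewrite (cmapK c'y) (cmapK cy).
apply: (Cinfty_comp oO oW) => //.
  by move=> _ [y [[cy Wy] c'y] <-] /=; rewrite (cmapK c'y).
move=> j; apply: Cinfty_sub (atlas_compatible ac' ac j).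
by move=> _ [y [[cy _] c'y] <-]; exists y.
Qed.

Lemma smooth_near_Cinfty c (O : set 'rV[R]_n) f : atlas c -> open O ->
  (forall p, O p -> (cmap c @` cdom c) p /\ smooth_near (cinv c p) f) ->
  Cinfty O (f \o cinv c).
Proof.
move=> ac oO H; apply: Cinfty_local => p /H[pc fp].
have [cp pE] := cinvP pc.
have [W [oW Wp _ fW]] := smooth_near_chart ac cp fp.
by exists W => //; rewrite -pE.
Qed.

Lemma smooth_onP (U : set M) f : open U ->
  smooth_on U f <-> forall x, U x -> smooth_near x f.
Proof.
move=> oU; split=> [fU x Ux|H c ac]; first by exists U.
apply: smooth_near_Cinfty => //; first exact: image_chart_open.
by move=> _ [y [Uy cy] <-]; rewrite cmapK //; split; [exists y|exact: H].
Qed.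

Lemma smooth_near_near x f : smooth_near x f ->
  \forall y \near x, smooth_near y f.
Proof.
move=> [U [oU Ux fU]]; apply: filterS (open_nbhs_nbhs (conj oU Ux)) => y Uy.
by exists U.
Qed.

(* P only serves to cut out the open sets on which F is known to be smooth. *)
Lemma smooth_near_chartP c x f (F : 'rV[R]_n -> R) (P : 'rV[R]_n -> Prop) :
  atlas c -> cdom c x -> (\forall p \near cmap c x, P p) ->
  (forall O, open O -> (forall p, O p -> P p) -> Cinfty O F) ->
  (\forall p \near cmap c x, f (cinv c p) = F p) -> smooth_near x f.
Proof.
move=> ac cx nP HF E.
have N : \forall p \near cmap c x, P p /\ f (cinv c p) = F p.
  by apply: filterS2 nP E.
pose O := interior [set p | P p /\ f (cinv c p) = F p].
have oO : open O by exact: open_interior.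
apply: (smooth_near_intro (W := O) ac cx oO N).
apply: (@eq_open_Cinfty _ _ _ F) => //.
  by move=> p /interior_subset [_ /= ->].
by apply: HF => // p /interior_subset [].
Qed.

Lemma smooth_near_eq x f g : smooth_near x f -> (\forall y \near x, f y = g y) ->
  smooth_near x g.
Proof.
move=> fx E; have [c ac cx] := atlas_cover x.
have [W [oW Wx _ fW]] := smooth_near_chart ac cx fx.
apply: (smooth_near_chartP (F := f \o cinv c) (P := W) ac cx).
- exact: open_nbhs_nbhs.
- by move=> O oO OW; apply: Cinfty_sub fW.
- by apply: filterS (near_chart cx E) => p /= ->.
Qed.

Lemma smooth_near_cst x (a : R) : smooth_near x (fun=> a).
Proof.
have [c ac cx] := atlas_cover x.
apply: (smooth_near_chartP (F := fun=> a) (P := fun=> True) ac cx) => //.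
- exact: filterT.
- by move=> O oO _; exact: Cinfty_cst.
- exact: filterE.
Qed.

Lemma smooth_near_add x f g : smooth_near x f -> smooth_near x g ->
  smooth_near x (fun y => f y + g y).
Proof.
move=> fx gx; have [c ac cx] := atlas_cover x.
have [W [oW Wx _ fW]] := smooth_near_chart ac cx fx.
have [W' [oW' Wx' _ gW]] := smooth_near_chart ac cx gx.
apply: (smooth_near_chartP (F := fun p => (f \o cinv c) p + (g \o cinv c) p)
  (P := W `&` W') ac cx).
- by apply: open_nbhs_nbhs; split; [exact: openI|split].
- move=> O oO OW; apply: Cinfty_add => //.
    by apply: Cinfty_sub fW => p /OW[].
  by apply: Cinfty_sub gW => p /OW[].
- exact: filterE.
Qed.

Lemma smooth_near_mul x f g : smooth_near x f -> smooth_near x g ->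
  smooth_near x (fun y => f y * g y).
Proof.
move=> fx gx; have [c ac cx] := atlas_cover x.
have [W [oW Wx _ fW]] := smooth_near_chart ac cx fx.
have [W' [oW' Wx' _ gW]] := smooth_near_chart ac cx gx.
apply: (smooth_near_chartP (F := fun p => (f \o cinv c) p * (g \o cinv c) p)
  (P := W `&` W') ac cx).
- by apply: open_nbhs_nbhs; split; [exact: openI|split].
- move=> O oO OW; apply: Cinfty_mul => //.
    by apply: Cinfty_sub fW => p /OW[].
  by apply: Cinfty_sub gW => p /OW[].
- exact: filterE.
Qed.

Lemma smooth_near_sum x (I : Type) (r : seq I) (P : pred I) (F : I -> M -> R) :
  (forall i, smooth_near x (F i)) ->
  smooth_near x (fun y => \sum_(i <- r | P i) F i y).
Proof.
move=> h; elim: r => [|i r IH].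
  by under eq_fun do rewrite big_nil; exact: smooth_near_cst.
under eq_fun do rewrite big_cons.
by case: (P i) => //; exact: smooth_near_add.
Qed.

Lemma smooth_near_continuous x f : smooth_near x f -> {for x, continuous f}.
Proof.
move=> fx; have [c ac cx] := atlas_cover x.
have [W [oW Wx _ fW]] := smooth_near_chart ac cx fx.
apply: (@near_eq_continuous _ _ ((f \o cinv c) \o cmap c)).
  by apply: filterS (near_cdom cx) => y cy /=; rewrite cmapK.
apply: continuous_comp; first exact: cmap_continuous.
exact: Cinfty_continuous fW Wx.
Qed.

Lemma smooth_near_coordinate c x i : atlas c -> cdom c x ->
  smooth_near x (coordinate c i).
Proof.
move=> ac cx.
apply: (smooth_near_chartP (F := fun p => p ord0 i) (P := fun=> True) ac cx) => //.
- exact: filterT.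
- by move=> O oO _; exact: Cinfty_coord.
- by apply: filterS (near_cimg cx) => p /cinvP[_ pE]; rewrite /coordinate pE.
Qed.

Lemma smooth_near_partial c x f i : atlas c -> cdom c x -> smooth_near x f ->
  smooth_near x (partial c i f).
Proof.
move=> ac cx fx; have [W [oW Wx Wc fW]] := smooth_near_chart ac cx fx.
apply: (smooth_near_chartP (F := 'D_(unit_row R i) (f \o cinv c)) (P := W) ac cx).
- exact: open_nbhs_nbhs.
- by move=> O oO OW; apply: Cinfty_sub OW _; exact: Cinfty_derive.
- by apply: filterS (near_cimg cx) => p /cinvP[_ pE]; rewrite /partial pE.
Qed.

Lemma partial_is_derive c x f i : atlas c -> cdom c x -> smooth_near x f ->
  is_derive (cmap c x) (unit_row R i) (f \o cinv c) (partial c i f x).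
Proof.
move=> ac cx fx; have [W [oW Wx Wc fW]] := smooth_near_chart ac cx fx.
exact: Cinfty_is_derive fW Wx.
Qed.

Lemma partial_is_derive_row c x f v : atlas c -> cdom c x -> smooth_near x f ->
  is_derive (cmap c x) v (f \o cinv c) (\sum_i v ord0 i * partial c i f x).
Proof.
move=> ac cx fx; have [W [oW Wx Wc fW]] := smooth_near_chart ac cx fx.
exact: Cinfty_is_derive_row fW Wx.
Qed.

Lemma partial_eq c x f g i : cdom c x -> (\forall y \near x, f y = g y) ->
  partial c i f x = partial c i g x.
Proof. by move=> cx E; apply: near_eq_derive; exact: near_chart cx E. Qed.

Lemma partial_cst c x i (a : R) : partial c i (fun=> a) x = 0.
Proof. exact: derive_cst. Qed.

Lemma partial_add c x f g i : atlas c -> cdom c x ->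
  smooth_near x f -> smooth_near x g ->
  partial c i (fun y => f y + g y) x = partial c i f x + partial c i g x.
Proof.
move=> ac cx /(partial_is_derive i ac cx) df /(partial_is_derive i ac cx) dg.
by have [_] := is_deriveD df dg.
Qed.

Lemma partial_mul c x f g i : atlas c -> cdom c x ->
  smooth_near x f -> smooth_near x g ->
  partial c i (fun y => f y * g y) x = partial c i f x * g x + f x * partial c i g x.
Proof.
move=> ac cx /(partial_is_derive i ac cx) df /(partial_is_derive i ac cx) dg.
have [_ ] := is_deriveM df dg; rewrite /= cmapK // /GRing.scale /= => E.
by rewrite [LHS]E addrC mulrC.
Qed.

Lemma partial_coordinate c x i j : cdom c x ->
  partial c i (coordinate c j) x = (i == j)%:R.
Proof.
move=> cx; have [_ E] := @coord_is_derive R n (cmap c x) (unit_row R i) j.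
rewrite /partial (@near_eq_derive _ _ _ _ (fun p : 'rV[R]_n => p ord0 j)); last first.
  by apply: filterS (near_cimg cx) => p /cinvP[_ pE]; rewrite /= /coordinate pE.
by rewrite E mxE eqxx /= eq_sym.
Qed.

Lemma partial_scale c x (a : R) f i : atlas c -> cdom c x -> smooth_near x f ->
  partial c i (fun y => a * f y) x = a * partial c i f x.
Proof.
move=> ac cx fx; rewrite partial_mul //; last exact: smooth_near_cst.
by rewrite partial_cst mul0r add0r.
Qed.

Lemma partial_sum c x (I : Type) (r : seq I) (F : I -> M -> R) i : atlas c ->
  cdom c x -> (forall j, smooth_near x (F j)) ->
  partial c i (fun y => \sum_(j <- r) F j y) x = \sum_(j <- r) partial c i (F j) x.
Proof.
move=> ac cx h; elim: r => [|j r IH].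
  by under eq_fun do rewrite big_nil; rewrite partial_cst big_nil.
under eq_fun do rewrite big_cons.
by rewrite partial_add ?big_cons ?IH //; exact: smooth_near_sum.
Qed.

End Charts.

(** * Chain rule for smooth maps between manifolds *)

Section SmoothMaps.
Context {R : realType} {d n : nat} {S : manifold R d} {M : manifold R n}.
Variables (phi : S -> M) (z : S) (k : chart R n M).
Hypotheses (ak : atlas k) (kz : cdom k (phi z)) (phic : {for z, continuous phi}).
Hypothesis phis : forall A, smooth_near z (fun z' => cmap k (phi z') ord0 A).

Let near_pull (P : M -> Prop) : (\forall x \near phi z, P x) ->
  \forall z' \near z, P (phi z').
Proof. by move=> h; exact: phic. Qed.

Lemma smooth_near_comp (f : M -> R) : smooth_near (phi z) f ->
  smooth_near z (f \o phi).
Proof.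
move=> fz; have [c ac cz] := atlas_cover z.
have [W [oW Wz _ fW]] := smooth_near_chart ak kz fz.
pose P p := [/\ (cmap c @` cdom c) p,
  forall A, smooth_near (cinv c p) (fun z' => cmap k (phi z') ord0 A),
  cdom k (phi (cinv c p)) & W (cmap k (phi (cinv c p)))].
apply: (smooth_near_chartP
  (F := (f \o cinv k) \o (fun p => cmap k (phi (cinv c p)))) (P := P) ac cz).
- have N1 : \forall p \near cmap c z, forall A,
      smooth_near (cinv c p) (fun z' => cmap k (phi z') ord0 A).
    apply: (near_forall (P := fun A p =>
      smooth_near (cinv c p) (fun z' => cmap k (phi z') ord0 A))) => A.
    apply: (near_chart (P := fun z => smooth_near z (fun z' => cmap k (phi z') ord0 A))) => //.
    exact: smooth_near_near.
  have N2 : \forall p \near cmap c z, cdom k (phi (cinv c p)) /\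
       W (cmap k (phi (cinv c p))).
    apply: (near_chart (P := fun z => cdom k (phi z) /\ W (cmap k (phi z)))) => //.
    apply: (near_pull (P := fun x => cdom k x /\ W (cmap k x))).
    by apply: filterS2 (near_cdom kz) (near_cmap kz (open_nbhs_nbhs (conj oW Wz))).
  by apply: filterS3 N1 N2 (near_cimg cz) => p ? [? ?] ?; split.
- move=> O oO OP; apply: (Cinfty_comp oO oW) => //.
    by move=> p /OP[].
  move=> A; apply: (smooth_near_Cinfty (f := fun z' => cmap k (phi z') ord0 A) ac oO).
  by move=> p /OP[].
- have : \forall p \near cmap c z, cdom k (phi (cinv c p)).
    apply: (near_chart (P := fun z => cdom k (phi z))) => //.
    exact/near_pull/near_cdom.
  by apply: filterS => p kp /=; rewrite cmapK.
Qed.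

Lemma partial_comp c i (f : M -> R) : atlas c -> cdom c z ->
  smooth_near (phi z) f ->
  partial c i (f \o phi) z = \sum_A partial c i (fun z' => cmap k (phi z') ord0 A) z
     * partial k A f (phi z).
Proof.
move=> ac cz fz; have [W [oW Wz _ fW]] := smooth_near_chart ak kz fz.
have := @Cinfty_is_derive_comp R _ _ W (f \o cinv k) (fun p => cmap k (phi (cinv c p)))
  (fun A => partial c i (fun z' => cmap k (phi z') ord0 A) z) (cmap c z) (unit_row R i)
  oW (fW 1%N).
rewrite /= cmapK // => /(_ Wz) [|_ <-].
  by move=> A; exact: (partial_is_derive i ac cz (phis A)).
apply: near_eq_derive.
have : \forall p \near cmap c z, cdom k (phi (cinv c p)).
  apply: (near_chart (P := fun z => cdom k (phi z))) => //.
  exact/near_pull/near_cdom.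
by apply: filterS => p kp /=; rewrite cmapK.
Qed.

End SmoothMaps.

(** * Tangent vectors *)

Section ManifoldBump.
Context {R : realType} {n : nat} {M : manifold R n}.
Implicit Types (c : chart R n M) (x y : M) (f g : M -> R).

Definition is_bump x (K : set M) (b : M -> R) : Prop :=
  [/\ closed K, forall y, smooth_near y b, forall y, 0 <= b y <= 1,
    \forall y \near x, b y = 1 & forall y, ~ K y -> b y = 0].

(** A bump function of the chart is extended by 0. Smoothness at points off the chart requires its
    support to be closed in the manifold, and this is where the Hausdorff property enters: the
    support lies in [K], the image of a compact cube. *)
Lemma manifold_bump x (N : set M) : nbhs x N ->
  exists K b, K `<=` N /\ is_bump x K b.
Proof.
move=> Nx; have [c ac cx] := atlas_cover x.
have : \forall p \near cmap c x, (cmap c @` cdom c) p /\ N (cinv c p).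
  by apply: filterS2 (near_cimg cx) (near_chart cx Nx).
move/nbhs_normP => [e /= e0 He].
have e2 : 0 < e / 2 by rewrite divr_gt0.
pose B : set 'rV[R]_n := [set p | `|p - cmap c x| <= e / 2].
have BW p : B p -> (cmap c @` cdom c) p /\ N (cinv c p).
  move=> Bp; apply: He; rewrite /= distrC (le_lt_trans Bp) //.
  by rewrite ltr_pdivrMr // ltr_pMr // ltr1n.
have cB : compact B.
  have -> : B = [set p | forall i, `[cmap c x ord0 i - e / 2, cmap c x ord0 i + e / 2]%classic
      (p ord0 i)].
    apply/seteqP; split=> p /= Hp.
      move=> i; have := le_trans (row_entry_le (p - cmap c x) i) Hp.
      by rewrite !mxE in_itv /= ler_norml => /andP[? ?]; apply/andP; split; lra.
    apply: row_norm_le => [|i]; first exact: ltW.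
    have := Hp i; rewrite in_itv /= !mxE ler_norml => /andP[? ?].
    by apply/andP; split; lra.
  apply: (@rV_compact R n (fun i =>
    `[cmap c x ord0 i - e / 2, cmap c x ord0 i + e / 2]%classic)) => i.
  exact: segment_compact.
pose K := cinv c @` B.
have Kc : K `<=` cdom c by move=> _ [p /BW[/cinvP[? _] _] <-].
have clK : closed K.
  apply: compact_closed; first exact: points_hausdorff.
  apply: continuous_compact => //; apply: continuous_in_subspaceT => p.
  rewrite inE => /BW[/cinvP[cp pE] _]; rewrite -pE.
  exact: cinv_continuous.
have [b [bs b01 b1 b0]] := bump_exists (cmap c x) e2.
pose h y := if `[< cdom c y >] then b (cmap c y) else 0.
have h0 y : ~ K y -> h y = 0.
  move=> Ky; rewrite /h; case: asboolP => // cy; apply: b0.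
  rewrite ltNge; apply/negP => By; apply: Ky; exists (cmap c y) => //.
  exact: cmapK.
exists K, h; split; first by move=> _ [p /BW[_ Np] <-].
split=> //.
- move=> y; have [cy|cy] := pselect (cdom c y).
    apply: (smooth_near_chartP (F := b) (P := fun=> True) ac cy).
    + exact: filterT.
    + by move=> O oO _; exact: Cinfty_sub bs.
    + apply: filterS (near_cimg cy) => p /cinvP[cp pE].
      by rewrite /h pE; case: asboolP.
  apply: (@smooth_near_eq _ _ _ _ (fun=> 0)); first exact: smooth_near_cst.
  have Ky : (~` K) y by move=> /Kc.
  have oK : open (~` K) by exact: closed_openC.
  by apply: filterS (open_nbhs_nbhs (conj oK Ky)) => y' /h0.
- by move=> y; rewrite /h; case: asboolP => // _; rewrite lexx ler01.
- apply: filterS2 (near_cdom cx) (near_cmap cx b1) => y cy.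
  by rewrite /h; case: asboolP.
Qed.

Lemma smooth_near_cutoff x (K : set M) b f : is_bump x K b ->
  (forall y, K y -> smooth_near y f) -> forall y, smooth_near y (fun y => b y * f y).
Proof.
move=> [clK bs _ _ b0] fK y; have [Ky|Ky] := pselect (K y).
  by apply: smooth_near_mul => //; exact: fK.
apply: (@smooth_near_eq _ _ _ _ (fun=> 0)); first exact: smooth_near_cst.
have oK : open (~` K) by exact: closed_openC.
by apply: filterS (open_nbhs_nbhs (conj oK Ky)) => y' /b0 ->; rewrite mul0r.
Qed.

End ManifoldBump.

Section TangentVectors.
Context {R : realType} {n : nat} {M : manifold R n}.
Implicit Types (c k : chart R n M) (f g : M -> R).
Variables (x : M) (D : (M -> R) -> R).
Hypothesis DT : tangent_space x D.

Lemma tangent_comb (a : R) f g : smooth_near x f -> smooth_near x g ->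
  D (fun y => a * f y + g y) = a * D f + D g.
Proof. by case: DT => _ h _; exact: h. Qed.

Lemma tangent_mul f g : smooth_near x f -> smooth_near x g ->
  D (fun y => f y * g y) = D f * g x + f x * D g.
Proof. by case: DT => _ _ h; exact: h. Qed.

Lemma tangent_add f g : smooth_near x f -> smooth_near x g ->
  D (fun y => f y + g y) = D f + D g.
Proof.
move=> fx gx; rewrite -[D f]mul1r -tangent_comb //; congr D.
by apply/funext => y; rewrite mul1r.
Qed.

Lemma tangent_cst (a : R) : D (fun=> a) = 0.
Proof.
have D1 : D (fun=> 1) = 0.
  have := tangent_mul (smooth_near_cst x 1) (smooth_near_cst x 1).
  have -> : (fun=> 1 * 1) = (fun=> 1) :> (M -> R) by apply/funext => y; rewrite mulr1.
  by rewrite mulr1 mul1r => /eqP; rewrite -subr_eq subrr eq_sym => /eqP.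
have D0 : D (fun=> 0) = 0.
  have := tangent_comb (-1) (smooth_near_cst x 1) (smooth_near_cst x 1).
  have -> : (fun=> -1 * 1 + 1) = (fun=> 0) :> (M -> R) by apply/funext => y; ring.
  by rewrite D1 mulr0 addr0.
have := tangent_comb a (smooth_near_cst x 1) (smooth_near_cst x 0).
have -> : (fun=> a * 1 + 0) = (fun=> a) :> (M -> R) by apply/funext => y; ring.
by rewrite D1 D0 mulr0 addr0.
Qed.

Lemma tangent_sum (I : Type) (r : seq I) (F : I -> M -> R) :
  (forall i, smooth_near x (F i)) ->
  D (fun y => \sum_(i <- r) F i y) = \sum_(i <- r) D (F i).
Proof.
move=> h; elim: r => [|i r IH].
  by under eq_fun do rewrite big_nil; rewrite tangent_cst big_nil.
under eq_fun do rewrite big_cons.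
by rewrite tangent_add ?big_cons ?IH //; exact: smooth_near_sum.
Qed.

(* Multiplying by the indicator of an open set on which f and g agree, which is
   smooth near x, turns the germ equality into an equality of functions. *)
Lemma tangent_local f g : smooth_near x f -> (\forall y \near x, f y = g y) ->
  D f = D g.
Proof.
move=> fx E; have gx := smooth_near_eq fx E.
pose O := interior [set y | f y = g y].
pose h y : R := if `[< O y >] then 1 else 0.
have nO : \forall y \near x, O y by exact: nbhs_interior.
have h1 : \forall y \near x, 1 = h y.
  by apply: filterS nO => y Oy; rewrite /h; case: asboolP.
have hx : smooth_near x h := smooth_near_eq (smooth_near_cst x 1) h1.
have hx1 : h x = 1 by rewrite -(nbhs_singleton h1).
have : D (fun y => h y * f y) = D (fun y => h y * g y).
  congr D; apply/funext => y; rewrite /h; case: asboolP => [Oy|_].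
    by rewrite (interior_subset Oy).
  by rewrite !mul0r.
rewrite !tangent_mul // hx1 !mul1r (nbhs_singleton E).
exact: addrI.
Qed.

(** In the Hadamard expansion of [f] the vector kills the constant; in each product the coordinate
    factor vanishes at [x], so Leibniz leaves only its derivative times the value of the other
    factor, a partial derivative of [f]. *)
Lemma tangent_expand k f : atlas k -> cdom k x -> smooth_near x f ->
  D f = \sum_A D (coordinate k A) * partial k A f x.
Proof.
move=> ak kx fx; have [W [oW Wx Wc fW]] := smooth_near_chart ak kx fx.
have := open_nbhs_nbhs (conj oW Wx); move/nbhs_ballP => [e /= e0 eW].
have [G [GU Gx fE]] := Hadamard e0 (Cinfty_sub eW fW).
have nB : \forall p \near cmap k x, ball (cmap k x) e p by exact: nbhsx_ballx.
pose g A y := G A (cmap k y).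
have gs A : smooth_near x (g A).
  apply: (smooth_near_chartP (F := G A) (P := ball (cmap k x) e) ak kx nB).
  - by move=> O oO OB; exact: Cinfty_sub (GU A).
  - by apply: filterS (near_cimg kx) => p /cinvP[_ pE]; rewrite /g pE.
have ls A : smooth_near x (fun y => coordinate k A y + - cmap k x ord0 A).
  apply: smooth_near_add; first exact: smooth_near_coordinate.
  exact: smooth_near_cst.
have E : \forall y \near x, f y = f x +
    \sum_A (coordinate k A y + - cmap k x ord0 A) * g A y.
  apply: filterS2 (near_cdom kx) (near_cmap kx nB) => y ky By.
  by have := fE _ By; rewrite /= !cmapK.
have ss A : smooth_near x (fun y => (coordinate k A y + - cmap k x ord0 A) * g A y).
  exact: smooth_near_mul.
rewrite (tangent_local fx E) tangent_add ?tangent_cst ?add0r //; first last.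
- exact: smooth_near_sum.
- exact: smooth_near_cst.
rewrite tangent_sum //; apply: eq_bigr => A _.
rewrite tangent_mul // tangent_add ?tangent_cst; first last.
- exact: smooth_near_cst.
- exact: smooth_near_coordinate.
by rewrite addr0 /coordinate addrN mul0r addr0 /g Gx.
Qed.

End TangentVectors.

Section CoordinateVectors.
Context {R : realType} {n : nat} {M : manifold R n}.
Implicit Types (c : chart R n M) (f g : M -> R).

Lemma coordinate_vectorE c i (x : M) f : smooth_near x f ->
  coordinate_vector c i x f = partial c i f x.
Proof. by move=> fx; rewrite /coordinate_vector; case: asboolP. Qed.

Lemma coordinate_vector_tangent c i (x : M) : atlas c -> cdom c x ->
  tangent_space x (coordinate_vector c i x).
Proof.
move=> ac cx; split=> [f nf|a f g fx gx|f g fx gx].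
- by rewrite /coordinate_vector; case: asboolP.
- have afx : smooth_near x (fun y => a * f y).
    by apply: smooth_near_mul => //; exact: smooth_near_cst.
  rewrite !coordinate_vectorE //; last exact: smooth_near_add.
  by rewrite partial_add // partial_scale.
- by rewrite !coordinate_vectorE //; [rewrite partial_mul|exact: smooth_near_mul].
Qed.

(* The commutator of two coordinate fields is a derivation killing all the
   coordinates, hence it vanishes. *)
Lemma partial_comm c i j (x : M) f : atlas c -> cdom c x -> smooth_near x f ->
  partial c i (partial c j f) x = partial c j (partial c i f) x.
Proof.
move=> ac cx fx.
pose C f := partial c i (partial c j f) x - partial c j (partial c i f) x.
(* The value 0 on functions that are not smooth near [x] is the normalization imposed by
   [tangent_space]. *)
pose D f : R := if `[< smooth_near x f >] then C f else 0.
have DE g : smooth_near x g -> D g = C g by rewrite /D; case: asboolP.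
have nc := near_cdom cx.
have ps g l : smooth_near x g -> smooth_near x (partial c l g).
  exact: smooth_near_partial.
have DT : tangent_space x D.
  split=> [g|a g h gx hx|g h gx hx]; first by rewrite /D; case: asboolP.
  - have ax : smooth_near x (fun y => a * g y).
      by apply: smooth_near_mul => //; exact: smooth_near_cst.
    rewrite !DE ?/C //; last exact: smooth_near_add.
    have E l m : partial c l (partial c m (fun y => a * g y + h y)) x
        = a * partial c l (partial c m g) x + partial c l (partial c m h) x.
      rewrite (@partial_eq _ _ _ _ _ _ (fun y => a * partial c m g y + partial c m h y)) //.
        rewrite partial_add ?partial_scale //; try exact: ps.
        by apply: smooth_near_mul; [exact: smooth_near_cst|exact: ps].
      apply: filterS3 nc (smooth_near_near gx) (smooth_near_near hx) => y cy gy hy.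
      rewrite partial_add ?partial_scale //.
      by apply: smooth_near_mul => //; exact: smooth_near_cst.
    rewrite (E i j) (E j i).
    move: (partial c i _ x) (partial c j _ x) (partial c i _ x) (partial c j _ x).
    by move=> *; ring.
  - rewrite !DE ?/C //; last exact: smooth_near_mul.
    have E l m : partial c l (partial c m (fun y => g y * h y)) x
        = partial c l (partial c m g) x * h x + partial c m g x * partial c l h x
         + (partial c l g x * partial c m h x + g x * partial c l (partial c m h) x).
      rewrite (@partial_eq _ _ _ _ _ _
        (fun y => partial c m g y * h y + g y * partial c m h y)) //.
        rewrite partial_add ?partial_mul //; try exact: ps.
        1, 2: by apply: smooth_near_mul => //; exact: ps.
      apply: filterS3 nc (smooth_near_near gx) (smooth_near_near hx) => y cy gy hy.
      by rewrite partial_mul.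
    rewrite (E i j) (E j i).
    move: (partial c i _ x) (partial c j _ x) (partial c i _ x) (partial c j _ x)
      (partial c i _ x) (partial c j _ x) (partial c i _ x) (partial c j _ x).
    by move=> *; ring.
have D0 A : D (coordinate c A) = 0.
  rewrite DE; last exact: smooth_near_coordinate.
  have E l m : partial c l (partial c m (coordinate c A)) x = 0.
    rewrite (@partial_eq _ _ _ _ _ _ (fun=> (m == A)%:R)) ?partial_cst //.
    by apply: filterS nc => y cy; rewrite partial_coordinate.
  by rewrite /C !E subrr.
have D1 : D f = 0.
  rewrite (tangent_expand DT ac cx fx); apply: big1 => A _.
  by rewrite D0 mul0r.
by apply/eqP; rewrite -subr_eq0 -D1 (DE f fx) /C.
Qed.

End CoordinateVectors.

(** * Sections and frames *)

Section FrameComponents.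
Context {R : realType} {T : topologicalType} {F : T -> vectType R} {r : nat}.
Variable s : local_frame F r.

Lemma component_linear a x (c : R) (u v : F x) :
  component s a (c *: u + v) = c * component s a u + component s a v.
Proof. by rewrite /component linearP. Qed.

Lemma component0 a x : component s a (0 : F x) = 0.
Proof. by rewrite /component linear0. Qed.

Lemma componentD a x (u v : F x) :
  component s a (u + v) = component s a u + component s a v.
Proof. by rewrite /component linearD. Qed.

Lemma componentN a x (u : F x) : component s a (- u) = - component s a u.
Proof. by rewrite /component linearN. Qed.

Lemma componentZ a x (c : R) (u : F x) :
  component s a (c *: u) = c * component s a u.
Proof. by rewrite /component linearZ. Qed.

Lemma component_sum a x (I : Type) (t : seq I) (P : pred I) (u : I -> F x) :
  component s a (\sum_(i <- t | P i) u i) = \sum_(i <- t | P i) component s a (u i).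
Proof. by rewrite /component linear_sum. Qed.

Lemma component_fsec a b x : fdom s x -> component s a (fsec s b x) = (a == b)%:R.
Proof.
move=> sx; have := @coord_free _ _ _ [tuple fsec s a x | a < r] b a
  (basis_free (fsec_basis sx)).
by rewrite -tnth_nth tnth_mktuple eq_sym.
Qed.

Lemma component_expand x (v : F x) : fdom s x ->
  v = \sum_a component s a v *: fsec s a x.
Proof.
move=> sx; rewrite [LHS](coord_basis (fsec_basis sx) (memvf v)).
by apply: eq_bigr => a _; rewrite -tnth_nth tnth_mktuple.
Qed.

End FrameComponents.

Section BundleSections.
Context {R : realType} {n : nat} {M : manifold R n} {r : nat}.
Context {E : vector_bundle M r}.
Implicit Types (u v w : section E) (x y : M) (s : local_frame E r).

Definition section_near x u : Prop := forall s, frames s -> fdom s x ->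
  forall a, smooth_near x (fun y => component s a (u y)).

Lemma near_fdom s x : fdom s x -> \forall y \near x, fdom s y.
Proof. by move=> sx; exact: open_nbhs_nbhs (conj (fdom_open s) sx). Qed.

Lemma frame_change_smooth s s' a b x : frames s -> frames s' -> fdom s x ->
  fdom s' x -> smooth_near x (fun y => component s a (fsec s' b y)).
Proof.
move=> fs fs' sx s'x; exists (fdom s `&` fdom s'); split; last 2 first.
- by split.
- exact: frames_compatible.
- by apply: openI; exact: fdom_open.
Qed.

Lemma section_near_frame s x u : frames s -> fdom s x ->
  (forall a, smooth_near x (fun y => component s a (u y))) -> section_near x u.
Proof.
move=> fs sx us s' fs' s'x a.
apply: (@smooth_near_eq _ _ _ _ (fun y =>
   \sum_b component s b (u y) * component s' a (fsec s b y))).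
  apply: smooth_near_sum => b; apply: smooth_near_mul => //.
  exact: frame_change_smooth.
apply: filterS (near_fdom sx) => y sy.
rewrite [in RHS](component_expand (u y) sy) component_sum.
by apply: eq_bigr => b _; rewrite componentZ.
Qed.

Lemma section_smooth_onP (U : set M) u : open U ->
  section_smooth_on U u <-> forall x, U x -> section_near x u.
Proof.
move=> oU; have oUs s : open (U `&` fdom s) by apply: openI => //; exact: fdom_open.
split=> [H x Ux s fs sx a|H s fs a].
  by apply: (smooth_onP _ (oUs s)).1 => //; exact: H.
by apply/(smooth_onP _ (oUs s)) => x [Ux sx]; exact: H.
Qed.

Lemma SecP u : Sec u <-> forall x, section_near x u.
Proof.
split=> [/section_smooth_onP H x|H]; first by apply: H => //; exact: openT.
by apply/section_smooth_onP; first exact: openT.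
Qed.

Lemma section_near_near x u : section_near x u -> \forall y \near x, section_near y u.
Proof.
move=> ux; have [s fs sx] := @frames_cover _ _ _ _ E x.
have H : \forall y \near x, forall a, smooth_near y (fun y => component s a (u y)).
  apply: (near_forall (P := fun a y => smooth_near y (fun y => component s a (u y)))) => a.
  by apply: smooth_near_near; exact: ux.
apply: filterS2 H (near_fdom sx) => y Hy sy.
exact: section_near_frame sy Hy.
Qed.

Lemma section_near_eq x u v : section_near x u -> (\forall y \near x, u y = v y) ->
  section_near x v.
Proof.
move=> ux uv s fs sx a; apply: (smooth_near_eq (ux s fs sx a)).
by apply: filterS uv => y ->.
Qed.

Lemma section_near0 x : section_near x (@section_zero _ _ _ _ E).
Proof.
move=> s fs sx a; apply: (@smooth_near_eq _ _ _ _ (fun=> 0)).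
  exact: smooth_near_cst.
by apply: filterE => y; rewrite component0.
Qed.

Lemma section_near_comb x (a : R) u v : section_near x u -> section_near x v ->
  section_near x (section_comb a u v).
Proof.
move=> ux vx s fs sx b.
apply: (@smooth_near_eq _ _ _ _ (fun y => a * component s b (u y) + component s b (v y))).
  apply: smooth_near_add; last exact: vx.
  by apply: smooth_near_mul; [exact: smooth_near_cst|exact: ux].
by apply: filterE => y; rewrite component_linear.
Qed.

Lemma section_near_scale x (f : M -> R) u : smooth_near x f -> section_near x u ->
  section_near x (section_scale f u).
Proof.
move=> fx ux s fs sx b.
apply: (@smooth_near_eq _ _ _ _ (fun y => f y * component s b (u y))).
  by apply: smooth_near_mul => //; exact: ux.
by apply: filterE => y; rewrite componentZ.
Qed.

Lemma section_near_fsec s a x : frames s -> fdom s x -> section_near x (fsec s a).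
Proof.
move=> fs sx; apply: (section_near_frame fs sx) => b.
exact: frame_change_smooth.
Qed.

Lemma Sec0 : Sec (@section_zero _ _ _ _ E).
Proof. by apply/SecP => x; exact: section_near0. Qed.

Lemma Sec_comb (a : R) u v : Sec u -> Sec v -> Sec (section_comb a u v).
Proof. by move=> /SecP Su /SecP Sv; apply/SecP => x; exact: section_near_comb. Qed.

Lemma Sec_scale (f : M -> R) u : (forall x, smooth_near x f) -> Sec u ->
  Sec (section_scale f u).
Proof. by move=> fs /SecP Su; apply/SecP => x; exact: section_near_scale. Qed.

(** Replaces a local section by a global one with the same germ, to which the bracket can be
    applied. *)
Lemma section_extend x u : section_near x u ->
  exists v, Sec v /\ \forall y \near x, v y = u y.
Proof.
move=> ux; have [K [b [KN [clK bs _ b1 b0]]]] := manifold_bump (section_near_near ux).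
exists (section_scale b u); split; last first.
  by apply: filterS b1 => y by1; rewrite /section_scale by1 scale1r.
apply/SecP => y; have [Ky|Ky] := pselect (K y).
  by apply: section_near_scale => //; exact: KN.
apply: (section_near_eq (@section_near0 y)).
have oK : open (~` K) by exact: closed_openC.
apply: filterS (open_nbhs_nbhs (conj oK Ky)) => y' /b0.
by rewrite /section_scale => ->; rewrite scale0r.
Qed.

Lemma function_extend x (f : M -> R) : smooth_near x f ->
  exists g, (forall y, smooth_near y g) /\ \forall y \near x, g y = f y.
Proof.
move=> fx; have [K [b [KN bb]]] := manifold_bump (smooth_near_near fx).
exists (fun y => b y * f y); split; first exact: (smooth_near_cutoff bb).
by case: bb => _ _ _ b1 _; apply: filterS b1 => y ->; rewrite mul1r.
Qed.

Lemma frame_extend s x : frames s -> fdom s x ->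
  exists e : 'I_r -> section E, (forall a, Sec (e a)) /\
    \forall y \near x, forall a, e a y = fsec s a y.
Proof.
move=> fs sx; have H a := section_extend (section_near_fsec a fs sx).
have [e eP] := choice H; exists e; split=> [a|]; first by have [] := eP a.
apply: (near_forall (P := fun a y => e a y = fsec s a y)) => a.
by have [] := eP a.
Qed.

Lemma components_extend s x u : frames s -> fdom s x -> section_near x u ->
  exists g : 'I_r -> M -> R, (forall a y, smooth_near y (g a)) /\
    \forall y \near x, forall a, g a y = component s a (u y).
Proof.
move=> fs sx ux; have H a := function_extend (ux s fs sx a).
have [g gP] := choice H; exists g; split=> [a|]; first by have [] := gP a.
apply: (near_forall (P := fun a y => g a y = component s a (u y))) => a.
by have [] := gP a.
Qed.

Definition section_sum (I : Type) (t : seq I) (g : I -> M -> R)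
    (e : I -> section E) : section E :=
  fun x => \sum_(a <- t) g a x *: e a x.

Lemma section_sum_cons (I : Type) (a : I) t (g : I -> M -> R) (e : I -> section E) :
  section_sum (a :: t) g e
  = section_comb 1 (section_scale (g a) (e a)) (section_sum t g e).
Proof.
apply: functional_extensionality_dep => x.
by rewrite /section_sum /section_comb /section_scale big_cons scale1r.
Qed.

Lemma section_sum_nil (I : Type) (g : I -> M -> R) (e : I -> section E) :
  section_sum [::] g e = @section_zero _ _ _ _ E.
Proof.
by apply: functional_extensionality_dep => x; rewrite /section_sum big_nil.
Qed.

Lemma Sec_sum (I : Type) (t : seq I) (g : I -> M -> R) (e : I -> section E) :
  (forall a y, smooth_near y (g a)) -> (forall a, Sec (e a)) ->
  Sec (section_sum t g e).
Proof.
move=> gs es; elim: t => [|a t IH]; first by rewrite section_sum_nil; exact: Sec0.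
by rewrite section_sum_cons; apply: Sec_comb => //; exact: Sec_scale.
Qed.

Lemma section_frame_sum s x u e g : fdom s x ->
  (\forall y \near x, forall a, e a y = fsec s a y) ->
  (\forall y \near x, forall a, g a y = component s a (u y)) ->
  \forall y \near x, u y = section_sum (index_enum 'I_r) g e y.
Proof.
move=> sx He Hg; apply: filterS3 (near_fdom sx) He Hg => y sy ey gy.
rewrite [LHS](component_expand (u y) sy) /section_sum.
by apply: eq_bigr => a _; rewrite gy ey.
Qed.

End BundleSections.

(** * Anchor and bracket *)

Section AnchorBracket.
Context {R : realType} {n : nat} {M : manifold R n} {r : nat}.
Context {E : lie_algebroid M r}.
Implicit Types (u v w : section E) (x y : M) (s : local_frame E r) (f : M -> R).

Lemma smooth_on_setT f : smooth_on setT f <-> forall x, smooth_near x f.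
Proof.
split=> [/(smooth_onP _ openT) H x|H]; first exact: H.
by apply/(smooth_onP _ openT).
Qed.

Lemma anchor0 x : anchor (0 : E x) = 0.
Proof.
have := @anchor_linear _ _ _ _ E x (-1) 0 0.
by rewrite scaler0 addr0 => ->; rewrite scaleN1r addNr.
Qed.

Lemma anchorZ x (a : R) (e : E x) : anchor (a *: e) = a *: anchor e.
Proof. by rewrite -[a *: e]addr0 anchor_linear anchor0 addr0. Qed.

Lemma anchorD x (e e' : E x) : anchor (e + e') = anchor e + anchor e'.
Proof. by rewrite -[e in LHS]scale1r anchor_linear scale1r. Qed.

Lemma anchor_sum x (I : Type) (t : seq I) (e : I -> E x) f :
  anchor (\sum_(i <- t) e i) f = \sum_(i <- t) anchor (e i) f.
Proof.
elim: t => [|i t IH]; first by rewrite !big_nil anchor0.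
by rewrite !big_cons anchorD -IH.
Qed.

Lemma anchor_smooth_near x u f : section_near x u -> smooth_near x f ->
  smooth_near x (fun y => anchor (u y) f).
Proof.
move=> ux fx; pose P y := section_near y u /\ smooth_near y f.
have nP : \forall y \near x, P y.
  by apply: filterS2 (section_near_near ux) (smooth_near_near fx).
pose U := interior [set y | P y].
have oU : open U by exact: open_interior.
have HU y : U y -> P y by move=> /interior_subset.
exists U; split => //; apply: anchor_smooth => //.
  by apply/(section_smooth_onP _ oU) => y /HU[].
by apply/(smooth_onP _ oU) => y /HU[].
Qed.

Lemma anchor_smooth_global u f : Sec u -> (forall x, smooth_near x f) ->
  forall x, smooth_near x (fun y => anchor (u y) f).
Proof. by move=> /SecP Su fs x; apply: anchor_smooth_near => //; exact: Su. Qed.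

Lemma anchor_frame_expand s x (e : E x) f : fdom s x ->
  anchor e f = \sum_a component s a e * anchor (fsec s a x) f.
Proof.
move=> sx; rewrite [in LHS](component_expand e sx) anchor_sum.
by apply: eq_bigr => a _; rewrite anchorZ.
Qed.

Lemma bracket_combr (a : R) u v w : Sec u -> Sec v -> Sec w -> forall x,
  bracket w (section_comb a u v) x = a *: bracket w u x + bracket w v x.
Proof.
move=> Su Sv Sw x; rewrite bracket_antisym //; last exact: Sec_comb.
rewrite bracket_linear // /section_comb opprD -scalerN.
by rewrite -(bracket_antisym Sw Su) -(bracket_antisym Sw Sv).
Qed.

Lemma bracket0r u x : Sec u -> bracket u (@section_zero _ _ _ _ E) x = 0.
Proof.
move=> Su; have := bracket_combr (-1) (@Sec0 _ _ _ _ E) (@Sec0 _ _ _ _ E) Su x.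
have -> : section_comb (-1) (@section_zero _ _ _ _ E) (@section_zero _ _ _ _ E)
    = @section_zero _ _ _ _ E.
  apply: functional_extensionality_dep => y.
  by rewrite /section_comb /section_zero scaler0 addr0.
by rewrite scaleN1r addNr.
Qed.

Lemma bracket_scaler u v f x : Sec u -> Sec v -> (forall x, smooth_near x f) ->
  bracket u (section_scale f v) x = anchor (u x) f *: v x + f x *: bracket u v x.
Proof. by move=> Su Sv fs; rewrite bracket_leibniz //; exact/smooth_on_setT. Qed.

Lemma bracket_sumr u (I : Type) (t : seq I) (g : I -> M -> R)
    (e : I -> section E) x : Sec u -> (forall a y, smooth_near y (g a)) ->
  (forall a, Sec (e a)) ->
  bracket u (section_sum t g e) x
  = \sum_(a <- t) (anchor (u x) (g a) *: e a x + g a x *: bracket u (e a) x).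
Proof.
move=> Su gs es; elim: t => [|a t IH].
  by rewrite section_sum_nil bracket0r // big_nil.
rewrite section_sum_cons bracket_combr //; last 2 first.
- exact: Sec_scale.
- exact: Sec_sum.
by rewrite scale1r big_cons IH bracket_scaler //; exact: gs.
Qed.

(* If v vanishes near x then v = (1 - b) v for a bump function b at x, and the
   Leibniz rule gives [u, v](x) = 0. *)
Lemma bracket_local0 u v x : Sec u -> Sec v -> (\forall y \near x, v y = 0) ->
  bracket u v x = 0.
Proof.
move=> Su Sv v0; have [K [b [KN [clK bs _ b1 b0]]]] := manifold_bump v0.
pose h y := 1 + (-1) * b y.
have hs y : smooth_near y h.
  apply: smooth_near_add; first exact: smooth_near_cst.
  by apply: smooth_near_mul; [exact: smooth_near_cst|exact: bs].
have vE : v = section_scale h v.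
  apply: functional_extensionality_dep => y; rewrite /section_scale /h.
  have [Ky|Ky] := pselect (K y); first by rewrite (KN _ Ky) scaler0.
  by rewrite b0 // mulr0 addr0 scale1r.
rewrite vE bracket_scaler // (nbhs_singleton v0) scaler0 add0r.
by rewrite /h (nbhs_singleton b1) mulr1 subrr scale0r.
Qed.

Lemma bracket_localr u v v' x : Sec u -> Sec v -> Sec v' ->
  (\forall y \near x, v y = v' y) -> bracket u v x = bracket u v' x.
Proof.
move=> Su Sv Sv' E'; have := @bracket_local0 u (section_comb (-1) v v') x Su.
move=> /(_ (Sec_comb _ Sv Sv')) H.
have /H : \forall y \near x, section_comb (-1) v v' y = 0.
  by apply: filterS E' => y yE; rewrite /section_comb yE scaleN1r addNr.
by rewrite bracket_combr // scaleN1r addrC => /eqP; rewrite subr_eq0 => /eqP ->.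
Qed.

Lemma bracket_locall u u' v x : Sec u -> Sec u' -> Sec v ->
  (\forall y \near x, u y = u' y) -> bracket u v x = bracket u' v x.
Proof.
move=> Su Su' Sv E'; rewrite bracket_antisym // (bracket_localr Sv Su Su' E').
by rewrite -bracket_antisym.
Qed.

(** By locality of the bracket the set inside [structure_fun] has exactly one element, so neither
    the choice of extensions nor the default value 0 is visible. *)
Lemma structure_funE s a b c x u v : Sec u -> Sec v ->
  (\forall y \near x, u y = fsec s a y) -> (\forall y \near x, v y = fsec s b y) ->
  structure_fun s a b c x = component s c (bracket u v x).
Proof.
move=> Su Sv ua vb; rewrite /structure_fun.
case: xgetP => [q _ [u' [v' [Su' Sv' uv' ->]]]|H].
  rewrite (@bracket_localr _ _ v) // ?(@bracket_locall _ u) //.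
    by apply: filterS2 uv' ua => y [-> _] ->.
  by apply: filterS2 uv' vb => y [_ ->] ->.
exfalso; apply: (H (component s c (bracket u v x))).
by exists u, v; split=> //; apply: filterS2 ua vb.
Qed.

Lemma structure_fun_antisym s a b c x : frames s -> fdom s x ->
  structure_fun s a b c x = - structure_fun s b a c x.
Proof.
move=> fs sx; have [e [Se He]] := frame_extend fs sx.
have Ha d : \forall y \near x, e d y = fsec s d y by apply: filterS He.
rewrite (structure_funE c (Se a) (Se b) (Ha a) (Ha b)).
rewrite (structure_funE c (Se b) (Se a) (Ha b) (Ha a)).
by rewrite bracket_antisym // componentN.
Qed.

(** Near [x] the section [u] is a combination of the frame with globally smooth coefficients, and
    Leibniz applies to [s_b, u]. The parenthesis is the fibre variation, with its derivative term
    still written through the anchor. *)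
Lemma bracket_frame s x u (e : 'I_r -> section E) b c :
  frames s -> fdom s x -> Sec u -> (forall a, Sec (e a)) ->
  (\forall y \near x, forall a, e a y = fsec s a y) ->
  component s c (bracket u (e b) x)
  = - (anchor (fsec s b x) (fun y => component s c (u y))
       - \sum_a component s a (u x) * structure_fun s a b c x).
Proof.
move=> fs sx Su Se He; have ux : section_near x u by exact: (SecP u).1.
have [g [gs Hg]] := components_extend fs sx ux.
have Ha d : \forall y \near x, e d y = fsec s d y by apply: filterS He.
have uE := section_frame_sum sx He Hg.
have Ssum := Sec_sum (index_enum 'I_r) gs Se.
rewrite bracket_antisym // componentN; congr (- _).
rewrite (bracket_localr (Se b) Su Ssum uE) bracket_sumr // component_sum.
rewrite (eq_bigr (fun a => anchor (e b x) (g a) * (c == a)%:R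
    + - (component s a (u x) * structure_fun s a b c x))); last first.
  move=> a _; rewrite componentD !componentZ (nbhs_singleton (Ha a)) component_fsec //.
  rewrite (nbhs_singleton Hg) (structure_fun_antisym a b c fs sx).
  by rewrite (structure_funE c (Se b) (Se a) (Ha b) (Ha a)) mulrN opprK.
rewrite big_split /= sumrN; congr (_ - _).
rewrite (bigD1 c) //= eqxx mulr1 big1 ?addr0; last first.
  by move=> a ac; rewrite eq_sym (negbTE ac) mulr0.
rewrite (nbhs_singleton (Ha b)); apply: (tangent_local (anchor_tangent _)); first exact: gs.
by apply: filterS Hg.
Qed.

Lemma bracket_swapr u v w x : Sec u -> Sec v -> Sec w ->
  bracket u (bracket w v) x = - bracket u (bracket v w) x.
Proof.
move=> Su Sv Sw; have S1 := bracket_smooth Sv Sw.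
have -> : bracket w v = section_comb (-1) (bracket v w) (@section_zero _ _ _ _ E).
  apply: functional_extensionality_dep => y.
  by rewrite /section_comb /section_zero addr0 scaleN1r -bracket_antisym.
by rewrite bracket_combr //; [rewrite bracket0r // addr0 scaleN1r|exact: Sec0].
Qed.

Lemma bracket_bracket u v w x : Sec u -> Sec v -> Sec w ->
  bracket (bracket u v) w x = bracket u (bracket v w) x - bracket v (bracket u w) x.
Proof.
move=> Su Sv Sw; have Suv := bracket_smooth Su Sv.
have := bracket_jacobi Su Sv Sw x.
rewrite (bracket_swapr x Sv Su) // (bracket_antisym Sw Suv).
by move/eqP; rewrite subr_eq0 => /eqP ->.
Qed.

(* Jacobi for u, v and f w: all the terms cancel except the failure of the anchor
   to be a morphism, applied to f and multiplied by w. *)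
Lemma anchor_bracket u v w f x : Sec u -> Sec v -> Sec w ->
  (forall y, smooth_near y f) -> w x != 0 ->
  anchor (bracket u v x) f = anchor (u x) (fun y => anchor (v y) f)
    - anchor (v x) (fun y => anchor (u y) f).
Proof.
move=> Su Sv Sw fs w0.
have key (u1 v1 : section E) : Sec u1 -> Sec v1 ->
    bracket u1 (bracket v1 (section_scale f w)) x
    = anchor (u1 x) (fun y => anchor (v1 y) f) *: w x
      + anchor (v1 x) f *: bracket u1 w x
      + (anchor (u1 x) f *: bracket v1 w x + f x *: bracket u1 (bracket v1 w) x).
  move=> Su1 Sv1.
  have -> : bracket v1 (section_scale f w) = section_comb 1
      (section_scale (fun y => anchor (v1 y) f) w) (section_scale f (bracket v1 w)).
    apply: functional_extensionality_dep => y.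
    by rewrite bracket_scaler // /section_comb scale1r.
  have S1 := bracket_smooth Sv1 Sw; have fs1 := anchor_smooth_global Sv1 fs.
  rewrite bracket_combr //; last 2 first.
  - exact: Sec_scale.
  - exact: Sec_scale.
  by rewrite scale1r !bracket_scaler.
have Sfw : Sec (section_scale f w) by exact: Sec_scale.
have Suv := bracket_smooth Su Sv.
have J1 := bracket_jacobi Su Sv Sfw x; have XE := bracket_bracket x Su Sv Sw.
rewrite (bracket_swapr x Sv Su) // (bracket_antisym Sfw Suv) !key // bracket_scaler // in J1.
set A := anchor (u x) (fun y => anchor (v y) f) in J1 *.
set B := anchor (v x) (fun y => anchor (u y) f) in J1 *.
set C := anchor (bracket u v x) f in J1 *.
move: (anchor (u x) f) (anchor (v x) f) (bracket u (bracket v w) x)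
  (bracket v (bracket u w) x) (bracket (bracket u v) w x) (bracket u w x)
  (bracket v w x) (f x) J1 XE => p q X Y Z U V t J1 XE.
have : (A - B - C) *: w x = 0.
  have {}XE : X = Y + Z by rewrite XE addrC subrK.
  (* The terms are vectors of a fibre, so the cancellation is carried out in an abstract additive
     group. *)
  have cancel_terms (K : zmodType) (a b c d e g h : K) :
      a - b - c = a + d + (e + (g + h)) - (b + e + (d + g)) - (c + h).
    have -> : a + d + (e + (g + h)) = a + h + (d + (e + g)).
      by rewrite (addrA e g) (addrA (a + d)) -(addrA a d) addrAC.
    have cancel (i j l : K) : i + j - (l + j) = i - l.
      by rewrite opprD addrACA subrr addr0.
    by rewrite [b + e + _]addrACA -[b + d + _]addrA cancel [a + h - b]addrAC cancel.
  by rewrite -[RHS]J1 XE scalerDr !scalerBl; exact: cancel_terms.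
move/eqP; rewrite scaler_eq0 (negbTE w0) orbF subr_eq0 => /eqP <-.
by [].
Qed.

End AnchorBracket.

(** * Killing sections *)

Lemma is_derive_bigsum (R : realType) (V : normedModType R) (I : Type)
    (t : seq I) (f : I -> V -> R) (df : I -> R) (x v : V) :
  (forall i, is_derive x v (f i) (df i)) ->
  is_derive x v (fun y => \sum_(i <- t) f i y) (\sum_(i <- t) df i).
Proof.
move=> h; elim: t => [|i t IH].
  by under eq_fun do rewrite big_nil; rewrite big_nil; exact: is_derive_cst.
under eq_fun do rewrite big_cons; rewrite big_cons.
by apply: is_deriveD.
Qed.

Lemma sum_unit_row (R : realType) (r : nat) (a : 'I_r) (F : 'I_r -> R) :
  \sum_i unit_row R a ord0 i * F i = F a.
Proof.
rewrite (bigD1 a) //= mxE !eqxx mul1r big1 ?addr0 // => i ia.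
by rewrite mxE (negbTE ia) andbF mul0r.
Qed.

Lemma sum_mulmx_form (R : realType) (r : nat) (y w : 'rV[R]_r) (N : 'M[R]_r)
    (K : 'I_r -> 'I_r -> R) :
  \sum_c (y *m N) ord0 c * (\sum_b w ord0 b * K c b)
  = \sum_a \sum_b y ord0 a * w ord0 b * (\sum_c N a c * K c b).
Proof.
under eq_bigr do rewrite mxE mulr_suml.
rewrite exchange_big; apply: eq_bigr => a _ /=.
under eq_bigr do rewrite mulr_sumr.
rewrite exchange_big; apply: eq_bigr => b _ /=.
by rewrite mulr_sumr; apply: eq_bigr => c _; ring.
Qed.

(** Polarization: the form is evaluated at unit vectors and at their sums. *)
Lemma quadratic_form_eq0 (R : realType) (r : nat) (B : 'I_r -> 'I_r -> R) :
  (forall a b, B a b = B b a) ->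
  (forall y : 'rV[R]_r, \sum_a \sum_b y ord0 a * y ord0 b * B a b = 0) ->
  forall a b, B a b = 0.
Proof.
move=> Bs B0.
pose Q (y z : 'rV[R]_r) := \sum_a \sum_b y ord0 a * z ord0 b * B a b.
have Qu a b : Q (unit_row R a) (unit_row R b) = B a b.
  rewrite /Q -(sum_unit_row b (B a)) -(sum_unit_row a (fun a => \sum_i unit_row R b ord0 i * B a i)).
  by apply: eq_bigr => i _; rewrite mulr_sumr; apply: eq_bigr => j _; rewrite mulrA.
have QD y z : Q (y + z) (y + z) = Q y y + Q y z + Q z y + Q z z.
  rewrite /Q -!big_split; apply: eq_bigr => i _; rewrite -!big_split /=.
  by apply: eq_bigr => j _; rewrite !mxE; ring.
move=> a b; have := QD (unit_row R a) (unit_row R b).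
rewrite [LHS]B0 [Q _ (unit_row R a)]Qu.
rewrite !Qu.
have Baa c : B c c = 0 by rewrite -Qu; exact: B0.
by rewrite !Baa (Bs b a) add0r addr0 => /eqP; rewrite eq_sym -mulr2n mulrn_eq0 => /eqP.
Qed.

(** * The Lie derivative of the metric and its expression in coordinates *)

Section LieDerivativeMetric.
Context {R : realType} {n : nat} {M : manifold R n} {r : nat}.
Context {E : lie_algebroid M r}.
Variable G : bundle_metric E.
Implicit Types (u v w : section E) (x y : M) (s : local_frame E r) (f : M -> R).

Lemma bmetric_linearl x (a : R) (e e' e'' : E x) :
  G x (a *: e + e') e'' = a * G x e e'' + G x e' e''.
Proof. by have [h _ _] := bmetric_inner G x; exact: h. Qed.

Lemma bmetric_sym x (e e' : E x) : G x e e' = G x e' e.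
Proof. by have [_ h _] := bmetric_inner G x; exact: h. Qed.

Lemma bmetric0l x (e : E x) : G x 0 e = 0.
Proof.
have := bmetric_linearl (-1) (0 : E x) 0 e; rewrite scaler0 addr0 mulN1r.
by rewrite addNr.
Qed.

Lemma bmetricDl x (e e' e'' : E x) : G x (e + e') e'' = G x e e'' + G x e' e''.
Proof. by rewrite -[e in LHS]scale1r bmetric_linearl mul1r. Qed.

Lemma bmetricZl x (a : R) (e e' : E x) : G x (a *: e) e' = a * G x e e'.
Proof. by rewrite -[a *: e]addr0 bmetric_linearl bmetric0l addr0. Qed.

Lemma bmetricNl x (e e' : E x) : G x (- e) e' = - G x e e'.
Proof. by rewrite -scaleN1r bmetricZl mulN1r. Qed.

Lemma bmetric_suml x (I : Type) (t : seq I) (e : I -> E x) (e' : E x) :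
  G x (\sum_(i <- t) e i) e' = \sum_(i <- t) G x (e i) e'.
Proof.
elim: t => [|i t IH]; first by rewrite !big_nil bmetric0l.
by rewrite !big_cons bmetricDl IH.
Qed.

Lemma bmetric_sumsum x (c d : 'I_r -> R) (e : 'I_r -> E x) :
  G x (\sum_a c a *: e a) (\sum_b d b *: e b)
  = \sum_a \sum_b c a * d b * G x (e a) (e b).
Proof.
rewrite bmetric_suml; apply: eq_bigr => a _.
rewrite bmetricZl bmetric_sym bmetric_suml mulr_sumr; apply: eq_bigr => b _.
by rewrite bmetricZl bmetric_sym mulrA.
Qed.

Lemma frame_metric_smooth s a b x : frames s -> fdom s x ->
  smooth_near x (fun y => G y (fsec s a y) (fsec s b y)).
Proof.
by move=> fs sx; exists (fdom s); split=> //;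
  [exact: fdom_open|exact: bmetric_smooth].
Qed.

Lemma bmetric_smooth_near x u v : section_near x u -> section_near x v ->
  smooth_near x (fun y => G y (u y) (v y)).
Proof.
move=> ux vx; have [s fs sx] := @frames_cover _ _ _ _ E x.
apply: (@smooth_near_eq _ _ _ _ (fun y => \sum_a \sum_b
   component s a (u y) * component s b (v y) * G y (fsec s a y) (fsec s b y))).
  apply: smooth_near_sum => a; apply: smooth_near_sum => b.
  apply: smooth_near_mul; last exact: frame_metric_smooth.
  by apply: smooth_near_mul; [exact: ux|exact: vx].
apply: filterS (near_fdom sx) => y sy.
by rewrite [u y in RHS](component_expand (u y) sy) [v y in RHS](component_expand (v y) sy)
  bmetric_sumsum.
Qed.

Lemma bmetric_smooth_global u v : Sec u -> Sec v ->
  forall x, smooth_near x (fun y => G y (u y) (v y)).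
Proof. by move=> /SecP Su /SecP Sv x; exact: bmetric_smooth_near. Qed.

(* (L_u G)(v, w), for global sections *)
Definition lie_metric u v w x : R :=
  anchor (u x) (fun y => G y (v y) (w y))
  - G x (bracket u v x) (w x) - G x (v x) (bracket u w x).

Lemma lie_metric_sym u v w x : lie_metric u v w x = lie_metric u w v x.
Proof.
rewrite /lie_metric.
have -> : (fun y => G y (v y) (w y)) = (fun y => G y (w y) (v y)).
  by apply/funext => y; rewrite bmetric_sym.
by rewrite addrAC [G x (bracket u v x) _]bmetric_sym [G x (v x) _]bmetric_sym.
Qed.

Lemma lie_metric_local u v v' w x : Sec u -> Sec v -> Sec v' -> Sec w ->
  (\forall y \near x, v y = v' y) -> lie_metric u v w x = lie_metric u v' w x.
Proof.
move=> Su Sv Sv' Sw vv'; rewrite /lie_metric (bracket_localr Su Sv Sv' vv').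
rewrite (nbhs_singleton vv'); congr (_ - _ - _).
apply: (tangent_local (anchor_tangent _)); first exact: bmetric_smooth_global.
by apply: filterS vv' => y ->.
Qed.

(** Tensoriality: the derivatives of the coefficients [g a] arise once from the metric function and
    once from the Leibniz rule of the bracket, with opposite signs. *)
Lemma lie_metric_sum u w (I : Type) (t : seq I) (g : I -> M -> R)
    (e : I -> section E) x : Sec u -> Sec w ->
  (forall a y, smooth_near y (g a)) -> (forall a, Sec (e a)) ->
  lie_metric u (section_sum t g e) w x = \sum_(a <- t) g a x * lie_metric u (e a) w x.
Proof.
move=> Su Sw gs Se; rewrite /lie_metric bracket_sumr // /section_sum.
have -> : (fun y => G y (\sum_(a <- t) g a y *: e a y) (w y))
    = (fun y => \sum_(a <- t) g a y * G y (e a y) (w y)).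
  apply/funext => y; rewrite bmetric_suml.
  by apply: eq_bigr => a _; rewrite bmetricZl.
have Gs a : smooth_near x (fun y => G y (e a y) (w y)) by exact: bmetric_smooth_global.
rewrite (tangent_sum (anchor_tangent _)); last first.
  by move=> a; apply: smooth_near_mul => //; exact: gs.
rewrite !bmetric_suml -!sumrB; apply: eq_bigr => a _.
rewrite (tangent_mul (anchor_tangent _)) //.
rewrite bmetricDl !bmetricZl.
move: (anchor (u x) (g a)) (anchor (u x) _) (G x (bracket u (e a) x) _)
  (G x (e a x) (bracket u w x)) => *; ring.
Qed.

Lemma lie_metric_expand s u v w x (e : 'I_r -> section E) :
  frames s -> fdom s x -> Sec u -> Sec v -> Sec w -> (forall a, Sec (e a)) ->
  (\forall y \near x, forall a, e a y = fsec s a y) ->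
  lie_metric u v w x = \sum_a component s a (v x) * lie_metric u (e a) w x.
Proof.
move=> fs sx Su Sv Sw Se He.
have [g [gs Hg]] := components_extend fs sx ((SecP v).1 Sv x).
have vE := section_frame_sum sx He Hg.
have Ssum := Sec_sum (index_enum 'I_r) gs Se.
rewrite (lie_metric_local Su Sv Ssum Sw vE) lie_metric_sum //.
by apply: eq_bigr => a _; rewrite (nbhs_singleton Hg).
Qed.

Section LocalCoordinates.
Variables (k : chart R n M) (s : local_frame E r) (x : M).
Hypotheses (ak : atlas k) (fs : frames s) (kx : cdom k x) (sx : fdom s x).

(* The symmetric bilinear form whose quadratic form is d_T(u)[G]. *)
Definition lift_form u (a b : 'I_r) : R :=
  \sum_A base_variation k s u x ord0 A
      * partial k A (fun y => G y (fsec s a y) (fsec s b y)) x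
  + \sum_c fibre_variation k s u x a c * G x (fsec s c x) (fsec s b x)
  + \sum_c fibre_variation k s u x b c * G x (fsec s a x) (fsec s c x).

Lemma base_variationE u A : base_variation k s u x ord0 A = anchor (u x) (coordinate k A).
Proof. by rewrite mxE (anchor_frame_expand (u x) _ sx). Qed.

Lemma lift_formC u a b : lift_form u a b = lift_form u b a.
Proof.
have sym c d : (fun y => G y (fsec s c y) (fsec s d y))
    = (fun y => G y (fsec s d y) (fsec s c y)).
  by apply/funext => y; rewrite bmetric_sym.
rewrite /lift_form addrAC (sym a b); apply: congr2; first apply: congr2.
- by [].
- by apply: eq_bigr => c _; rewrite bmetric_sym.
- by apply: eq_bigr => c _; rewrite bmetric_sym.
Qed.

Lemma bracket_fibre_variation u (e : 'I_r -> section E) b c : Sec u ->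
  (forall a, Sec (e a)) -> (\forall y \near x, forall a, e a y = fsec s a y) ->
  component s c (bracket u (e b) x) = - fibre_variation k s u x b c.
Proof.
move=> Su Se He; rewrite (bracket_frame _ _ fs sx Su Se He) mxE; congr (- (_ - _)).
have us := (SecP u).1 Su x s fs sx c.
by rewrite (tangent_expand (anchor_tangent _) ak kx us).
Qed.

(** The frame components of [u, s_a] are minus the fibre variation, which turns the two subtracted
    bracket terms into the two fibre sums of [lift_form]. This ties the coordinate-free description
    to d_T(u)[G]. *)
Lemma lie_metric_frame u (e : 'I_r -> section E) a b : Sec u ->
  (forall a, Sec (e a)) -> (\forall y \near x, forall a, e a y = fsec s a y) ->
  lie_metric u (e a) (e b) x = lift_form u a b.
Proof.
move=> Su Se He; have ex := nbhs_singleton He.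
have GE (c d : 'I_r) : G x (bracket u (e c) x) (fsec s d x)
    = - \sum_i fibre_variation k s u x c i * G x (fsec s i x) (fsec s d x).
  rewrite (component_expand (bracket u (e c) x) sx) bmetric_suml -sumrN.
  apply: eq_bigr => i _.
  by rewrite bmetricZl (bracket_fibre_variation _ _ Su Se He) mulNr.
rewrite /lie_metric !ex GE [G x (fsec s a x) _]bmetric_sym GE !opprK /lift_form.
congr (_ + _ + _); last by apply: eq_bigr => i _; rewrite bmetric_sym.
rewrite (@tangent_local _ _ _ _ _ (anchor_tangent (u x)) _
  (fun y => G y (fsec s a y) (fsec s b y))); first last.
- by apply: filterS He => y ey; rewrite !ey.
- exact: bmetric_smooth_global.
rewrite (tangent_expand (anchor_tangent _) ak kx); last exact: frame_metric_smooth.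
by apply: eq_bigr => A _; rewrite base_variationE.
Qed.

(** In the induced coordinates the metric is the quadratic function y^a y^b G_ab: derivatives in x
    act on G_ab, and derivatives in y give two sums, one for each factor y. *)
Lemma tangent_lift_quadratic u (y : 'rV[R]_r) :
  tangent_lift k s u (fun x' e => G x' e e) x y
  = \sum_a \sum_b y ord0 a * y ord0 b * lift_form u a b.
Proof.
pose K a b := G x (fsec s a x) (fsec s b x).
have Gs a b : smooth_near x (fun z => G z (fsec s a z) (fsec s b z)).
  exact: frame_metric_smooth.
have E1 A : 'D_(unit_row R A) (fun p => local_expression k s (fun x' e => G x' e e) p y)
    (cmap k x) = \sum_a \sum_b y ord0 a * y ord0 b
      * partial k A (fun z => G z (fsec s a z) (fsec s b z)) x.
  have -> : (fun p => local_expression k s (fun x' e => G x' e e) p y)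
      = (fun z => \sum_a \sum_b y ord0 a * y ord0 b * G z (fsec s a z) (fsec s b z))
        \o cinv k.
    by apply/funext => p; rewrite /local_expression bmetric_sumsum.
  have ts a b : smooth_near x
      (fun z => y ord0 a * y ord0 b * G z (fsec s a z) (fsec s b z)).
    by apply: smooth_near_mul => //; exact: smooth_near_cst.
  rewrite -[LHS]/(partial k A _ x) partial_sum //; last first.
    by move=> a; apply: smooth_near_sum.
  apply: eq_bigr => a _; rewrite partial_sum //.
  by apply: eq_bigr => b _; rewrite partial_scale.
have E2 c : 'D_(unit_row R c) (fun y' : 'rV[R]_r => local_expression k s (fun x' e => G x' e e)
    (cmap k x) y') y = \sum_a y ord0 a * (K c a + K a c).
  have -> : (fun y' : 'rV[R]_r => local_expression k s (fun x' e => G x' e e) (cmap k x) y')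
      = (fun y' : 'rV[R]_r => \sum_a \sum_b y' ord0 a * y' ord0 b * K a b).
    by apply/funext => y'; rewrite /local_expression cmapK // bmetric_sumsum.
  have D a b : is_derive y (unit_row R c) (fun y' : 'rV[R]_r => y' ord0 a * y' ord0 b * K a b)
     ((y ord0 a * unit_row R c ord0 b + y ord0 b * unit_row R c ord0 a) * K a b).
    have d1 := coord_is_derive y (unit_row R c) a.
    have d2 := coord_is_derive y (unit_row R c) b.
    have d3 := is_deriveM (is_deriveM d1 d2) (is_derive_cst (K a b) y (unit_row R c)).
    apply: is_derive_eq; rewrite scaler0 add0r /GRing.scale /= mulrC; ring.
  have DD := is_derive_bigsum (index_enum _) (fun a => is_derive_bigsum (index_enum _) (D a)).
  have [_ ->] := DD.
  have -> : \sum_a \sum_b (y ord0 a * unit_row R c ord0 b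
        + y ord0 b * unit_row R c ord0 a) * K a b
     = \sum_a (\sum_b unit_row R c ord0 b * (y ord0 a * K a b))
      + \sum_a unit_row R c ord0 a * (\sum_b y ord0 b * K a b).
    rewrite -big_split; apply: eq_bigr => a _; rewrite /= mulr_sumr -big_split.
    by apply: eq_bigr => b _ /=; ring.
  rewrite sum_unit_row -big_split /=; apply: eq_bigr => a _.
  by rewrite sum_unit_row; ring.
rewrite /tangent_lift /lift_form; under eq_bigr do rewrite E1.
under [X in _ + X]eq_bigr do rewrite E2.
have -> : \sum_A base_variation k s u x ord0 A * (\sum_a \sum_b y ord0 a * y ord0 b *
      partial k A (fun z => G z (fsec s a z) (fsec s b z)) x)
   = \sum_a \sum_b y ord0 a * y ord0 b * \sum_A base_variation k s u x ord0 A *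
      partial k A (fun z => G z (fsec s a z) (fsec s b z)) x.
  under eq_bigr do rewrite mulr_sumr.
  rewrite exchange_big; apply: eq_bigr => a _ /=.
  under eq_bigr do rewrite mulr_sumr.
  rewrite exchange_big; apply: eq_bigr => b _ /=.
  by rewrite mulr_sumr; apply: eq_bigr => A _; rewrite mulrCA.
have -> : \sum_c (y *m fibre_variation k s u x) ord0 c * (\sum_a y ord0 a * (K c a + K a c))
   = \sum_a \sum_b y ord0 a * y ord0 b * (\sum_c fibre_variation k s u x a c * K c b)
    + \sum_a \sum_b y ord0 a * y ord0 b * (\sum_c fibre_variation k s u x b c * K a c).
  rewrite -sum_mulmx_form [X in _ = _ + X]exchange_big /=.
  under [X in _ = _ + X]eq_bigr do under eq_bigr do rewrite [y _ _ * _]mulrC.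
  rewrite -(sum_mulmx_form y y _ (fun c b => K b c)) -big_split.
  apply: eq_bigr => c _; rewrite /= -mulrDr -big_split /=.
  by congr (_ * _); apply: eq_bigr => a _; rewrite mulrDr.
rewrite addrA -!big_split; apply: eq_bigr => a _ /=; rewrite -!big_split.
by apply: eq_bigr => b _ /=; rewrite -!mulrDr.
Qed.

End LocalCoordinates.

(** Testing on [v] that does not vanish at [x] is enough because frame sections never vanish, and it
    supplies the nonzero section that [anchor_bracket] needs. *)
Lemma killing_intro u : Sec u ->
  (forall v w x, Sec v -> Sec w -> v x != 0 -> lie_metric u v w x = 0) ->
  killing_sections G u.
Proof.
move=> Su H; split=> // k s x y ak fs kx sx.
have [e [Se He]] := frame_extend fs sx.
rewrite tangent_lift_quadratic //; apply: big1 => a _; apply: big1 => b _.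
rewrite -(lie_metric_frame ak fs kx sx _ _ Su Se He) H ?mulr0 //.
rewrite (nbhs_singleton He); apply/eqP => e0.
have := component_fsec a a sx; rewrite e0 component0 eqxx => /eqP.
by rewrite eq_sym oner_eq0.
Qed.

(** The Killing condition kills a quadratic form, hence by polarization the bilinear form on the
    frame, hence by tensoriality its value on all sections. *)
Lemma killing_lie_metric u : killing_sections G u ->
  forall v w x, Sec v -> Sec w -> lie_metric u v w x = 0.
Proof.
move=> [Su H] v w x Sv Sw.
have [k ak kx] := atlas_cover x; have [s fs sx] := @frames_cover _ _ _ _ E x.
have [e [Se He]] := frame_extend fs sx.
have B0 : forall a b, lift_form k s x u a b = 0.
  apply: quadratic_form_eq0 => [a b|y]; first exact: lift_formC.
  by rewrite -tangent_lift_quadratic //; exact: H.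
rewrite (lie_metric_expand fs sx Su Sv Sw Se He) big1 // => a _.
rewrite lie_metric_sym (lie_metric_expand fs sx Su Sw (Se a) Se He) big1 ?mulr0 // => b _.
by rewrite (lie_metric_frame ak fs kx sx _ _ Su Se He) B0 mulr0.
Qed.

Lemma killing_lie_subalgebra : lie_subalgebra (killing_sections G).
Proof.
have S0 := @Sec0 _ _ _ _ E.
split.
- by move=> u [].
- apply: killing_intro => // v w x Sv Sw _.
  rewrite /lie_metric anchor0 (bracket_antisym S0 Sv) (bracket_antisym S0 Sw) !bracket0r //.
  by rewrite oppr0 bmetric0l bmetric_sym bmetric0l !subr0.
- move=> a u v Ku Kv; have [[Su _] [Sv _]] := (Ku, Kv).
  apply: killing_intro => [|w w' x Sw Sw' _]; first exact: Sec_comb.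
  have := killing_lie_metric Ku x Sw Sw'; have := killing_lie_metric Kv x Sw Sw'.
  rewrite /lie_metric !bracket_linear // anchor_linear /section_comb bmetric_linearl.
  rewrite ![G x (w x) _]bmetric_sym bmetric_linearl => H1 H2.
  rewrite -[LHS]/(a * anchor (u x) (fun y => G y (w y) (w' y))
    + anchor (v x) (fun y => G y (w y) (w' y)) - _ - _).
  move: (anchor (u x) _) (anchor (v x) _) (G x (bracket u w x) _) (G x (bracket v w x) _)
    (G x (bracket u w' x) _) (G x (bracket v w' x) _) H1 H2 => p q b c d e H1 H2.
  have -> : a * p + q - (a * b + c) - (a * d + e) = a * (p - b - d) + (q - c - e) by ring.
  by rewrite H1 H2 mulr0 addr0.
- move=> u v Ku Kv; have [[Su _] [Sv _]] := (Ku, Kv).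
  have Suv := bracket_smooth Su Sv.
  apply: killing_intro => // w w' x Sw Sw' wx.
  (* A Killing section acts on the pairing by the Leibniz rule. *)
  have der (t : section E) (v1 v2 : section E) : killing_sections G t -> Sec v1 -> Sec v2 ->
      forall y, anchor (t y) (fun z => G z (v1 z) (v2 z))
        = G y (bracket t v1 y) (v2 y) + G y (v1 y) (bracket t v2 y).
    move=> Kt S1 S2 y; have := killing_lie_metric Kt y S1 S2.
    by rewrite /lie_metric -addrA -opprD => /eqP; rewrite subr_eq0 => /eqP.
  (* The products in which each argument is bracketed once are symmetric in [t] and [t'], so they
     drop out of the commutator; the remaining terms combine by the Jacobi identity. *)
  have der2 (t t' : section E) : killing_sections G t -> killing_sections G t' ->
      anchor (t x) (fun y => anchor (t' y) (fun z => G z (w z) (w' z)))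
      = G x (bracket t (bracket t' w) x) (w' x) + G x (bracket t' w x) (bracket t w' x)
       + (G x (bracket t w x) (bracket t' w' x) + G x (w x) (bracket t (bracket t' w') x)).
    move=> Kt Kt'; have [[St _] [St' _]] := (Kt, Kt').
    have S1 := bracket_smooth St' Sw; have S2 := bracket_smooth St' Sw'.
    have -> : (fun y => anchor (t' y) (fun z => G z (w z) (w' z)))
       = (fun y => G y (bracket t' w y) (w' y) + G y (w y) (bracket t' w' y)).
      by apply/funext => y; exact: der.
    rewrite (tangent_add (anchor_tangent _)); try exact: bmetric_smooth_global.
    by rewrite !der.
  rewrite /lie_metric (anchor_bracket (w := w)) //; last exact: bmetric_smooth_global.
  rewrite !der2 // !bracket_bracket // bmetricDl bmetricNl.
  rewrite [G x (w x) (_ - _)]bmetric_sym bmetricDl bmetricNl.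
  rewrite ![G x (bracket _ (bracket _ w') x) (w x)]bmetric_sym.
  move: (G x (bracket u (bracket v w) x) _) (G x (bracket v (bracket u w) x) _)
    (G x (w x) (bracket u (bracket v w') x)) (G x (w x) (bracket v (bracket u w') x))
    (G x (bracket v w x) _) (G x (bracket u w x) _) => *; ring.
Qed.

End LieDerivativeMetric.

(** * The Lagrangian and its variation *)

Lemma is_derive_mulf (R : realType) (V : normedModType R) (f h : V -> R)
    (df dh : R) (x v : V) : is_derive x v f df -> is_derive x v h dh ->
  is_derive x v (fun y => f y * h y) (df * h x + f x * dh).
Proof.
move=> Df Dh; refine (is_derive_eq (is_deriveM Df Dh) _).
by rewrite /GRing.scale /= addrC mulrC.
Qed.

(** * Positivity of the Gram matrix of the source metric *)

Section GramMatrix.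
Context {R : realType} {d : nat} {S : manifold R d}.
Variables (g : riemannian_metric S) (c : chart R d S) (z : S).
Hypotheses (ac : atlas c) (cz : cdom c z).

Lemma tangent_space0 : tangent_space z (0 : (S -> R) -> R).
Proof.
by split=> // *; rewrite -?[LHS]/(0 : R) -?[RHS]/(_ * 0 + 0) -?[RHS]/(0 * _ + _ * 0)
  ?mulr0 ?mul0r ?addr0.
Qed.

Lemma tangent_space_comb (a : R) D D' : tangent_space z D -> tangent_space z D' ->
  tangent_space z (a *: D + D').
Proof.
move=> [h1 h2 h3] [h1' h2' h3'].
have E f : (a *: D + D') f = a * D f + D' f by [].
split=> [f nf|b f h fz hz|f h fz hz]; rewrite !E.
- by rewrite h1 // h1' // mulr0 addr0.
- by rewrite h2 // h2' //; ring.
- by rewrite h3 // h3' //; ring.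
Qed.

Let vector (v : 'rV[R]_d) (t : seq 'I_d) : (S -> R) -> R :=
  \sum_(i <- t) v ord0 i *: coordinate_vector c i z.

Let vector_tangent v t : tangent_space z (vector v t).
Proof.
rewrite /vector; elim: t => [|i t IH]; first by rewrite big_nil; exact: tangent_space0.
by rewrite big_cons; apply: tangent_space_comb => //; exact: coordinate_vector_tangent.
Qed.

Let gmetric_comb (a : R) D D' D'' : tangent_space z D -> tangent_space z D' ->
  tangent_space z D'' -> g z (a *: D + D') D'' = a * g z D D'' + g z D' D''.
Proof. by have [h _ _] := gmetric_inner g z; exact: h. Qed.

Let gmetricC D D' : tangent_space z D -> tangent_space z D' -> g z D D' = g z D' D.
Proof. by have [_ h _] := gmetric_inner g z; exact: h. Qed.

Let gmetric_vector v t D : tangent_space z D ->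
  g z (vector v t) D = \sum_(i <- t) v ord0 i * g z (coordinate_vector c i z) D.
Proof.
move=> DT; rewrite /vector; elim: t => [|i t IH].
  rewrite !big_nil; have T0 := tangent_space0.
  by have := gmetric_comb (-1) T0 T0 DT; rewrite scaler0 addr0 mulN1r addNr.
rewrite !big_cons gmetric_comb ?IH //.
- exact: coordinate_vector_tangent.
- exact: vector_tangent.
Qed.

(** The quadratic form is the squared length of the tangent vector with coordinates [v]; applying
    that vector to the coordinate functions recovers [v], so it is nonzero. *)
Lemma gram_posdef (v : 'rV[R]_d) : v != 0 ->
  0 < (v *m gram_matrix g c z *m v^T) ord0 ord0.
Proof.
move=> v0; pose D := vector v (index_enum 'I_d).
have DT : tangent_space z D by exact: vector_tangent.
have -> : (v *m gram_matrix g c z *m v^T) ord0 ord0 = g z D D.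
  rewrite gmetric_vector // mxE; under eq_bigr do rewrite mxE mulr_suml.
  rewrite exchange_big; apply: eq_bigr => i _ /=.
  rewrite gmetricC ?gmetric_vector //; try exact: coordinate_vector_tangent.
  rewrite mulr_sumr; apply: eq_bigr => j _.
  rewrite !mxE -mulrA [g z (coordinate_vector c j z) _]gmetricC; try exact: coordinate_vector_tangent.
  by congr (_ * _); rewrite mulrC.
have [_ _ h] := gmetric_inner g z; apply: h => //.
apply: contra_neq v0 => D0; apply/rowP => i; rewrite mxE.
have Di : D (coordinate c i) = v ord0 i.
  rewrite /D /vector fct_sumE (bigD1_seq i) ?mem_index_enum ?index_enum_uniq //= big1 => [|j ji].
    rewrite addr0 -[LHS]/(_ * coordinate_vector c i z _) coordinate_vectorE; last first.
      exact: smooth_near_coordinate.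
    by rewrite partial_coordinate // eqxx mulr1.
  rewrite -[LHS]/(_ * coordinate_vector c j z _) coordinate_vectorE; last first.
    exact: smooth_near_coordinate.
  by rewrite partial_coordinate // (negbTE ji) mulr0.
by rewrite -Di D0.
Qed.

Lemma gram_unitmx : gram_matrix g c z \in unitmx.
Proof.
rewrite -row_free_unit -kermx_eq0; apply/rowV0P => v /sub_kermxP vg.
apply/eqP; apply: contraT => /gram_posdef; rewrite vg mul0mx mxE ltxx.
by [].
Qed.

(** With w = v A^-1, the value is that of the Gram form at [w], up to transposing a 1 by 1
    matrix. *)
Lemma invmx_gram_posdef (v : 'rV[R]_d) : v != 0 ->
  0 < (v *m invmx (gram_matrix g c z) *m v^T) ord0 ord0.
Proof.
move=> v0; have U := gram_unitmx; set A := gram_matrix g c z in U *.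
pose w := v *m invmx A.
have w0 : w != 0.
  apply: contra_neq v0 => w0; have := congr1 (mulmx^~ A) w0.
  by rewrite /w mulmxKV // mul0mx.
have := gram_posdef w0; rewrite -/A /w mulmxKV //.
have -> : v *m (v *m invmx A)^T = (v *m invmx A *m v^T)^T by rewrite [RHS]trmx_mul trmxK.
by rewrite mxE.
Qed.

Lemma sqrt_det_gram_gt0 : 0 < Num.sqrt `|\det (gram_matrix g c z)|.
Proof. by rewrite sqrtr_gt0 normr_gt0 -unitfE -unitmxE gram_unitmx. Qed.

End GramMatrix.

Section LagrangianVariation.
Context {R : realType} {d n : nat} {S : manifold R d} {M : manifold R n}.
Context {r : nat} {E : lie_algebroid M r}.
Variables (g : riemannian_metric S) (G : bundle_metric E).
Variables (c : chart R d S) (k : chart R n M) (s : local_frame E r) (z : S) (x : M).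
Hypotheses (ak : atlas k) (fs : frames s) (kx : cdom k x) (sx : fdom s x).

(** Only the values of the fields vary, while the source metric is fixed at [z]. The product rule
    yields three terms, from G_ab and from each factor chi, and these are the three sums of
    [lift_form]. As [X] is arbitrary, the formula serves both inclusions. *)
Lemma lagrangian_is_derive (u : section E) (X : 'M[R]_(d, r)) :
  is_derive (0 : R) (1 : R) (fun eps : R => lagrangian g G c k s z
     (cmap k x + eps *: base_variation k s u x)
     (X + eps *: (X *m fibre_variation k s u x)))
   (2^-1 * (Num.sqrt `|\det (gram_matrix g c z)| *
     \sum_i \sum_j invmx (gram_matrix g c z) i j *
       \sum_a \sum_b X i a * X j b * lift_form G k s x u a b)).
Proof.
set N := fibre_variation k s u x; set bv := base_variation k s u x.
set h := invmx _; set w := Num.sqrt _; set Y := X *m N.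
pose K a b x' := G x' (fsec s a x') (fsec s b x').
pose dK a b := \sum_A bv ord0 A * partial k A (K a b) x.
have d1 i a : is_derive (0 : R) (1 : R) (fun eps : R => (X + eps *: Y) i a) (Y i a).
  have -> : (fun eps : R => (X + eps *: Y) i a) = (fun eps : R => X i a + eps * Y i a).
    by apply/funext => eps; rewrite !mxE.
  by apply: is_derive_eq; rewrite /GRing.scale /=; ring.
have d2 a b : is_derive (0 : R) (1 : R)
    (fun eps : R => (K a b \o cinv k) (cmap k x + eps *: bv)) (dK a b).
  have -> : (fun eps : R => (K a b \o cinv k) (cmap k x + eps *: bv))
     = (fun eps : R => (K a b \o cinv k) (eps *: bv + cmap k x)).
    by apply/funext => eps; rewrite addrC.
  apply/(is_derive_line0P (K a b \o cinv k)); apply: partial_is_derive_row => //.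
  exact: frame_metric_smooth.
have d3 i j a b : is_derive (0 : R) (1 : R) (fun eps : R =>
    h i j * (X + eps *: Y) j b * (X + eps *: Y) i a
      * (K a b \o cinv k) (cmap k x + eps *: bv))
    (h i j * (X j b * X i a * dK a b + Y i a * (X j b * K a b x)
      + Y j b * (X i a * K a b x))).
  have D := is_derive_mulf (is_derive_mulf (is_derive_mulf
    (is_derive_cst (h i j) (0 : R) (1 : R)) (d1 j b)) (d1 i a)) (d2 a b).
  have EX : X + (0 : R) *: Y = X by rewrite scale0r addr0.
  have Ep : cmap k x + (0 : R) *: bv = cmap k x by rewrite scale0r addr0.
  refine (is_derive_eq D _); rewrite /= EX Ep (cmapK kx).
  move: (dK a b) (K a b x) (Y i a) (Y j b) (X i a) (X j b) (h i j) => *; ring.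
have D := is_derive_mulf (is_derive_cst (2^-1 : R) (0 : R) (1 : R))
  (is_derive_mulf (is_derive_cst (w : R) (0 : R) (1 : R))
   (is_derive_bigsum (index_enum _) (fun i => is_derive_bigsum (index_enum _) (fun j =>
    is_derive_bigsum (index_enum _) (fun a => is_derive_bigsum (index_enum _) (d3 i j a)))))).
refine (is_derive_eq D _).
rewrite /= !mul0r !add0r; congr (_ * (_ * _)).
apply: eq_bigr => i _; apply: eq_bigr => j _.
under eq_bigr do rewrite -mulr_sumr.
rewrite -mulr_sumr; congr (_ * _).
pose yi := row i X; pose yj := row j X.
have L1 : \sum_a \sum_b Y i a * (X j b * K a b x)
   = \sum_a \sum_b yi ord0 a * yj ord0 b * \sum_c N a c * K c b x.
  rewrite -(sum_mulmx_form yi yj N (fun c b => K c b x)); apply: eq_bigr => a _.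
  rewrite -row_mul -/Y mxE mulr_sumr; apply: eq_bigr => b _.
  by rewrite !mxE.
have L2 : \sum_a \sum_b Y j b * (X i a * K a b x)
   = \sum_a \sum_b yi ord0 a * yj ord0 b * \sum_c N b c * K a c x.
  rewrite exchange_big [RHS]exchange_big /=.
  under [RHS]eq_bigr do under eq_bigr do rewrite [yi _ _ * _]mulrC.
  rewrite -(sum_mulmx_form yj yi N (fun c b => K b c x)); apply: eq_bigr => b _.
  rewrite -row_mul -/Y mxE mulr_sumr; apply: eq_bigr => a _.
  by rewrite !mxE.
rewrite /lift_form -/N -/bv.
transitivity (\sum_a \sum_b X j b * X i a * dK a b
  + \sum_a \sum_b Y i a * (X j b * K a b x) + \sum_a \sum_b Y j b * (X i a * K a b x)).
  rewrite -!big_split; apply: eq_bigr => a _ /=.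
  by rewrite -!big_split.
rewrite L1 L2 -!big_split; apply: eq_bigr => a _ /=; rewrite -!big_split.
by apply: eq_bigr => b _ /=; rewrite /yi /yj !mxE [X j b * _]mulrC -!mulrDr.
Qed.

End LagrangianVariation.

(** * Field configurations built from algebroid paths *)

Lemma sum_antisym_eq0 (R : realType) (r : nat) (eta : 'I_r -> R)
    (Q : 'I_r -> 'I_r -> R) : (forall a b, Q a b = - Q b a) ->
  \sum_a \sum_b eta a * eta b * Q b a = 0.
Proof.
move=> Qa; set T := \sum_a _.
have : T = - T.
  rewrite {1}/T exchange_big -sumrN; apply: eq_bigr => a _ /=.
  rewrite -sumrN; apply: eq_bigr => b _.
  by rewrite Qa mulrN [eta b * _]mulrC.
by move/eqP; rewrite -subr_eq0 opprK -mulr2n mulrn_eq0 => /eqP.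
Qed.

Section FieldFromPath.
Context {R : realType} {d n : nat} {S : manifold R d} {M : manifold R n}.
Context {r : nat} {E : lie_algebroid M r}.
Variables (k : chart R n M) (s : local_frame E r) (y : 'rV[R]_r).
Hypotheses (ak : atlas k) (fs : frames s).
Variables (e : R) (gamma : R -> 'rV[R]_n) (f : S -> R).

Let Y : section E := fun x => \sum_a y ord0 a *: fsec s a x.
Let W : set 'rV[R]_n := cmap k @` (fdom s `&` cdom k).
Let V (A : 'I_n) (p : 'rV[R]_n) : R := anchor (Y (cinv k p)) (coordinate k A).

Let oW : open W.
Proof. by apply: image_chart_open; exact: fdom_open. Qed.

Let WP p : W p -> [/\ fdom s (cinv k p), cdom k (cinv k p) & cmap k (cinv k p) = p].
Proof. by move=> [x [sx kx] <-]; rewrite cmapK. Qed.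

Let Y_near x : fdom s x -> section_near x Y.
Proof.
move=> sx; apply: (section_near_frame fs sx) => a.
apply: (@smooth_near_eq _ _ _ _ (fun x' =>
  \sum_b y ord0 b * component s a (fsec s b x'))).
  apply: smooth_near_sum => b; apply: smooth_near_mul; first exact: smooth_near_cst.
  exact: frame_change_smooth.
apply: filterE => x'; rewrite component_sum.
by apply: eq_bigr => b _; rewrite componentZ.
Qed.

Let VW A : Cinfty W (V A).
Proof.
apply: (smooth_near_Cinfty (f := fun x => anchor (Y x) (coordinate k A)) ak oW).
move=> p /[dup] Wp /WP [sp kp pE]; split; first by exists (cinv k p).
by apply: anchor_smooth_near; [exact: Y_near|exact: smooth_near_coordinate].
Qed.

Lemma algebroid_path_exists x : cdom k x -> fdom s x ->
  exists2 e : R, 0 < e & exists gamma : R -> 'rV[R]_n,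
    gamma 0 = cmap k x /\ forall t : R, `|t| <= e -> W (gamma t) /\
      forall A, is_derive t 1 (fun t => gamma t ord0 A) (V A (gamma t)).
Proof. by move=> kx sx; apply: ODE_solution => //; exists x. Qed.

Hypothesis gammaP : forall t : R, `|t| < e -> W (gamma t) /\
  forall A, is_derive t 1 (fun t => gamma t ord0 A) (V A (gamma t)).
Hypothesis f_smooth : forall z, smooth_near z f.
Hypothesis f_small : forall z, `|f z| < e.

Let phi (z : S) : M := cinv k (gamma (f z)).

Let phiP z : [/\ fdom s (phi z), cdom k (phi z) & cmap k (phi z) = gamma (f z)].
Proof. by have [/WP] := gammaP (f_small z). Qed.

Let phik z : cdom k (phi z).
Proof. by have [] := phiP z. Qed.
Let phis z : fdom s (phi z).
Proof. by have [] := phiP z. Qed.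

Let phi_coord z A : smooth_near z (fun z' => cmap k (phi z') ord0 A).
Proof.
have [c ac cz] := atlas_cover z.
have [N [oN Nz _ fN]] := smooth_near_chart ac cz (f_smooth z).
apply: (smooth_near_intro ac cz oN Nz).
have -> : (fun z' => cmap k (phi z') ord0 A) \o cinv c
    = (fun p => gamma ((f \o cinv c) p) ord0 A).
  by apply/funext => p /=; have [_ _ ->] := phiP (cinv c p).
by apply: (ODE_solution_Cinfty oW VW gammaP) => // p _ /=; exact: f_small.
Qed.

Let phi_continuous : continuous phi.
Proof.
move=> z; apply: (continuous_comp (f := fun z => gamma (f z)) (g := cinv k)).
  apply: continuous_for_row => A.
  apply: (@near_eq_continuous _ _ (fun z' => cmap k (phi z') ord0 A)).
    by apply: filterE => z'; have [_ _ ->] := phiP z'.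
  exact: smooth_near_continuous.
by have [_ kz <-] := phiP z; exact: cinv_continuous.
Qed.

Let comp_phi (F : M -> R) z : smooth_near (phi z) F -> smooth_near z (F \o phi).
Proof.
apply: (smooth_near_comp ak (phik z)); last by move=> A; exact: phi_coord.
exact: phi_continuous.
Qed.

Let partial_phi c i z A : atlas c -> cdom c z ->
  partial c i (fun z' => cmap k (phi z') ord0 A) z
  = partial c i f z * anchor (Y (phi z)) (coordinate k A).
Proof.
move=> ac cz; have Df := partial_is_derive i ac cz (f_smooth z).
have [_ HA] := gammaP (f_small z).
suff : is_derive (cmap c z) (unit_row R i) ((fun z' => cmap k (phi z') ord0 A) \o cinv c)
    (anchor (Y (phi z)) (coordinate k A) * partial c i f z).
  by move=> [_ H]; rewrite /partial H mulrC.
have -> : (fun z' => cmap k (phi z') ord0 A) \o cinv c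
    = (fun p => gamma ((f \o cinv c) p) ord0 A).
  by apply/funext => p /=; have [_ _ ->] := phiP (cinv c p).
apply/is_derive_line0P.
apply: (is_derive1_comp (f := fun t => gamma t ord0 A)
  (g := fun t : R => (f \o cinv c) (t *: unit_row R i + cmap c z))).
  by rewrite scale0r add0r /= cmapK //; exact: HA.
by apply/(is_derive_line0P (f \o cinv c)).
Qed.

(** Since [gamma] is an integral curve of the anchor of [Y], this is d(F o phi) = rho(Y)(F) df. It
    will be applied to coordinates of any chart and to components of [Y] in any frame. *)
Let partial_comp_phi c i z (F : M -> R) : atlas c -> cdom c z ->
  smooth_near (phi z) F ->
  partial c i (F \o phi) z = partial c i f z * anchor (Y (phi z)) F.
Proof.
move=> ac cz Fz.
have pc : {for z, continuous phi} by exact: phi_continuous.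
rewrite (partial_comp ak (phik z) pc (phi_coord z) i ac cz Fz).
rewrite (tangent_expand (anchor_tangent _) ak (phik z) Fz) mulr_sumr.
by apply: eq_bigr => A _; rewrite partial_phi // mulrA.
Qed.

(** The bundle map df tensor Y: the algebroid path over [gamma] precomposed with the differential of
    [f]. *)
Definition path_field (z : S) (D : (S -> R) -> R) : E (phi z) := D f *: Y (phi z).

Let pullbackE c s' i a z : pullback_component path_field c s' i a z
  = partial c i f z * component s' a (Y (phi z)).
Proof. by rewrite /pullback_component componentZ coordinate_vectorE. Qed.

Let eta_smooth s' a z : frames s' -> fdom s' (phi z) ->
  smooth_near (phi z) (fun x => component s' a (Y x)).
Proof. by move=> fs' s'z; exact: (Y_near (phis z)). Qed.

Let open_pre (U : set M) : open U -> open (phi @^-1` U).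
Proof. by have /continuousP H := @phi_continuous; exact: H. Qed.

(** The anchor condition is the identity for d(F o phi) with [F] a coordinate. In the bracket
    condition the second derivatives of [f] are symmetric and the first-order terms are symmetric in
    i and j, so the right side vanishes. The definition is transparent so that base and components
    can be read off by computation. *)
Definition path_configuration : field_configuration S E.
Proof.
refine (@FieldConfiguration _ _ _ _ _ _ E phi path_field _ _ _ _ _ _).
- move=> z a D D' _ _; rewrite /path_field.
  rewrite -[(a *: D + D') f]/(a * D f + D' f).
  by rewrite scalerDl scalerA.
- exact: phi_continuous.
- move=> k' ak' A; apply/smooth_onP; first by apply: open_pre; exact: cdom_open.
  move=> z k'z; apply: (@comp_phi (coordinate k' A)).
  exact: smooth_near_coordinate.
- move=> c s' ac fs' i a; apply/smooth_onP.
    by apply: openI; [exact: cdom_open|apply: open_pre; exact: fdom_open].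
  move=> z [cz s'z]; have -> : pullback_component path_field c s' i a
      = (fun z => partial c i f z * component s' a (Y (phi z))).
    by apply/funext => z'; rewrite pullbackE.
  apply: smooth_near_mul; first exact: smooth_near_partial.
  exact: (@comp_phi (fun x => component s' a (Y x)) z (eta_smooth a fs' s'z)).
- move=> c k' s' z ac ak' fs' cz k'z s'z i A.
  rewrite -[LHS]/(partial c i (coordinate k' A \o phi) z).
  rewrite (@partial_comp_phi c i z (coordinate k' A)) //; last exact: smooth_near_coordinate.
  rewrite (anchor_frame_expand _ _ s'z) mulr_sumr; apply: eq_bigr => a _.
  by rewrite pullbackE mulrA.
- move=> c s' z ac fs' cz s'z i j a.
  have pb l : pullback_component path_field c s' l a
      = (fun z => partial c l f z * component s' a (Y (phi z))).
    by apply/funext => z'; rewrite pullbackE.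
  have Fs := eta_smooth a fs' s'z.
  have pm l m : partial c l (fun z => partial c m f z * component s' a (Y (phi z))) z
     = partial c l (partial c m f) z * component s' a (Y (phi z))
      + partial c m f z * (partial c l f z * anchor (Y (phi z)) (fun x => component s' a (Y x))).
    rewrite partial_mul //.
    + by rewrite -(@partial_comp_phi c l z _ ac cz Fs).
    + exact: smooth_near_partial.
    + exact: (@comp_phi _ z Fs).
  rewrite !pb (pm i j) (pm j i) (partial_comm i j ac cz (f_smooth z)).
  have -> (p q t u : R) : p + q * (t * u) - (p + t * (q * u)) = 0 by ring.
  (* Both chi_i and chi_j are multiples of the components of [Y], so the left side contracts the
     antisymmetric structure functions with a symmetric tensor. *)
  have Z := @sum_antisym_eq0 R r (fun a => component s' a (Y (phi z)))
    (fun b b' => structure_fun s' b b' a (phi z)) (fun b b' =>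
      structure_fun_antisym b b' a fs' s'z).
  rewrite -[RHS](mulr0 (partial c i f z * partial c j f z)) -[X in _ = _ * X]Z.
  rewrite [RHS]mulr_sumr; apply: eq_bigr => b _; rewrite [RHS]mulr_sumr.
  apply: eq_bigr => b' _; rewrite !pullbackE.
  move: (partial c i f z) (partial c j f z) (component s' b _) (component s' b' _)
    (structure_fun _ _ _ _ _) => *; ring.
Defined.

Lemma path_configuration_base z : fbase path_configuration z = cinv k (gamma (f z)).
Proof. by []. Qed.

Lemma path_configuration_component c i a z :
  pullback_component (@Defs.fmap _ _ _ _ _ _ _ path_configuration) c s i a z
  = partial c i f z * y ord0 a.
Proof.
rewrite -[LHS]/(pullback_component path_field c s i a z) pullbackE; congr (_ * _).
rewrite /Y component_sum (bigD1 a) //= componentZ component_fsec // eqxx mulr1.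
rewrite big1 ?addr0 // => b ba; rewrite componentZ component_fsec //.
by rewrite eq_sym (negbTE ba) mulr0.
Qed.

End FieldFromPath.

Lemma field_configuration_exists (R : realType) (d n r : nat) (S : manifold R d)
    (M : manifold R n) (E : lie_algebroid M r) (c : chart R d S) (k : chart R n M)
    (s : local_frame E r) (z : S) (x : M) (i0 : 'I_d) (y : 'rV[R]_r) :
  atlas c -> cdom c z -> atlas k -> cdom k x -> frames s -> fdom s x ->
  exists Phi : field_configuration S E, fbase Phi z = x /\
    forall i a, pullback_component (@Defs.fmap _ _ _ _ _ _ _ Phi) c s i a z
      = (i == i0)%:R * y ord0 a.
Proof.
move=> ac cz ak kx fs sx.
have [e e0 [gamma [g0 gP]]] := algebroid_path_exists y ak fs kx sx.
have e2 : 0 < e / 2 by rewrite divr_gt0.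
(* The coordinate of index [i0] centred at [z]: its value at [z] is 0 and its differential there is
   that of the coordinate. *)
pose l (z' : S) := coordinate c i0 z' + (-1) * coordinate c i0 z.
have lz : l z = 0 by rewrite /l mulN1r subrr.
have ls z' : cdom c z' -> smooth_near z' l.
  move=> cz'; apply: smooth_near_add; first exact: smooth_near_coordinate.
  exact: smooth_near_cst.
(* A cutoff supported here makes the product with [l] smooth on all of the source and smaller than
   [e] everywhere, while near [z] it is still [l]. *)
pose N := [set z' : S | cdom c z' /\ `|l z'| <= e / 2].
have nN : nbhs z N.
  have := smooth_near_continuous (ls z cz) => /continuous_forP /(_ _ e2).
  apply: filterS2 (near_cdom cz) => z' cz'; rewrite lz sub0r normrN.
  by split.
have [K [b [KN bb]]] := manifold_bump nN.
have fs0 : forall z', smooth_near z' (fun z' => b z' * l z').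
  by apply: (smooth_near_cutoff bb) => z' /KN[cz' _]; exact: ls.
case: bb => clK bs b01 b1 b0.
have fe z' : `|b z' * l z'| < e.
  have [Kz|Kz] := pselect (K z'); last by rewrite b0 // mul0r normr0.
  have [_ lz'] := KN _ Kz; have /andP[b0' b1'] := b01 z'.
  rewrite normrM ger0_norm //; apply: (@le_lt_trans _ _ (e / 2)).
    by rewrite -[leRHS]mul1r ler_pM.
  by rewrite ltr_pdivrMr // ltr_pMr // ltr1n.
have gP' t : `|t| < e -> _ := fun h => gP t (ltW h).
exists (path_configuration ak fs gP' fs0 fe); split.
  by rewrite path_configuration_base lz mulr0 g0 cmapK.
move=> i a; rewrite path_configuration_component; congr (_ * _).
have ll : smooth_near z l by exact: ls.
rewrite partial_mul // lz mulr0 add0r (nbhs_singleton b1) mul1r.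
rewrite partial_add ?partial_cst ?addr0 ?partial_coordinate //.
  exact: smooth_near_coordinate.
exact: smooth_near_cst.
Qed.

Lemma killing_internal (R : realType) (d n r : nat)
    (S : manifold R d) (g : riemannian_metric S)
    (M : manifold R n) (E : lie_algebroid M r) (G : bundle_metric E) :
  killing_sections G `<=` internal_symmetries g G.
Proof.
move=> u [Su Ku]; split=> [|Phi c k s z ac ak fs cz kx sx x X]; first exact: Su.
have B0 : forall a b, lift_form G k s x u a b = 0.
  apply: quadratic_form_eq0 => [a b|y]; first exact: lift_formC.
  by rewrite -tangent_lift_quadratic //; exact: Ku.
refine (is_derive_eq (lagrangian_is_derive g G c z ak fs kx sx u X) _).
rewrite big1 ?mulr0 // => i _; rewrite big1 // => j _.
rewrite big1 ?mulr0 // => a _; rewrite big1 // => b _.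
by rewrite B0 mulr0.
Qed.

(** On the field with the single nonzero row [y] the variation is a positive multiple of the tangent
    lift at [y]. A point of the source and a direction at it must exist: over an empty source there
    are no conditions, and in dimension 0 the Lagrangian is an empty sum, so every smooth section
    would be a symmetry. *)
Lemma internal_killing (R : realType) (d n r : nat)
    (S : manifold R d) (g : riemannian_metric S)
    (M : manifold R n) (E : lie_algebroid M r) (G : bundle_metric E) :
  (0 < d)%N -> [set: S] !=set0 ->
  internal_symmetries g G `<=` killing_sections G.
Proof.
move=> d0 [z _] u [Su Iu]; split=> [|k s x y ak fs kx sx]; first exact: Su.
have [c ac cz] := atlas_cover z.
pose i0 := Ordinal d0.
have [Phi [Px Pc]] := field_configuration_exists i0 y ac cz ak kx fs sx.
have := Iu Phi c k s z ac ak fs cz; rewrite Px => /(_ kx sx) /=.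
set X := \matrix_(i, a) _.
have XE i a : X i a = unit_row R i0 ord0 i * y ord0 a by rewrite !mxE Pc eq_sym.
have [_ D1] := lagrangian_is_derive g G c z ak fs kx sx u X.
move=> [_]; rewrite D1.
set h := invmx _; set w := Num.sqrt _.
(* A diagonal entry is the value of the positive definite inverse form at a unit vector. *)
have h0 : 0 < h i0 i0.
  have e0 : unit_row R i0 != 0.
    apply/eqP => /rowP /(_ i0); rewrite !mxE !eqxx => /eqP.
    by rewrite oner_eq0.
  have := invmx_gram_posdef g ac cz e0.
  by rewrite -/h /unit_row -rowE trmx_delta -colE !mxE.
have -> : \sum_i \sum_j h i j * (\sum_a \sum_b X i a * X j b * lift_form G k s x u a b)
   = h i0 i0 * tangent_lift k s u (fun x' e => G x' e e) x y.
  rewrite tangent_lift_quadratic //.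
  set T := (X in _ = _ * X).
  rewrite -(sum_unit_row i0 (fun i => h i i0 * T)); apply: eq_bigr => i _.
  rewrite -(sum_unit_row i0 (fun j => h i j * T)) mulr_sumr; apply: eq_bigr => j _.
  have -> : \sum_a \sum_b X i a * X j b * lift_form G k s x u a b
      = unit_row R i0 ord0 i * unit_row R i0 ord0 j * T.
    rewrite /T mulr_sumr; apply: eq_bigr => a _; rewrite mulr_sumr.
    by apply: eq_bigr => b _; rewrite !XE; ring.
  by move: T (h i j) (unit_row R i0 ord0 i) (unit_row R i0 ord0 j) => *; ring.
have w0 : 0 < w by exact: sqrt_det_gram_gt0.
move/eqP; rewrite !mulf_eq0 invr_eq0 pnatr_eq0 /= (gt_eqF w0) (gt_eqF h0) /=.
by move/eqP.
Qed.

Theorem proposition4p4 (R : realType) (d n r : nat)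
    (S : manifold R d) (g : riemannian_metric S)
    (M : manifold R n) (E : lie_algebroid M r) (G : bundle_metric E)
    (d_gt0 : (0 < d)%N) (S_nonempty : [set: S] !=set0) :
  [/\ lie_subalgebra (internal_symmetries g G),
      lie_subalgebra (killing_sections G) &
      internal_symmetries g G = killing_sections G].
Proof.
have IK : internal_symmetries g G = killing_sections G.
  by apply/seteqP; split; [exact: internal_killing|exact: killing_internal].
by rewrite IK; split=> //; exact: killing_lie_subalgebra.
Qed.
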